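(* Let $\mathbf{A}$ be a finite simple non-abelian Mal'cev algebra, let $n\geq 0$, let $e_1,\dots,e_n\in A$ be idempotents, let $\mathbf{B}$ be the countable atomless Boolean algebra, and let $x_1,\dots,x_n\in 2^\omega$ be distinct. Then: (1) $(\mathbf{A}^{\mathbf{B}})^{x_1,\dots,x_n}_{e_1,\dots,e_n}$ is $\omega$-categorical; (2) $\operatorname{Aut}\,(\mathbf{A}^{\mathbf{B}})^{x_1,\dots,x_n}_{e_1,\dots,e_n}$ has the small index property; (3) $\operatorname{Aut}\,(\mathbf{A}^{\mathbf{B}})^{x_1,\dots,x_n}_{e_1,\dots,e_n}$ has uncountable strong cofinality; in particular, it has uncountable cofinality and the Bergman property.
   Context: An algebra is a nonempty set with a family of finitary operations. It is Mal'cev if it has a ternary term operation $m$ satisfying $m(x,x,y)=y=m(y,x,x)$. A Mal'cev algebra is abelian if its basic operations can be represented as affine functions over a module; otherwise it is non-abelian. An element $e$ of an algebra $\mathbf{A}$ is an idempotent if $\{e\}$ is a subalgebra of $\mathbf{A}$. The idempotents $e_1,\dots,e_n$ need not be distinct and need not be all idempotents. The Stone space $X$ of a Boolean algebra $\mathbf{B}$ is its set of ultrafilters with basic open sets $\{x\in X : b\in x\}$, $b\in B$. The countable atomless Boolean algebra is unique up to isomorphism and its Stone space is the Cantor space $2^\omega$. The Boolean power $\mathbf{A}^{\mathbf{B}}$ is the subalgebra of the direct power $\mathbf{A}^X$ whose elements are the continuous functions $f\colon X\to A$, where $A$ is discrete. For pairwise distinct $x_1,\dots,x_n\in X$ and idempotents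 $e_1,\dots,e_n$ of $\mathbf{A}$, the filtered Boolean power $(\mathbf{A}^{\mathbf{B}})^{x_1,\dots,x_n}_{e_1,\dots,e_n}$ is the subalgebra of $\mathbf{A}^{\mathbf{B}}$ with universe $\{f\in A^{\mathbf{B}} : f(x_1)=e_1,\dots,f(x_n)=e_n\}$. A countable structure is $\omega$-categorical if its first-order theory has exactly one countable model up to isomorphism. For a countably infinite structure $M$, the group $G=\operatorname{Aut} M$ has the small index property if every subgroup of $G$ of index less than $2^{\aleph_0}$ contains the pointwise stabilizer in $G$ of some finite subset of $M$. The cofinality of a group $G$ is the smallest cardinal $\kappa$ such that $G$ is the union of a chain of length $\kappa$ of proper subgroups. The strong cofinality of $G$ is the smallest cardinal $\kappa$ such that $G$ is the union of a chain $(U_i)_{i<\kappa}$ of proper subsets of $G$ such that for all $i<j$ we have $U_i\subseteq U_j$, $U_i=U_i^{-1}$, and $U_iU_i\subseteq U_k$ for some $k\in\kappa$. A group $G$ has the Bergman property if for each generating subset $E$ of $G$ with $1\in E=E^{-1}$ there exists $k\in\mathbb{N}$ such that $E^k=G$. *)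

(* Defs.v *)
From HB Require Import structures.
From mathcomp Require Import all_boot all_order all_algebra.
From mathcomp Require Import mathcomp_extra boolp wochoice classical_sets.
From mathcomp Require Import functions cardinality filter topology.

Set Implicit Arguments.
Unset Strict Implicit.
Unset Printing Implicit Defensive.

Import Order.Theory.

Local Open Scope classical_set_scope.
Local Open Scope card_scope.

Record signature := Signature { symbol :> Type; arity : symbol -> nat }.

Record algebra (L : signature) := Algebra {
  carrier :> choiceType;
  op : forall s : L, ('I_(arity s) -> carrier) -> carrier;
  algebra_nonempty : inhabited carrier }.
Arguments op {L} a s _.

Section Algebras.
Variable L : signature.
Implicit Types A M N : algebra L.

Definition homomorphism M N (f : M -> N) :=
  forall (s : L) (a : 'I_(arity s) -> M), f (op M s a) = op N s (f \o a).

Definition isomorphic M N :=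
  exists f : M -> N, homomorphism f /\ bijective f.

Definition closed_under_ops A (S : set A) :=
  forall (s : L) (a : 'I_(arity s) -> A), (forall i, S (a i)) -> S (op A s a).

Definition subuniverse A (S : set A) := S !=set0 /\ closed_under_ops S.

Lemma subalgebra_op_subproof A (S : set A) (HS : subuniverse S) (s : L)
    (a : 'I_(arity s) -> S) : op A s (fun i => val (a i)) \in S.
Proof. by rewrite inE; apply: HS.2 => i; exact: set_valP. Qed.

Lemma subalgebra_nonempty A (S : set A) (HS : subuniverse S) : inhabited S.
Proof. by case: HS.1 => x /mem_set Sx; constructor; exact: (SigSub Sx). Qed.

Definition subalgebra A (S : set A) (HS : subuniverse S) : algebra L :=
  @Algebra L S (fun s a => SigSub (subalgebra_op_subproof HS a))
    (subalgebra_nonempty HS).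

Definition idempotent_element A (e : A) := subuniverse [set e].

Lemma direct_power_nonempty A (X : Type) : inhabited (X -> A).
Proof. by case: (algebra_nonempty A) => a; constructor; exact: (fun=> a). Qed.

Definition direct_power A (X : Type) : algebra L :=
  @Algebra L (X -> A) (fun s a => fun x => op A s (fun i => a i x))
    (direct_power_nonempty A X).

Definition congruence A (R : A -> A -> Prop) :=
  [/\ forall x, R x x, forall x y, R x y -> R y x,
      forall x y z, R x y -> R y z -> R x z
    & forall (s : L) (a b : 'I_(arity s) -> A),
        (forall i, R (a i) (b i)) -> R (op A s a) (op A s b)].

Definition simple_algebra A :=
  (exists x y : A, x <> y) /\
  forall R : A -> A -> Prop, congruence R ->
    (forall x y, R x y <-> x = y) \/ (forall x y, R x y).

(* Variables are de Bruijn indices: a term or formula of index [n] has its free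
   variables in ['I_n], and [FAll] binds index 0 of its body *)
Inductive term (n : nat) : Type :=
| TVar of 'I_n
| TApp (s : L) of ('I_(arity s) -> term n).

Fixpoint eval A n (v : 'I_n -> A) (t : term n) : A :=
  match t with
  | TVar i => v i
  | TApp s u => op A s (fun i => eval v (u i))
  end.

Inductive formula : nat -> Type :=
| FFalse n : formula n
| FEq n of term n & term n : formula n
| FImp n of formula n & formula n : formula n
| FAll n of formula n.+1 : formula n.

Definition extend (T : Type) n (a : T) (v : 'I_n -> T) : 'I_n.+1 -> T :=
  fun i => if unlift ord0 i is Some j then v j else a.

Fixpoint sat M n (phi : formula n) : ('I_n -> M) -> Prop :=
  match phi with
  | FFalse _ => fun=> False
  | FEq _ t u => fun v => eval v t = eval v u
  | FImp _ phi psi => fun v => sat phi v -> sat psi v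
  | FAll _ phi => fun v => forall a : M, sat phi (extend a v)
  end.

Definition sentence := formula 0.

Definition models M (phi : sentence) :=
  sat phi (fun i : 'I_0 => match notF (ltn_ord i) return M with end).

Definition model_of_theory M N := forall phi, models M phi -> models N phi.

(* [M] itself is a countable model of its theory, so "exactly one countable
   model up to isomorphism" says that every such model is isomorphic to [M] *)
Definition omega_categorical M :=
  countable [set: M] /\
  forall N, countable [set: N] -> model_of_theory M N -> isomorphic N M.

Definition malcev A :=
  exists m : term 3, forall x y : A,
    eval (tnth [tuple x; x; y]) m = y /\ eval (tnth [tuple y; x; x]) m = y.

Definition abelian_algebra A :=
  exists (R : pzRingType) (V : lmodType R) (phi : A -> V), bijective phi /\
    forall s : L, exists (r : 'I_(arity s) -> R) (c : V),
      forall a : 'I_(arity s) -> A,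
        phi (op A s a) = (c + \sum_(i < arity s) r i *: phi (a i))%R.

End Algebras.

Section Stone.
Context {d : Order.disp_t}.
Variable B : ctbDistrLatticeType d.
Implicit Types (a b c : B) (F G : set B).

Definition atom a := a <> \bot%O /\ forall c, (c <= a)%O -> c = \bot%O \/ c = a.

Definition atomless := \bot%O <> \top%O :> B /\ forall a, ~ atom a.

Definition boolean_filter F :=
  [/\ F \top%O, forall a b, F a -> F b -> F (a `&` b)%O
    & forall a b, (a <= b)%O -> F a -> F b].

Definition proper_filter F := boolean_filter F /\ ~ F \bot%O.

Definition ultrafilter F :=
  proper_filter F /\ forall G, proper_filter G -> F `<=` G -> G = F.

Definition stone : Type := set_type [set F | ultrafilter F].

HB.instance Definition _ := Choice.on stone.

Definition stone_basic b : set stone := [set x | val x b].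

Definition pointed_ba : pointedType :=
  HB.pack (Order.CTBDistrLattice.sort B)
    (isPointed.Build (Order.CTBDistrLattice.sort B) \bot%O).

Lemma stone_filter (x : stone) : ultrafilter (val x).
Proof. exact: set_valP x. Qed.

Lemma stone_basic_cover :
  \bigcup_(b in [set: pointed_ba]) stone_basic (b : B) = [set: stone].
Proof.
apply/seteqP; split=> // x _; exists (\top%O : B) => //.
by have [[[]]] := stone_filter x.
Qed.

Lemma stone_basic_join (a b : pointed_ba) (x : stone) :
  [set: pointed_ba] a -> [set: pointed_ba] b ->
  stone_basic (a : B) x -> stone_basic (b : B) x ->
  exists c : pointed_ba, [/\ [set: pointed_ba] c, stone_basic (c : B) x &
    stone_basic (c : B) `<=` stone_basic (a : B) `&` stone_basic (b : B)].
Proof.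
move=> _ _ ax bx; exists ((a : B) `&` (b : B))%O; split=> //.
  by have [[[_ FI _] _] _] := stone_filter x; apply: FI.
move=> y aby; have [[[_ _ up] _] _] := stone_filter y.
by split; apply: up aby; [exact: leIl|exact: leIr].
Qed.

HB.instance Definition _ :=
  @isBaseTopological.Build stone pointed_ba setT
    (fun b : pointed_ba => stone_basic (b : B))
    stone_basic_cover stone_basic_join.

Lemma stone_basic_open b : open (stone_basic b).
Proof. by exists [set b : pointed_ba] => //; rewrite bigcup_set1. Qed.

Lemma stone_compl (x : stone) b : ~ val x b <-> val x (~` b)%O.
Proof.
have [[[F1 FI Fup] F0] Fmax] := stone_filter x; split=> [nb|nbx bx]; last first.
  by apply: F0; rewrite -(meetxC b); apply: FI.
pose G := [set c | exists2 f, val x f & (f `&` ~` b <= c)%O].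
have GF : proper_filter G.
  split; first split.
  - by exists \top%O => //; exact: lex1.
  - move=> c1 c2 [f1 xf1 l1] [f2 xf2 l2]; exists (f1 `&` f2)%O; first exact: FI.
    rewrite lexI; apply/andP; split.
      by apply: le_trans l1; rewrite leI2// leIl.
    by apply: le_trans l2; rewrite leI2// leIr.
  - by move=> c1 c2 c12 [f xf l1]; exists f => //; exact: le_trans c12.
  - case=> f xf; rewrite lex0 => /eqP fb0; apply: nb; apply: Fup xf.
    rewrite -[f]meetx1 -(joinxC b) meetUr fb0 joinx0; exact: leIr.
rewrite -(Fmax G GF); last by move=> f xf; exists f => //; exact: leIl.
by exists \top%O => //; rewrite meet1x.
Qed.

Lemma stone_near b (x : stone) : \forall y \near x, val y b <-> val x b.
Proof.
have [bx|nbx] := pselect (val x b).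
  have : nbhs x (stone_basic b).
    by apply: open_nbhs_nbhs; split=> //; exact: stone_basic_open.
  by apply: filterS => y; split.
have : nbhs x (stone_basic (~` b)%O).
  apply: open_nbhs_nbhs; split; first exact: stone_basic_open.
  exact/stone_compl.
by apply: filterS => y /stone_compl.
Qed.

Lemma stone_separate (x y : stone) : x <> y -> exists b, val x b /\ ~ val y b.
Proof.
move=> xy; apply: contrapT => H; apply: xy; apply/val_inj/esym.
have [PF Fmax] := stone_filter x; have [PG _] := stone_filter y.
by apply: Fmax => // b xb; apply: contrapT => nyb; apply: H; exists b.
Qed.

End Stone.

Section BooleanPower.
Variables (L : signature) (A : algebra L).
Context {d : Order.disp_t}.
Variable B : ctbDistrLatticeType d.

Definition boolean_power_set : set (direct_power A (stone B)) :=
  [set f | continuous (f : stone B -> discrete_topology A)].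

Lemma locally_constantP (f : stone B -> discrete_topology A) :
  continuous f <-> forall x, \forall y \near x, f y = f x.
Proof.
split=> cf x; last first.
  by move=> U /nbhs_singleton Ufx; apply: filterS (cf x) => y /= ->.
have : nbhs (f x) [set f x] by exact: (@discrete_set1 (discrete_topology A)).
exact: cf.
Qed.

Lemma boolean_power_subuniverse : subuniverse boolean_power_set.
Proof.
split.
  case: (algebra_nonempty A) => a0; exists (fun=> a0).
  by apply/locally_constantP => x; near=> y.
move=> s a ca; apply/locally_constantP => x.
have : \forall y \near x, forall i, a i y = a i x.
  apply: (@filter_forall _ _ (fun i => [set y | a i y = a i x]) (nbhs x)) => i.
  exact: (iffLR (locally_constantP _) (ca i) x).
by apply: filterS => y e; congr (op A s _); apply/funext => i; exact: e.
Unshelve. all: by end_near. Qed.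

Definition boolean_power : algebra L := subalgebra boolean_power_subuniverse.

Variables (n : nat) (x : 'I_n -> stone B) (e : 'I_n -> A).

Definition filtered_boolean_power_set : set boolean_power :=
  [set f | forall i, val f (x i) = e i].

Lemma filtered_boolean_power_subuniverse :
  injective x -> (forall i, idempotent_element (e i)) ->
  subuniverse filtered_boolean_power_set.
Proof.
move=> xI eI; split; last first.
  move=> s a Fa i /=; apply: (eI i).2 => j; exact: Fa.
have /choice[c cP] : forall p : 'I_n * 'I_n, exists b : B,
    p.1 != p.2 -> val (x p.1) b /\ ~ val (x p.2) b.
  move=> [i j] /=; have [->|ij] := eqVneq i j; first by exists \top%O.
  have [|b bP] := @stone_separate _ _ (x i) (x j); last by exists b.
  by move=> /xI /eqP; rewrite (negbTE ij).
pose b i := (\meet_(j | i != j) c (i, j))%O.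
have bi i : val (x i) (b i).
  have [[[F1 FI _] _] _] := stone_filter (x i).
  rewrite /b; elim/big_ind: _ => //.
  by move=> j ij; have [] := cP (i, j) ij.
have bj i j : i != j -> ~ val (x j) (b i).
  move=> ij bj; have [_] := cP (i, j) ij; apply.
  have [[[_ _ up] _] _] := stone_filter (x j); apply: up bj.
  exact: (meets_inf (j := j)).
case: (algebra_nonempty A) => a0.
pose f (y : stone B) :=
  if [pick i | `[< val y (b i) >]] is Some i then e i else a0.
have fc : f \in boolean_power_set.
  rewrite inE; apply/locally_constantP => y.
  have : \forall z \near y, forall i, val z (b i) <-> val y (b i).
    apply: (@filter_forall _ _ (fun i => [set z | val z (b i) <-> val y (b i)])
      (nbhs y)).
    by move=> i; exact: stone_near.
  apply: filterS => z zy; rewrite /f.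
  by under eq_pick do rewrite (asbool_equiv_eq (zy _)).
exists (SigSub fc) => i /=; rewrite /f; case: pickP => [j /asboolP bxi|/(_ i)].
  by have [->//|ji] := eqVneq j i; case: (bj _ _ ji).
by move/asboolP; case.
Qed.

Definition filtered_boolean_power
    (xI : injective x) (eI : forall i, idempotent_element (e i)) : algebra L :=
  subalgebra (filtered_boolean_power_subuniverse xI eI).

End BooleanPower.

Section Automorphisms.
Variables (L : signature) (M : algebra L).

Record aut := Aut {
  aut_fun :> M -> M;
  aut_hom : homomorphism aut_fun;
  aut_bij : bijective aut_fun }.

HB.instance Definition _ := gen_eqMixin aut.
HB.instance Definition _ := gen_choiceMixin aut.

Lemma aut_ext (g h : aut) : g =1 h -> g = h.
Proof.
case: g h => [g gh gb] [h hh hb] /= /funext gE; rewrite -gE in hh hb *.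
by congr Aut; exact: Prop_irrelevance.
Qed.

Definition aut_one : aut :=
  @Aut idfun (fun s a => erefl) (Bijective (fun=> erefl) (fun=> erefl)).

Lemma aut_mul_hom (g h : aut) : homomorphism (g \o h).
Proof. by move=> s a /=; rewrite !aut_hom. Qed.

Definition aut_mul (g h : aut) : aut :=
  Aut (@aut_mul_hom g h) (bij_comp (aut_bij g) (aut_bij h)).

Lemma aut_inv_exists (g : aut) : exists h : aut, cancel g h /\ cancel h g.
Proof.
have [h gK hK] := aut_bij g.
have hh : homomorphism h.
  move=> s a; apply: (can_inj gK); rewrite hK aut_hom; congr op.
  by apply/funext => i /=; rewrite hK.
by exists (Aut hh (Bijective hK gK)).
Qed.

Definition aut_inv (g : aut) : aut := projT1 (cid (aut_inv_exists g)).

Lemma aut_mulA : associative aut_mul.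
Proof. by move=> f g h; exact: aut_ext. Qed.

Lemma aut_mul1g : left_id aut_one aut_mul.
Proof. by move=> g; exact: aut_ext. Qed.

Lemma aut_mulg1 : right_id aut_one aut_mul.
Proof. by move=> g; exact: aut_ext. Qed.

Lemma aut_mulVg : left_inverse aut_one aut_inv aut_mul.
Proof.
move=> g; apply: aut_ext => x /=; rewrite /aut_inv.
by case: cid => h /= [gK _]; exact: gK.
Qed.

Lemma aut_mulgV : right_inverse aut_one aut_inv aut_mul.
Proof.
move=> g; apply: aut_ext => x /=; rewrite /aut_inv.
by case: cid => h /= [_ hK]; exact: hK.
Qed.

HB.instance Definition _ :=
  isGroup.Build aut aut_mulA aut_mul1g aut_mulg1 aut_mulVg aut_mulgV.

End Automorphisms.

Definition card_lt T U (S : set T) (S' : set U) := (S #<= S') && (S #!= S').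

Section GroupProperties.
Local Open Scope group_scope.
Variable G : groupType.
Implicit Types (H E U V : set G) (g : G).

Definition is_subgroup H := group_closed (mem H).

Definition proper_subset U := U <> [set: G].

Definition left_cosets H : set (set G) :=
  [set [set g * h | h in H] | g in [set: G]].

Definition setmul U V : set G := [set u * v | u in U & v in V].

Definition setinv U : set G := [set u^-1 | u in U].

Definition setpow U k : set G := iter k (setmul U) [set 1].

Definition generates E :=
  forall H, is_subgroup H -> E `<=` H -> H = [set: G].

Definition bergman_property :=
  forall E, generates E -> E 1 -> E = setinv E ->
    exists k : nat, setpow E k = [set: G].

End GroupProperties.

(* Cardinals as initial ordinals: well-ordered types in which every proper
   initial segment has strictly smaller cardinality *)
Record cardinal := Cardinal {
  cardinal_sort :> eqType;
  cardinal_le : rel cardinal_sort;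
  cardinal_wo : well_order cardinal_le;
  cardinal_initial : forall i : cardinal_sort,
    card_lt [set j | cardinal_le j i && (j != i)] [set: cardinal_sort] }.

Definition cardinal_ltn (k : cardinal) (i j : k) :=
  cardinal_le i j && (i != j).

Definition least_cardinal (P : cardinal -> Prop) (k : cardinal) :=
  P k /\ forall l : cardinal, P l -> [set: k] #<= [set: l].

Section Cofinality.
Variable G : groupType.

Definition union_of_chain (k : cardinal) (U : k -> set G) :=
  [/\ forall i, proper_subset (U i),
      forall i j, cardinal_ltn i j -> U i `<=` U j
    & \bigcup_i U i = [set: G]].

Definition union_of_subgroup_chain (k : cardinal) :=
  exists U : k -> set G, union_of_chain U /\ forall i, is_subgroup (U i).

Definition union_of_strong_chain (k : cardinal) :=
  exists U : k -> set G, union_of_chain U /\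
    forall i, U i = setinv (U i) /\
      exists l : k, setmul (U i) (U i) `<=` U l.

Definition cofinality := least_cardinal union_of_subgroup_chain.

Definition strong_cofinality := least_cardinal union_of_strong_chain.

Definition uncountable_cofinality :=
  exists k, cofinality k /\ ~ countable [set: k].

Definition uncountable_strong_cofinality :=
  exists k, strong_cofinality k /\ ~ countable [set: k].

End Cofinality.

Section SmallIndex.
Variables (L : signature) (M : algebra L).

Definition pointwise_stabilizer (F : set M) : set (aut M) :=
  [set g : aut M | forall m, F m -> g m = m].

Definition small_index_property :=
  [set: M] #= [set: nat] /\
  forall H : set (aut M), is_subgroup H ->
    card_lt (left_cosets H) [set: nat -> bool] ->
    exists F : set M, finite_set F /\ pointwise_stabilizer F `<=` H.

End SmallIndex.

(* Main.v *)
(* Let X be the Stone space of B and F the filtered power.  Since A is simple,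
   non-abelian and Mal'cev, every homomorphism of F onto A is the evaluation at a
   point of X other than the x_i followed by an automorphism of A.  So an
   automorphism g of F is a permutation of X x A, fibered over X, that sends the
   graph of f to the graph of g f, is locally constant in the fiber direction and
   is continuous over X away from the x_i.  Conversely every homeomorphism of X
   that fixes the x_i acts on F; a back-and-forth construction of such
   homeomorphisms shows that Aut F has finitely many orbits on tuples, and (1)
   follows by the Ryll-Nardzewski argument.

   For (2) and (3) fix a class of "small" subsets of Aut F: either the subsets of
   a subgroup of index less than the continuum, or the subsets of the members of
   a countable strong chain.  In both cases, among continuum many automorphisms
   g_S there are two with g_S^-1 g_S' in a small set, and every infinite product
   of groups of automorphisms has a factor that is covered by quotients in one
   small set.  Around the exceptional points an infinite sequence of clopen cells
   is available, and from these two properties an infinite-swindle argument with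
   commutators shows that the group of automorphisms supported close to the
   exceptional points is small.  By compactness the pointwise stabilizer of a
   suitable finite subset of F is a finite product of such groups, hence small.
   This is (2).  For (3), the stabilizer has finitely many double cosets because
   there are finitely many orbits on tuples, so Aut F itself would be contained in
   a member of the strong chain; hence there is no countable strong chain. *)

From HB Require Import structures.
From mathcomp Require Import all_boot all_order all_algebra.
From mathcomp Require Import boolp classical_sets functions cardinality topology.
From mathcomp Require Import wochoice filter zify.
Require Import Defs.

Set Implicit Arguments.
Unset Strict Implicit.
Unset Printing Implicit Defensive.

Import Order.Theory.

Local Open Scope classical_set_scope.
Local Open Scope card_scope.

(** * Affine representation of abelian Mal'cev algebras *)

(** Every element of the power has the value [e i] at [x i], so an automorphism need not extend
    continuously to these points: it may move points close to [x i] to points close to [x j],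
    provided that an automorphism of [A] carries [e i] to [e j]. All [x i] whose values lie in one
    orbit of [aut A] therefore behave like a single point at infinity and are treated as one
    exceptional set. Fixing one element [f0] pins down the section that must be preserved near this
    set. The same analysis with one ordinary point and constant sections covers the rest of the
    space.

    Asking for no continuity at the exceptional set is what allows infinite products of maps with
    disjoint supports, and so the swindle.

    Non-abelianness enters through a pair of congruences: agreement on a clopen set and agreement on
    its complement intersect trivially. If neither were contained in the kernel of a surjection onto
    [A], the two would centralize each other and make [A] affine. Hence the clopen sets that
    determine the surjection form an ultrafilter. *)

Section EndomorphismRing.
Import GRing.Theory.
Local Open Scope ring_scope.
Variable V : zmodType.

Record zmod_endo := ZmodEndo {
  zmod_endo_fun :> V -> V;
  zmod_endoD : {morph zmod_endo_fun : x y / x + y} }.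

HB.instance Definition _ := gen_eqMixin zmod_endo.
HB.instance Definition _ := gen_choiceMixin zmod_endo.

Lemma zmod_endo_ext (f g : zmod_endo) : f =1 g -> f = g.
Proof.
case: f g => [f hf] [g hg] /= /funext fg; rewrite -fg in hg *.
by congr ZmodEndo; exact: Prop_irrelevance.
Qed.

Lemma endo_zeroD : {morph (fun _ : V => 0 : V) : x y / x + y}.
Proof. by move=> x y; rewrite addr0. Qed.

Lemma endo_oppD (f : zmod_endo) : {morph (fun x : V => - f x) : x y / x + y}.
Proof. by move=> x y; rewrite zmod_endoD opprD. Qed.

Lemma endo_addD (f g : zmod_endo) : {morph (fun x : V => f x + g x) : x y / x + y}.
Proof. by move=> x y; rewrite !zmod_endoD addrACA. Qed.

Lemma endo_mulD (f g : zmod_endo) : {morph f \o g : x y / x + y}.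
Proof. by move=> x y /=; rewrite !zmod_endoD. Qed.

Let endo_zero := ZmodEndo endo_zeroD.
Let endo_opp f := ZmodEndo (endo_oppD f).
Let endo_add f g := ZmodEndo (endo_addD f g).
Let endo_one := @ZmodEndo idfun (fun x y => erefl).
Let endo_mul f g := ZmodEndo (endo_mulD f g).

Lemma endo_addA : associative endo_add.
Proof. by move=> f g h; apply: zmod_endo_ext => x /=; rewrite addrA. Qed.

Lemma endo_addC : commutative endo_add.
Proof. by move=> f g; apply: zmod_endo_ext => x /=; rewrite addrC. Qed.

Lemma endo_add0 : left_id endo_zero endo_add.
Proof. by move=> f; apply: zmod_endo_ext => x /=; rewrite add0r. Qed.

Lemma endo_addN : left_inverse endo_zero endo_opp endo_add.
Proof. by move=> f; apply: zmod_endo_ext => x /=; rewrite addNr. Qed.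

HB.instance Definition _ :=
  GRing.isZmodule.Build zmod_endo endo_addA endo_addC endo_add0 endo_addN.

Lemma endo_mulA : associative endo_mul.
Proof. by move=> f g h; exact: zmod_endo_ext. Qed.

Lemma endo_mul1 : left_id endo_one endo_mul.
Proof. by move=> f; exact: zmod_endo_ext. Qed.

Lemma endo_mulr1 : right_id endo_one endo_mul.
Proof. by move=> f; exact: zmod_endo_ext. Qed.

Lemma endo_mulDl : left_distributive endo_mul +%R.
Proof. by move=> f g h; exact: zmod_endo_ext. Qed.

Lemma endo_mulDr : right_distributive endo_mul +%R.
Proof. by move=> f g h; apply: zmod_endo_ext => x /=; rewrite zmod_endoD. Qed.

HB.instance Definition _ := GRing.Zmodule_isPzRing.Build zmod_endo
  endo_mulA endo_mul1 endo_mulr1 endo_mulDl endo_mulDr.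

Definition endo_module : Type := V.
HB.instance Definition _ := GRing.Zmodule.on endo_module.

Lemma endo_scaleA (f g : zmod_endo) (v : endo_module) : f (g v) = (f * g) v.
Proof. by []. Qed.

HB.instance Definition _ := @GRing.Zmodule_isLmodule.Build zmod_endo endo_module
  (fun (f : zmod_endo) (v : endo_module) => f v) endo_scaleA
  (fun=> erefl) (fun f v w => zmod_endoD f v w) (fun v f g => erefl).

End EndomorphismRing.

Section ZmoduleOf.
Variables (T : choiceType) (o : T) (opp : T -> T) (add : T -> T -> T).
Hypotheses (addA : associative add) (addC : commutative add).
Hypotheses (add0 : left_id o add) (addN : left_inverse o opp add).

(** The laws are arguments of the type, so that the group structure can be recovered from the type
    alone. *)
Definition zmod_of of associative add & commutative add & left_id o add
  & left_inverse o opp add : Type := T.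

HB.instance Definition _ := Choice.on (zmod_of addA addC add0 addN).
HB.instance Definition _ :=
  GRing.isZmodule.Build (zmod_of addA addC add0 addN) addA addC add0 addN.

End ZmoduleOf.

Section AffineAlgebra.
Import GRing.Theory.
Local Open Scope ring_scope.
Variables (L : signature) (A : algebra L) (m : A -> A -> A -> A).
Hypothesis ml : forall x y, m x x y = y.
Hypothesis mC : forall x y z, m x y z = m z y x.
Hypothesis mm : forall p1 p2 p3 q1 q2 q3 r1 r2 r3,
  m (m p1 q1 r1) (m p2 q2 r2) (m p3 q3 r3) =
  m (m p1 p2 p3) (m q1 q2 q3) (m r1 r2 r3).
Hypothesis mop : forall s (p q r : 'I_(arity s) -> A),
  op A s (fun i => m (p i) (q i) (r i)) = m (op A s p) (op A s q) (op A s r).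

Let mr x y : m y x x = y. Proof. by rewrite mC ml. Qed.

(** With any [o] as zero, [x + y = m x o y] is an abelian group by the medial law [mm], and
    [m x y z = x - y + z]. The operations commute with [m], so each is a constant plus additive maps
    of the single coordinates, and these maps are scalars from the endomorphism ring. *)
Lemma malcev_affine_abelian : abelian_algebra A.
Proof.
have [o] := algebra_nonempty A.
pose add (x y : A) := m x o y; pose opp x := m o x o.
have addA : associative add.
  by move=> x y z; have := mm x o o o o o y o z; rewrite !ml !mr.
have addC : commutative add by move=> x y; rewrite /add mC.
have add0 : left_id o add by move=> x; rewrite /add ml.
have addN : left_inverse o opp add.
  by move=> x; have := mm o o o x o o o o x; rewrite !ml !mr.
pose V : zmodType := zmod_of addA addC add0 addN.
have mE (x y z : V) : m x y z = x - y + z.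
  have := mm x o o o o y z o o.
  rewrite !ml !mr => <-.
  rewrite -[RHS]addrAC.
  done.
pose W : lmodType (zmod_endo V) := endo_module V.
pose oV (s : L) (a : 'I_(arity s) -> V) : V := op A s a.
pose c s : V := oV s (fun=> 0).
pose single (s : L) (i : 'I_(arity s)) (x : V) : 'I_(arity s) -> V :=
  fun j => if j == i then x else 0.
have opD s (p r : 'I_(arity s) -> V) :
    oV s (fun i => p i + r i) = oV s p - c s + oV s r.
  by rewrite -mE -[RHS]mop.
have rD s i : {morph (fun x : V => oV s (single s i x) - c s) : x y / x + y}.
  move=> x y; rewrite addrA -opD; congr (oV s _ - _); apply/funext => j.
  by rewrite /single; case: ifP; rewrite ?addr0.
exists (zmod_endo V), W, id; split; first by exists id.
move=> s; exists (fun i => ZmodEndo (rD s i)), (c s) => a0.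
pose a : 'I_(arity s) -> V := a0.
(* Coordinates are switched on one at a time, the others staying at 0. *)
have H (J : seq 'I_(arity s)) : uniq J ->
    oV s (fun i => if i \in J then a i else 0) =
    c s + \sum_(i <- J) (oV s (single s i (a i)) - c s).
  elim: J => [|i J IH] /=; first by rewrite big_nil addr0.
  case/andP=> iJ /IH {}IH; rewrite big_cons addrCA -IH.
  rewrite -opD; congr (oV s _); apply/funext => j.
  rewrite inE /single; case: eqP => [->|_] /=; last by rewrite add0r.
  by rewrite (negbTE iJ) addr0.
have := H _ (index_enum_uniq _).
have -> : oV s (fun i => if i \in index_enum 'I_(arity s) then a i else 0) = oV s a.
  by congr (oV s _); apply/funext => i; rewrite mem_index_enum.
by move=> E; exact: E.
Qed.
End AffineAlgebra.

(* Two congruences of [F] with trivial intersection, neither of them below the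
   kernel of [pi], centralize each other; they push [A] into being abelian *)
Section CentralPair.
Variable L : signature.
Implicit Types A F : algebra L.

Lemma homomorphism_eval F A (h : F -> A) n (v : 'I_n -> F) (t : term L n) :
  homomorphism h -> h (eval v t) = eval (h \o v) t.
Proof.
move=> hh; elim: t => //= s u IH; rewrite hh; congr (op A s _).
by apply/funext => i /=.
Qed.

Lemma congruence_eval F (R : F -> F -> Prop) n (v w : 'I_n -> F) (t : term L n) :
  congruence R -> (forall i, R (v i) (w i)) -> R (eval v t) (eval w t).
Proof. by move=> [Rr _ _ Ro] vw; elim: t => //= s u IH; exact: Ro. Qed.

Variables (F A : algebra L) (pi : F -> A) (t : term L 3).
Hypothesis pi_hom : homomorphism pi.
Hypothesis pi_surj : forall a, exists f, pi f = a.
Hypothesis A_simple : simple_algebra A.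
Let mF (x y z : F) := eval (tnth [tuple x; y; z]) t.
Let mA (x y z : A) := eval (tnth [tuple x; y; z]) t.
Hypothesis mFl : forall x y, mF x x y = y.
Hypothesis mFr : forall x y, mF y x x = y.
Hypothesis mAl : forall x y, mA x x y = y.
Hypothesis mAr : forall x y, mA y x x = y.

Let tnth3 (T : Type) (P : T -> T -> Prop) (x y z x' y' z' : T) :
  P x x' -> P y y' -> P z z' ->
  forall i, P (tnth [tuple x; y; z] i) (tnth [tuple x'; y'; z'] i).
Proof.
by move=> Px Py Pz [[|[|[|//]]] i]; rewrite !(tnth_nth x).
Qed.

Let pi_m x y z : pi (mF x y z) = mA (pi x) (pi y) (pi z).
Proof.
rewrite /mF homomorphism_eval //; congr (eval _ t).
by apply/funext => -[[|[|[|//]]] i] /=; rewrite (tnth_nth x) (tnth_nth (pi x)).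
Qed.

Let congr_m (R : F -> F -> Prop) x y z x' y' z' : congruence R ->
  R x x' -> R y y' -> R z z' -> R (mF x y z) (mF x' y' z').
Proof. by move=> cR ? ? ?; apply: congruence_eval => //; exact: tnth3. Qed.

(** The image of [R] in [A] is a congruence, transitive because of the Mal'cev term; it is not
    equality, so by simplicity it is total. The Mal'cev term then moves a pair with the right images
    to a pair that ends in [q]. *)
Lemma congruence_lift (R : F -> F -> Prop) : congruence R ->
  (exists f g, R f g /\ pi f <> pi g) ->
  forall (q : F) (a : A), exists p, R p q /\ pi p = a.
Proof.
move=> cR [f0 [g0 [Rfg pfg]]]; have [Rr Rs Rt Ro] := cR.
pose S a b := exists f g, [/\ R f g, pi f = a & pi g = b].
have cS : congruence S.
  split.
  - by move=> a; have [f <-] := pi_surj a; exists f, f.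
  - by move=> a b [f [g [fg fa gb]]]; exists g, f; split=> //; exact: Rs.
  - move=> a b c [f [g [fg <- gb]]] [f' [g' [fg' f'b <-]]].
    exists (mF f g f'), g'; split=> //; last by rewrite pi_m gb f'b mAr.
    by apply: Rt fg'; rewrite -[X in R _ X](mFl g f'); apply: congr_m.
  - move=> s a b /choice[f /choice[g H]].
    exists (op F s f), (op F s g); split.
    + by apply: Ro => i; have [] := H i.
    + by rewrite pi_hom; congr (op A s _); apply/funext => i; have [] := H i.
    + by rewrite pi_hom; congr (op A s _); apply/funext => i; have [] := H i.
have ST a b : S a b.
  have [H|//] := A_simple.2 S cS; exfalso; apply: pfg; apply/H.
  by exists f0, g0.
move=> q a; have [f [g [fg <- gq]]] := ST a (pi q).
exists (mF f g q); split; last by rewrite pi_m gq mAr.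
by rewrite -[X in R _ X](mFl g q); apply: congr_m.
Qed.

Section TwoCongruences.
Variables R S : F -> F -> Prop.
Hypotheses (cR : congruence R) (cS : congruence S).
Hypothesis RS : forall f g, R f g -> S f g -> f = g.
Hypothesis Rpi : exists f g, R f g /\ pi f <> pi g.
Hypothesis Spi : exists f g, S f g /\ pi f <> pi g.

(** Lift [q] arbitrarily, [p] within the [R]-classes of that lift and [r] within its [S]-classes.
    Both sides then lift to elements of [F] that are congruent modulo [R] and modulo [S], hence
    equal. *)
Let commute (I : Type) (oF : (I -> F) -> F) (oA : (I -> A) -> A) :
  (forall a, pi (oF a) = oA (pi \o a)) ->
  (forall a b, (forall i, R (a i) (b i)) -> R (oF a) (oF b)) ->
  (forall a b, (forall i, S (a i) (b i)) -> S (oF a) (oF b)) ->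
  forall p q r, mA (oA r) (oA q) (oA p) = oA (fun i => mA (p i) (q i) (r i)).
Proof.
move=> po Ro So p q r.
have [q' q'E] := choice (fun i => pi_surj (q i)).
have [p' p'E] := choice (fun i => congruence_lift cR Rpi (q' i) (p i)).
have [r' r'E] := choice (fun i => congruence_lift cS Spi (q' i) (r i)).
have E : mF (oF r') (oF q') (oF p') = oF (fun i => mF (p' i) (q' i) (r' i)).
  have [Rr Rs Rt _] := cR; have [Sr Ss St _] := cS.
  apply: RS.
    apply: (Rt _ (oF r')); first rewrite -{2}(mFr (oF q') (oF r')).
      by apply: congr_m => //; apply: Ro => i; have [] := p'E i.
    apply: Ro => i; rewrite -{1}(mFl (q' i) (r' i)); apply: congr_m => //.
    by apply: Rs; have [] := p'E i.
  apply: (St _ (oF p')); first rewrite -{2}(mFl (oF q') (oF p')).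
    by apply: congr_m => //; apply: So => i; have [] := r'E i.
  apply: So => i; rewrite -{1}(mFr (q' i) (p' i)); apply: congr_m => //.
  by apply: Ss; have [] := r'E i.
have -> : p = pi \o p' by apply/funext => i /=; have [] := p'E i.
have -> : q = pi \o q' by apply/funext => i /=.
have -> : r = pi \o r' by apply/funext => i /=; have [] := r'E i.
rewrite -!po -pi_m E po; congr oA; apply/funext => i /=.
by rewrite pi_m.
Qed.

(** Three uses of [commute]: a projection gives the symmetry of [m] because of the reversed order,
    [m] itself gives the medial law, and the basic operations give their compatibility with [m]. *)
Lemma central_pair_abelian : abelian_algebra A.
Proof.
have mC x y z : mA x y z = mA z y x.
  by have := @commute unit (fun a => a tt) (fun a => a tt) (fun=> erefl)
    (fun a b H => H tt) (fun a b H => H tt) (fun=> z) (fun=> y) (fun=> x).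
apply: (@malcev_affine_abelian L A mA) => //.
  move=> p1 p2 p3 q1 q2 q3 r1 r2 r3.
  have := @commute 'I_3 (fun a => eval a t) (fun a => eval a t)
    (fun a => homomorphism_eval a t pi_hom)
    (fun a b => congruence_eval t cR) (fun a b => congruence_eval t cS)
    (tnth [tuple p1; p2; p3]) (tnth [tuple q1; q2; q3]) (tnth [tuple r1; r2; r3]).
  rewrite -/(mA p1 p2 p3) -/(mA q1 q2 q3) -/(mA r1 r2 r3) mC => ->.
  congr (eval _ t); apply/funext => -[[|[|[|//]]] i] /=;
  by rewrite !(tnth_nth p1).
move=> s p q r; rewrite [RHS]mC.
have [_ _ _ Ro] := cR; have [_ _ _ So] := cS.
by rewrite (@commute _ (op F s) (op A s) (@pi_hom s) (Ro s) (So s)).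
Qed.

End TwoCongruences.
End CentralPair.

(** * Structures with finitely many orbits on tuples *)

Section BackAndForth.
Variables (S T : choiceType) (P : seq (S * T) -> Prop) (l0 : seq (S * T)).
Hypotheses (S_countable : countable [set: S]) (T_countable : countable [set: T]).
Hypothesis P0 : P l0.
Hypothesis forth : forall l s, P l -> exists t, P ((s, t) :: l).
Hypothesis back : forall l t, P l -> exists s, P ((s, t) :: l).

Let step (X : choiceType) (X_countable : countable [set: X]) :
  exists c : nat -> option X, forall x, exists k, c k = Some x.
Proof.
have /countable_injP[f fI] := X_countable.
exists (fun k => if pselect (exists x, f x = k) is left e then Some (projT1 (cid e))
                 else None) => x.
exists (f x); case: pselect => [e|[]]; last by exists x.
by case: cid => y /= /fI ->; rewrite ?inE.
Qed.

(** [P] is a property of finite matchings, newest pair first. It serves both for isomorphisms of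
    countable models and for homeomorphisms of the Stone space. *)
Lemma back_and_forth : exists l : nat -> seq (S * T),
  [/\ forall k, P (l k), forall k j, (k <= j)%N -> {subset l k <= l j},
      {subset l0 <= l 0%N},
      forall s, exists k t, (s, t) \in l k &
      forall t, exists k s, (s, t) \in l k].
Proof.
have [cS cSE] := step S_countable; have [cT cTE] := step T_countable.
have /choice[F FE] : forall (p : {l | P l} * nat), exists q : {l | P l},
    [/\ {subset sval p.1 <= sval q},
        forall s, cS p.2 = Some s -> exists t, (s, t) \in sval q &
        forall t, cT p.2 = Some t -> exists s, (s, t) \in sval q].
  case=> -[l Pl] k /=.
  have [l1 [Pl1 l1l l1s]] : exists l1, [/\ P l1, {subset l <= l1} &
      forall s, cS k = Some s -> exists t, (s, t) \in l1].
    case: (cS k) => [s|]; last by exists l; split.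
    have [t Pt] := forth s Pl; exists ((s, t) :: l); split=> //.
      by move=> x xl; rewrite inE xl orbT.
    by move=> _ [<-]; exists t; rewrite inE eqxx.
  case: (cT k) => [t|]; last by exists (exist _ l1 Pl1); split.
  have [s Ps] := back t Pl1; exists (exist _ ((s, t) :: l1) Ps); split=> /=.
  - by move=> x /l1l xl; rewrite inE xl orbT.
  - by move=> s' /l1s[t' H]; exists t'; rewrite inE H orbT.
  - by move=> _ [<-]; exists s; rewrite inE eqxx.
pose l := fix l k := if k is k'.+1 then F (l k', k') else exist P l0 P0.
have lS k : {subset sval (l k) <= sval (l k.+1)} by have [] := FE (l k, k).
exists (fun k => sval (l k)); split=> //.
- by move=> k; exact: svalP.
- move=> k j /subnK <-; elim: (j - k)%N => [|i IH]; first by rewrite add0n.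
  by move=> x /IH /lS; rewrite addSn.
- by move=> s; have [k ck] := cSE s; exists k.+1; have [_ + _] := FE (l k, k); apply.
- by move=> t; have [k ck] := cTE t; exists k.+1; have [_ _] := FE (l k, k); apply.
Qed.

End BackAndForth.

(** * Types, isolating formulas and the Ryll-Nardzewski argument *)

Section Formulas.
Variable L : signature.
Implicit Types M N : algebra L.

Definition FNot n (phi : formula L n) := FImp phi (FFalse L n).
Definition FAnd n (phi psi : formula L n) := FNot (FImp phi (FNot psi)).
Definition FEx n (phi : formula L n.+1) := FNot (FAll (FNot phi)).
Definition FBigAnd n (K : finType) (chi : K -> formula L n) :=
  foldr (fun k => FAnd (chi k)) (FNot (FFalse L n)) (enum K).

Lemma sat_and M n (phi psi : formula L n) (v : 'I_n -> M) :
  sat (FAnd phi psi) v <-> sat phi v /\ sat psi v.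
Proof.
split=> [H|[p q] /(_ p)]; last by apply.
split; apply: contrapT => N; apply: H => p; first by case: N.
by move=> q; case: N.
Qed.

Lemma sat_ex M n (phi : formula L n.+1) (v : 'I_n -> M) :
  sat (FEx phi) v <-> exists a, sat phi (extend a v).
Proof.
split=> [H|[a pa] H]; last exact: (H a pa).
by apply: contrapT => N; apply: H => a pa; apply: N; exists a.
Qed.

Lemma sat_bigand M n (K : finType) (chi : K -> formula L n) (v : 'I_n -> M) :
  sat (FBigAnd chi) v <-> forall k, sat (chi k) v.
Proof.
suff H s : sat (foldr (fun k => FAnd (chi k)) (FNot (FFalse L n)) s) v <->
    forall k, k \in s -> sat (chi k) v.
  by rewrite H; split=> Hk k; [apply: Hk; rewrite mem_enum|move=> _; exact: Hk].
elim: s => [|k s IH]; first by split=> _; [move=> k; rewrite in_nil|move=> p; exact: p].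
rewrite [foldr _ _ _]/= sat_and IH; split=> [[p q] j|H].
  by rewrite inE => /orP[/eqP ->|] //; exact: q.
by split=> [|j js]; apply: H; rewrite inE ?eqxx ?js ?orbT.
Qed.

Fixpoint universal_closure n : formula L n -> sentence L :=
  match n with
  | 0 => fun phi => phi
  | n'.+1 => fun phi => universal_closure (FAll phi)
  end.

Lemma extend_surj (T : Type) n (v : 'I_n.+1 -> T) :
  v = extend (v ord0) (fun i => v (lift ord0 i)).
Proof.
apply/funext => i; rewrite /extend; case: unliftP => [j|] -> //.
Qed.

Lemma models_closure M n (phi : formula L n) :
  models M (universal_closure phi) <-> forall v : 'I_n -> M, sat phi v.
Proof.
elim: n phi => [|n IH] phi.
  rewrite /models /=; split=> [H v|]; last by apply.
  by congr (sat phi _) : H; apply/funext => -[].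
rewrite IH /=; split=> [H v|H v a]; last exact: H.
by rewrite (extend_surj v); exact: H.
Qed.

Lemma aut_eval M (g : aut M) n (v : 'I_n -> M) (t : term L n) :
  g (eval v t) = eval (g \o v) t.
Proof. exact: homomorphism_eval (aut_hom g). Qed.

Lemma aut_sat M (g : aut M) n (phi : formula L n) (v : 'I_n -> M) :
  sat phi (g \o v) <-> sat phi v.
Proof.
have [h gK hK] := aut_bij g.
elim: phi v => {n} [m|m t u|m phi Hp psi Hq|m phi IH] v /=.
- by [].
- by rewrite -!aut_eval; split=> [/(can_inj gK)|->].
- by rewrite Hp Hq.
- have E a : extend (g a) (g \o v) = g \o extend a v.
    by apply/funext => i; rewrite /extend /=; case: unlift.
  split=> H a; first by apply/IH; rewrite -E; exact: H.
  by rewrite -(hK a) E; apply/IH.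
Qed.

Definition same_type M N n (v : 'I_n -> M) (w : 'I_n -> N) :=
  forall phi, sat phi v <-> sat phi w.

Definition isolating M n (v : 'I_n -> M) (psi : formula L n) :=
  sat psi v /\ forall w : 'I_n -> M, sat psi w -> same_type v w.

(** Oligomorphic. The finite colouring of the tuples may be finer than the partition into orbits,
    which avoids constructing the orbits. *)
Definition finitely_many_orbits M := forall n, exists (K : finType)
  (orbit : ('I_n -> M) -> K), forall v w, orbit v = orbit w ->
  exists g : aut M, forall i, g (v i) = w i.

(** Each colour whose tuples differ in type from [v] is excluded by one formula true of [v]; the
    conjunction over the finitely many colours isolates. *)
Lemma exists_isolating M n (v : 'I_n -> M) :
  finitely_many_orbits M -> exists psi, isolating v psi.
Proof.
move=> /(_ n)[K [orb orbP]].
have type_orb w w' : orb w = orb w' -> same_type w w'.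
  move=> /orbP[g gE] phi.
  have -> : w' = g \o w by apply/funext => i; rewrite -gE.
  by rewrite aut_sat.
have /choice[chi chiE] : forall k : K, exists chi, sat chi v /\
    forall w, orb w = k -> sat chi w -> same_type v w.
  move=> k; have [[w wk]|nw] := pselect (exists w, orb w = k); last first.
    exists (FNot (FFalse L n)); split=> // w wk; case: nw; exists w; exact: wk.
  have [vw|] := pselect (same_type v w).
    exists (FNot (FFalse L n)); split=> // w' w'k _.
    by move=> phi; rewrite (vw phi); apply: type_orb; rewrite wk.
  move/existsNP => [phi vw].
  have ww' w' : orb w' = k -> sat phi w' <-> sat phi w.
    by move=> w'k; apply: type_orb; rewrite wk.
  have [pv|pv] := pselect (sat phi v).
    exists phi; split=> // w' /ww' w'w pw'; case: vw.
    by split=> // _; apply/w'w.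
  exists (FNot phi); split=> // w' /ww' w'w pw'; case: vw.
  by split=> [/pv|/w'w/pw'].
exists (FBigAnd chi); split; first by apply/sat_bigand => k; have [] := chiE k.
by move=> w /sat_bigand H; have [_] := chiE (orb w); apply.
Qed.

(** In [M] each formula or its negation follows from [psi]; this implication is a sentence once
    closed, and passes to [N]. *)
Lemma isolating_same_type M N n (v w : 'I_n -> M) (u : 'I_n -> N)
  (psi : formula L n) : model_of_theory M N -> isolating v psi ->
  sat psi w -> sat psi u -> same_type w u.
Proof.
move=> MN [_ iso] pw pu phi.
have closed (chi : formula L n) : (forall w' : 'I_n -> M, sat psi w' -> sat chi w') -> sat chi u.
  move=> H; have : models M (universal_closure (FImp psi chi)).
    by apply/models_closure => w'; exact: H.
  by move=> /MN /models_closure /(_ u); apply.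
have [pw'|pw'] := pselect (sat phi w).
  split=> // _; apply: closed => w' pw2; have vw' := iso _ pw2.
  by apply/(vw' phi); apply/(iso w pw phi).
split=> // pu'.
suff : sat (FNot phi) u by move=> /(_ pu').
apply: closed => w' pw2 pw''; have vw' := iso _ pw2; apply: pw'.
by apply/(iso w pw phi); apply/(vw' phi).
Qed.

Theorem ryll_nardzewski M : countable [set: M] -> finitely_many_orbits M ->
  omega_categorical M.
Proof.
move=> Mc Mo; split=> // N Nc MN.
pose vM (l : seq (M * N)) : 'I_(size l) -> M := fun i => (tnth (in_tuple l) i).1.
pose vN (l : seq (M * N)) : 'I_(size l) -> N := fun i => (tnth (in_tuple l) i).2.
have vMc s t l : vM ((s, t) :: l) = extend s (vM l).
  rewrite [LHS]extend_surj; congr (extend _ _).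
  by apply/funext => i; rewrite /vM !(tnth_nth (s, t)).
have vNc s t l : vN ((s, t) :: l) = extend t (vN l).
  rewrite [LHS]extend_surj; congr (extend _ _).
  by apply/funext => i; rewrite /vN !(tnth_nth (s, t)).
have [|||l [lP lm _ lM lN]] := @back_and_forth M N
    (fun l => same_type (vM l) (vN l)) [::] Mc Nc.
- move=> phi; split=> [p|p].
    have : models N phi.
      by apply: MN; congr (sat phi _) : p; apply/funext => -[].
    by congr (sat phi _); apply/funext => -[].
  apply: contrapT => np; have : models N (FNot phi).
    apply: MN => /= p'; apply: np; congr (sat phi _) : p'.
    by apply/funext => -[].
  by apply=> /=; congr (sat phi _) : p; apply/funext => -[].
- move=> l s ll; have [psi psiP] := exists_isolating (extend s (vM l)) Mo.
  have /ll/sat_ex[t pt] : sat (FEx psi) (vM l).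
    by apply/sat_ex; exists s; have [] := psiP.
  exists t; rewrite vMc vNc; apply: (isolating_same_type MN psiP) => //.
  by have [] := psiP.
- move=> l t ll; have [K [orb orbP]] := Mo (size l).+1.
  have /choice[psi psiE] : forall k : K, exists psi : formula L (size l).+1,
      (forall w, orb w = k -> sat psi w) /\
      ((exists w, orb w = k) -> exists v : 'I_(size l).+1 -> M, isolating v psi).
    move=> k; have [[v vk]|nv] := pselect (exists v, orb v = k); last first.
      by exists (FNot (FFalse L _)); split=> // w wk; case: nv; exists w.
    have [psi psiP] := exists_isolating v Mo; exists psi; split=> [w|_]; last by exists v.
    rewrite -vk => /esym/orbP[g gE].
    have -> : w = g \o v by apply/funext => i; rewrite -gE.
    by apply/aut_sat; have [] := psiP.
  (* In [M] every tuple of this length satisfies the formula of its colour. The sentence saying so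
     is a finite disjunction, and it holds in [N] too. *)
  have : exists k, (exists w, orb w = k) /\ sat (psi k) (extend t (vN l)).
    apply: contrapT => nk.
    pose chi := FBigAnd (fun k => if `[< exists w, orb w = k >] then FNot (psi k)
                                  else FNot (FFalse L _)).
    have : models N (universal_closure (FNot chi)).
      apply: MN; apply/models_closure => w /= /sat_bigand /(_ (orb w)).
      by case: asboolP => [_|[]]; [apply; exact: (psiE _).1|exists w].
    move=> /models_closure /(_ (extend t (vN l))); apply; apply/sat_bigand => k.
    by case: asboolP => // kw /= p; apply: nk; exists k.
  move=> [k [kw pt]]; have [v psiP] := (psiE k).2 kw.
  have /ll/sat_ex[s ps] : sat (FEx (psi k)) (vN l) by apply/sat_ex; exists t.
  by exists s; rewrite vMc vNc; apply: (isolating_same_type MN psiP).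
have idx k (p : M * N) : p \in l k -> exists i : 'I_(size (l k)),
    vM (l k) i = p.1 /\ vN (l k) i = p.2.
  move=> pl; have pi : (index p (l k) < size (l k))%N by rewrite index_mem.
  by exists (Ordinal pi); rewrite /vM /vN (tnth_nth p) /= nth_index.
have eq1 k s t s' t' : (s, t) \in l k -> (s', t') \in l k -> s = s' <-> t = t'.
  move=> /idx[i [/= <- <-]] /idx[j [/= <- <-]].
  exact: (lP k (FEq (TVar _ i) (TVar _ j))).
have eq2 k k' s t s' t' : (s, t) \in l k -> (s', t') \in l k' -> s = s' <-> t = t'.
  move=> st st'; apply: (eq1 (maxn k k')); apply: (lm _ _ _ _ _).
    exact: leq_maxl.
  - exact: st.
  - exact: leq_maxr.
  - exact: st'.
have /choice[f fE] : forall t, exists s, exists k, (s, t) \in l k.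
  by move=> t; have [k [s]] := lN t; exists s, k.
have /choice[g gE] : forall s, exists t, exists k, (s, t) \in l k.
  by move=> s; have [k [t]] := lM s; exists t, k.
exists f; split; last first.
  exists g => z.
    by have [k fz] := fE z; have [k' gf] := gE (f z); apply/(eq2 _ _ _ _ _ _ gf fz).
  by have [k gz] := gE z; have [k' fg] := fE (g z); apply/(eq2 _ _ _ _ _ _ fg gz).
move=> s a; have /choice[ka kaE] := fE.
(* A stage late enough to have matched the result and all the arguments. *)
pose K := maxn (ka (op N s a)) (\max_i ka (a i)).
have inK t : (ka t <= K)%N -> (f t, t) \in l K by move=> /lm; apply; exact: kaE.
have [i0 [i0M i0N]] : exists i, vM (l K) i = f (op N s a) /\ vN (l K) i = op N s a.
  exact: (idx K (f _, _) (inK _ (leq_maxl _ _))).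
have /choice[ia iaE] : forall i, exists j,
    vM (l K) j = f (a i) /\ vN (l K) j = a i.
  move=> i; apply: (idx K (f _, _) (inK _ _)).
  by apply: leq_trans (leq_maxr _ _); apply: (leq_bigmax i).
have := lP K (FEq (TVar _ i0) (TApp (fun i => TVar _ (ia i)))).
rewrite /= i0M i0N => -[_ ->]; congr (op _ _ _); apply/funext => i /=;
by have [] := iaE i.
Qed.

End Formulas.

(** * Cardinals and chains of subsets of a group *)

Section Cardinals.

Lemma card_le_of_inj T U (A : set T) (B : set U) (f : T -> U) :
  (forall x, A x -> B (f x)) -> {in A &, injective f} -> A #<= B.
Proof.
move=> AB fI; rewrite -(card_le_eql (inj_card_eq fI)); apply: subset_card_le.
by move=> _ [x Ax <-]; exact: AB.
Qed.

Lemma card_eq_bijection T U (B : set U) : [set: T] #= B -> exists f : T -> U,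
  [/\ forall x, B (f x), injective f & forall u, B u -> exists x, f x = u].
Proof.
move=> /card_eqP[f]; pose i (x : T) : [set: T] := SigSub (mem_set (I : [set: T] x)).
exists (fun x => val (f (i x))); split.
- by move=> x; exact: set_valP.
- move=> x y /val_inj fxy.
  have /(congr1 val) // : i x = i y by apply: (@inj _ _ _ f) => //; rewrite inE.
- move=> u Bu.
  have [y _ fy] := @surj _ _ _ _ f (SigSub (mem_set Bu)) I.
  exists (val y); rewrite -[RHS](congr1 val fy); congr (val (f _)).
  exact: val_inj.
Qed.

(* A maximal set of choice functions that pairwise differ at every index is
   onto at some index [S]; evaluation then embeds [S] into every other member *)
Lemma exists_least_card T (P : set (set T)) : P !=set0 ->
  exists S, P S /\ forall S', P S' -> S #<= S'.
Proof.
move=> [S0 PS0].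
pose Q (Phi : set (set T -> T)) := (forall f S, Phi f -> P S -> S (f S)) /\
  forall f g S, Phi f -> Phi g -> P S -> f S = g S -> f = g.
have [|Phi [[PhiS PhiI] Phimax]] := @Zorn_bigcup _ Q.
  move=> F FQ Ftot; split=> [f S [X FX Xf]|f g S [X FX Xf] [Y FY Yg]].
    by have [+ _] := FQ _ FX; apply.
  have [XY|YX] := Ftot _ _ FX FY.
    by have [_ +] := FQ _ FY; apply=> //; exact: XY.
  by have [_ +] := FQ _ FX; apply=> //; exact: YX.
have [S [PS Ssurj]] : exists S, P S /\ forall t, S t -> exists2 f, Phi f & f S = t.
  apply: contrapT => N.
  have /choice[h hE] : forall S, exists t, P S -> S t /\ forall f, Phi f -> f S <> t.
    move=> S; have [PS|nPS] := pselect (P S); last first.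
      have [t _] : exists t : T, True; last by exists t => /nPS.
      apply: contrapT => nT; apply: N; exists S0; split=> // t.
      by move=> _; case: nT; exists t.
    apply: contrapT => N'; apply: N; exists S; split=> // t St.
    apply: contrapT => N''; apply: N'; exists t => _; split=> // f Phif fS.
    by apply: N''; exists f.
  apply: (Phimax (Phi `|` [set h])).
    split=> [|sub]; first by move=> f; left.
    have /sub Phih : (Phi `|` [set h]) h by right.
    by have [_ /(_ h Phih)] := hE S0 PS0.
  split=> [f S [Phif|->] PS|f g S]; [exact: (PhiS f S)|by have [] := hE S PS|].
  move=> [Phif|->] [Phig|->] PS //; first exact: PhiI.
    by have [_ /(_ f Phif)] := hE S PS.
  by move=> /esym; have [_ /(_ g Phig)] := hE S PS.
exists S; split=> // S' PS'.
have [[f0 _]|nT] := pselect (exists t : T, True); last first.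
  by apply: (@card_le_of_inj _ _ _ _ id) => // x; case: nT; exists x.
have /choice[e eE] : forall t, exists f, S t -> Phi f /\ f S = t.
  move=> t; have [/Ssurj[f Phif fS]|nSt] := pselect (S t); first by exists f.
  by exists (fun=> f0).
apply: (@card_le_of_inj _ _ _ _ (fun t => e t S')).
  by move=> t /eE[Phie _]; exact: (PhiS (e t) S').
move=> s t; rewrite !inE => /eE[es esS] /eE[et etS] est.
by rewrite -esS -etS (PhiI _ _ _ es et PS' est).
Qed.

(** The two sets are placed in a disjoint sum, where one of the copies has least cardinality. *)
Lemma card_le_total T U (A : set T) (B : set U) : A #<= B \/ B #<= A.
Proof.
have il : @inl T U @` A #= A by apply: inj_card_eq => x y _ _ [].
have ir : @inr T U @` B #= B by apply: inj_card_eq => x y _ _ [].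
have [|S [PS min]] := @exists_least_card (T + U)%type
    [set X | X = inl @` A \/ X = inr @` B]; first by exists (inl @` A); left.
have minA := min _ (or_introl erefl); have minB := min _ (or_intror erefl).
case: PS => SE; [left|right]; move: minA minB; rewrite SE.
  by move=> _; rewrite (card_le_eql il) (card_le_eqr ir).
by move=> + _; rewrite (card_le_eqr il) (card_le_eql ir).
Qed.

(** The cardinals live on arbitrary types; those not larger than [k0] are copied to subsets of [k0],
    where [exists_least_card] applies. *)
Lemma least_cardinal_exists (P : cardinal -> Prop) (k0 : cardinal) :
  P k0 -> exists k, least_cardinal P k.
Proof.
move=> Pk0; pose Q := [set S : set k0 | exists l, P l /\ [set: l] #= S].
have [|S [[k [Pk kS]] min]] := @exists_least_card _ Q.
  by exists setT, k0; split=> //; exact: card_eqxx.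
exists k; split=> // l Pl; rewrite (card_le_eql kS).
have [|le] := card_le_total [set: l] [set: k0].
  move=> /card_subP[S' S'l _]; have /min : Q S'.
    by exists l; split=> //; rewrite card_eq_sym.
  by rewrite (card_le_eqr S'l).
exact: card_le_trans (card_leT S) le.
Qed.

Section WellOrder.
Variables (T : eqType) (R : rel T).
Hypothesis wo : well_order R.

Lemma wo_total : total R.
Proof.
move=> x y; have [|z [[]]] := @wo [pred z | (z == x) || (z == y)].
  by exists x; rewrite inE eqxx.
rewrite inE => /orP[]/eqP -> le _; apply/orP; [left|right]; apply: le;
by rewrite inE eqxx ?orbT.
Qed.

Lemma wo_refl : reflexive R.
Proof. by move=> x; have := wo_total x x; rewrite orbb. Qed.

Lemma wo_anti x y : R x y -> R y x -> x = y.
Proof.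
move=> xy yx; have [|z [_ U]] := @wo [pred z | (z == x) || (z == y)].
  by exists x; rewrite inE eqxx.
transitivity z; [symmetry|]; apply: U; split; rewrite ?inE ?eqxx ?orbT //;
by move=> t; rewrite inE => /orP[]/eqP ->; rewrite ?wo_refl.
Qed.

Lemma wo_trans x y z : R x y -> R y z -> R x z.
Proof.
move=> xy yz; have [|w [[+ le] _]] := @wo [pred w | [|| w == x, w == y | w == z]].
  by exists x; rewrite inE eqxx.
have wx : R w x by apply: le; rewrite inE eqxx.
have wy : R w y by apply: le; rewrite inE eqxx !orbT.
have wz : R w z by apply: le; rewrite inE eqxx !orbT.
rewrite inE => /or3P[]/eqP wE; first by rewrite -wE.
  by rewrite wE in wx wz; rewrite (wo_anti xy wx).
by rewrite wE in wy; rewrite -(wo_anti yz wy).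
Qed.

Lemma wo_least (D : set T) : D !=set0 -> exists i, D i /\ forall j, D j -> R i j.
Proof.
move=> [i0 Di0]; have [|i [[]]] := @wo [pred i | `[< D i >]].
  by exists i0; rewrite inE.
rewrite inE => Di le _; exists i; split=> // j Dj.
by apply: le; rewrite inE.
Qed.

End WellOrder.

(** Well-order [T]. If a proper initial segment is as large as [T], cut at the least point with this
    property; otherwise keep all of [T]. *)
Lemma cardinal_of (T : eqType) : exists k : cardinal, [set: k] #= [set: T].
Proof.
have [R wo] := well_ordering_principle T.
pose seg i := [set j | R j i && (j != i)].
have seg_lt i : seg i #!= [set: T] -> card_lt (seg i) [set: T].
  by move=> ne; rewrite /card_lt card_leT.
have [[i0 Di0]|N] := pselect ([set i | seg i #= [set: T]] !=set0); last first.
  have ne i : seg i #!= [set: T] by apply/negP => si; apply: N; exists i.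
  by exists (@Cardinal T R wo (fun i => seg_lt i (ne i))); exact: card_eqxx.
have [|i [Di min]] := wo_least wo (D := [set i | seg i #= [set: T]]).
  by exists i0.
pose T' : eqType := {j : T | R j i && (j != i)}.
pose R' : rel T' := relpre val R.
have wo' : well_order R'.
  move=> A [x Ax].
  have [|y [[y' Ay' yE] le]] := wo_least wo (D := [set val z | z in [set z | z \in A]]).
    by exists (val x), x.
  have le' z : z \in A -> R' y' z by move=> Az; rewrite /R' /= yE; apply: le; exists z.
  exists y'; split=> // z [Az lez]; apply: val_inj; apply: (wo_anti wo).
    exact: le'.
  exact: lez.
have T'E : [set: T'] #= [set: T].
  apply: card_eq_trans Di.
  have <- : val @` [set: T'] = seg i.
    apply/seteqP; split=> [_ [z _ <-]|j ji]; first exact: (valP z).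
    by exists (exist _ j ji).
  by rewrite card_eq_sym; apply: inj_card_eq => x y _ _; exact: val_inj.
have lt' (z : T') : card_lt [set j | R' j z && (j != z)] [set: T'].
  rewrite /card_lt card_leT /=; apply/negP => E.
  have /andP[zi zni] := valP z.
  have Dz : seg (val z) #= [set: T].
    apply: card_eq_trans (card_eq_trans E T'E).
    have <- : val @` [set j | R' j z && (j != z)] = seg (val z).
      apply/seteqP; split=> [_ [y /andP[yz ynz] <-]|j /andP[jz jnz]].
        by apply/andP; split; [exact: yz|exact: ynz].
      have ji : R j i && (j != i).
        rewrite (wo_trans wo jz zi); apply/eqP => jE; rewrite jE in jz.
        by move/eqP: zni; apply; apply: (wo_anti wo).
      exists (exist _ j ji); last by [].
      by apply/andP; split; [exact: jz|exact: jnz].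
    by apply: inj_card_eq => x y _ _; exact: val_inj.
  by move/eqP: zni; apply; apply: (wo_anti wo) => //; exact: min.
by exists (Cardinal wo' lt').
Qed.

End Cardinals.

(** * Generating sets, chains and cofinalities of groups *)

Section GroupSets.
Local Open Scope group_scope.
Variable G : groupType.
Implicit Types (H E U V : set G) (g h : G).

Lemma is_subgroupP H : is_subgroup H <->
  [/\ H 1, forall g h, H g -> H h -> H (g * h) & forall g, H g -> H g^-1].
Proof.
split=> [Hs|[H1 HM HV]].
  have HM := group_closedM Hs; have HV := group_closedV Hs; split.
  - by have [+ _] := Hs; rewrite inE.
  - by move=> g h /mem_set Hg /mem_set Hh; apply/set_mem; exact: HM.
  - by move=> g /mem_set Hg; apply/set_mem; exact: HV.
split; first by rewrite inE.
by move=> g h; rewrite !inE => Hg Hh; apply: HM => //; exact: HV.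
Qed.

Lemma setinv_sub U : (forall g, U g -> U g^-1) -> U = setinv U.
Proof.
move=> UV; apply/seteqP; split=> [g Ug|_ [g Ug <-]]; last exact: UV.
by exists g^-1; [exact: UV|rewrite invgK].
Qed.

Lemma setinvE U g : U = setinv U -> U g -> U g^-1.
Proof. by move=> UV Ug; rewrite UV; exists g. Qed.

Lemma setpowS E k : setpow E k.+1 = setmul E (setpow E k).
Proof. by []. Qed.

Lemma setpow_add E j k g h : setpow E j g -> setpow E k h -> setpow E (j + k) (g * h).
Proof.
elim: j g => [|j IH] g; first by move=> ->; rewrite mul1g.
move=> [u Eu [v Ev <-]] Eh; rewrite addSn setpowS.
by exists u => //; exists (v * h); [exact: IH|rewrite mulgA].
Qed.

Lemma setpow1 E g : E g -> setpow E 1 g.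
Proof. by move=> Eg; exists g => //; exists 1 => //; rewrite mulg1. Qed.

Lemma setpow_inv E k g : E = setinv E -> setpow E k g -> setpow E k g^-1.
Proof.
move=> EV; elim: k g => [|k IH] g; first by move=> ->; rewrite invg1.
move=> [u Eu [v Ev <-]]; rewrite invgM -addn1.
by apply: setpow_add; [exact: IH|apply: setpow1; exact: setinvE].
Qed.

Lemma setpow_le E j k g : E 1 -> (j <= k)%N -> setpow E j g -> setpow E k g.
Proof.
move=> E1 /subnK <- Eg; rewrite -[g]mul1g; apply: setpow_add => //.
elim: (k - j)%N => [//|i IH]; rewrite setpowS; exists 1 => //; exists 1 => //.
by rewrite mulg1.
Qed.

Definition nat_strong_chain (U : nat -> set G) :=
  [/\ forall i, proper_subset (U i), forall i, U i `<=` U i.+1,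
      \bigcup_i U i = [set: G], forall i, U i = setinv (U i)
    & forall i, exists j, setmul (U i) (U i) `<=` U j].

Lemma generates_setpow E : generates E -> E 1 -> E = setinv E ->
  forall g, exists k, setpow E k g.
Proof.
move=> gE E1 EV g; suff : [set g | exists k, setpow E k g] = [set: G].
  by move=> /seteqP[_]; apply.
apply: gE; last by move=> h Eh; exists 1%N; exact: setpow1.
apply/is_subgroupP; split; first by exists 0%N.
  by move=> h h' [j Eh] [k Eh']; exists (j + k)%N; exact: setpow_add.
by move=> h [k Eh]; exists k; exact: setpow_inv.
Qed.

(** Otherwise the powers of [E] with exponents [2 ^ i] form a countable strong chain, the square of
    each lying in the next. *)
Lemma no_chain_bergman : (~ exists C : nat -> set G, nat_strong_chain C) -> bergman_property G.
Proof.
move=> nU E gE E1 EV; apply: contrapT => N; apply: nU.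
exists (fun i => setpow E (2 ^ i)); split.
- by move=> i Ei; apply: N; exists (2 ^ i)%N.
- by move=> i g; apply: setpow_le => //; rewrite leq_exp2l.
- apply/seteqP; split=> // g _; have [k Ek] := generates_setpow gE E1 EV g.
  by exists k => //; apply: setpow_le Ek => //; exact/ltnW/ltn_expl.
- by move=> i; apply: setinv_sub => g; exact: setpow_inv.
- move=> i; exists i.+1 => _ [g Eg [h Eh <-]].
  by rewrite expnS mul2n -addnn; exact: setpow_add.
Qed.

(** Enumerate [k] by [f] and let [V n] be the union of the finitely many [U i] with [f i < n]. In a
    chain such a union is empty or one of its members, so it stays proper. *)
Lemma no_countable_strong_chain (k : cardinal) :
  (~ exists C : nat -> set G, nat_strong_chain C) -> union_of_strong_chain G k ->
  ~ countable [set: k].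
Proof.
move=> nU [U [[Uproper Umono Ucover] Ustrong]] /countable_injP[f fI]; apply: nU.
have Ule i j : cardinal_le i j -> U i `<=` U j.
  move=> ij; have [->//|nij] := eqVneq i j.
  by apply: Umono; rewrite /cardinal_ltn ij.
have Utot i j : U i `<=` U j \/ U j `<=` U i.
  by have /orP[/Ule|/Ule] := wo_total (@cardinal_wo k) i j; [left|right].
pose V n := \bigcup_(i in [set i | (f i < n)%N]) U i.
have VE n : V n = set0 \/ exists i, V n = U i.
  elim: n => [|j IH]; first by left; apply/seteqP; split=> // g [i].
  have VS : V j `<=` V j.+1 by move=> g [i /= fij Ui]; exists i => //=; exact: leqW.
  have [[i fij]|ni] := pselect (exists i, f i = j); last first.
    suff -> : V j.+1 = V j by [].
    apply/seteqP; split=> // g [i /= fij Ui]; exists i => //=.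
    by rewrite ltn_neqAle -ltnS fij andbT; apply/eqP => fi; apply: ni; exists i.
  have VSE : V j.+1 = V j `|` U i.
    apply/seteqP; split=> [g [i' /= + Ug]|g [/VS//|Ug]]; last by exists i; rewrite //= fij.
    rewrite ltnS leq_eqVlt => /orP[/eqP|fi'j]; last by left; exists i'.
    by rewrite -fij => fii'; right; rewrite (fI i i') ?inE.
  rewrite VSE; right; case: IH => [->|[i' ->]]; first by exists i; rewrite set0U.
  by have [/setUidPr ->|/setUidPl ->] := Utot i' i; [exists i|exists i'].
exists V; split.
- move=> n; have [->|[i ->]] := VE n; last exact: Uproper.
  by move=> /seteqP[_] /(_ 1) /(_ I).
- by move=> n g [i /= fin Ui]; exists i => //=; exact: leqW.
- apply/seteqP; split=> // g _; have : (\bigcup_i U i) g by rewrite Ucover.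
  by move=> [i _ Ui]; exists (f i).+1 => //; exists i => /=.
- move=> n; have [->|[i ->]] := VE n; first by rewrite /setinv image_set0.
  by have [] := Ustrong i.
- move=> n; have [->|[i ->]] := VE n; first by exists 0%N => g [].
  have [_ [l Ul]] := Ustrong i; exists (f l).+1; apply: subset_trans Ul _.
  by move=> g Ulg; exists l => /=.
Qed.

Definition generated (X : set G) : set G :=
  [set g | forall H, is_subgroup H -> X `<=` H -> H g].

Lemma generated_subgroup X : is_subgroup (generated X).
Proof.
apply/is_subgroupP; split.
- by move=> H /is_subgroupP[].
- move=> g h Xg Xh H Hs XH; have /is_subgroupP[_ HM _] := Hs.
  by apply: HM; [exact: Xg|exact: Xh].
- move=> g Xg H Hs XH; have /is_subgroupP[_ _] := Hs; apply; exact: Xg.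
Qed.

Lemma sub_generated X : X `<=` generated X.
Proof. by move=> g Xg H _; apply. Qed.

Lemma generated_mono X Y : X `<=` Y -> generated X `<=` generated Y.
Proof. by move=> XY g Xg H Hs YH; apply: Xg => //; exact: subset_trans YH. Qed.

Lemma generatesE X : generates X <-> generated X = [set: G].
Proof.
split=> [gX|gX H Hs XH]; first by apply: gX; [exact: generated_subgroup|exact: sub_generated].
apply/seteqP; split=> // g _; have Xg : generated X g by rewrite gX.
exact: Xg.
Qed.

Lemma finite_setpow E k : finite_set E -> finite_set (setpow E k).
Proof.
move=> Ef; elim: k => [|k IH]; first exact: finite_set1.
rewrite setpowS; exact: finite_image2.
Qed.

(** A finite [S], closed up by inverses and 1, would have only finite powers, and one of these is
    the whole group. *)
Lemma bergman_generating_infinite (S : set G) : infinite_set [set: G] -> bergman_property G ->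
  generates S -> infinite_set S.
Proof.
move=> Gi bG gS Sf; pose E : set G := S `|` (setinv S `|` [set 1]).
have [|||k Ek] := bG E.
- by move=> H Hs EH; apply: gS => // g Sg; apply: EH; left.
- by right; right.
- apply: setinv_sub => g [Sg|[[h Sh <-]|->]].
  + by right; left; exists g.
  + by left; rewrite invgK.
  + by right; right; rewrite /= invg1.
- apply: Gi; rewrite -Ek; apply: finite_setpow.
  rewrite !finite_setU; split=> //; split; last exact: finite_set1.
  exact: finite_image.
Qed.

(** Shift a sequence that starts at [x] by one place. *)
Lemma infinite_setD1 T (x : T) : infinite_set [set: T] -> [set: T] #= [set~ x].
Proof.
move=> Ti; have /infiniteP /card_subP[C Cnat Cx] : infinite_set [set~ x].
  by rewrite -setTD; apply: infinite_setD => //; exact: finite_set1.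
have [f [fC fI _]] : exists f : nat -> T,
    [/\ forall n, C (f n), injective f & forall u, C u -> exists n, f n = u].
  by apply: card_eq_bijection; rewrite card_eq_sym.
have fx n : f n <> x by exact: Cx (fC n).
rewrite card_eq_le card_leT andbT.
pose k n := if n is m.+1 then f m else x.
have kI : injective k by move=> [|n] [|m] //= => [/esym/fx|/fx|/fI ->].
have /choice[s sE] : forall y, exists z,
    (exists2 n, y = k n & z = k n.+1) \/ (z = y /\ forall n, y <> k n).
  move=> y; have [[n yn]|ny] := pselect (exists n, y = k n).
    by exists (k n.+1); left; exists n.
  by exists y; right; split=> // n yn; apply: ny; exists n.
apply: (@card_le_of_inj _ _ _ _ s) => [y _|y z _ _].
  by case: (sE y) => [[n _ ->] /fx|[-> /(_ 0%N)]].
case: (sE y) (sE z) => [[n -> ->]|[-> ny]] [[m -> ->]|[-> nz]] //.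
- by move=> /kI[->].
- by move=> /esym/nz.
- by move=> /ny.
Qed.

(** Index a generating set of least size by its initial ordinal: the subgroups generated by proper
    initial segments are proper by minimality. This supplies a chain, without which the cofinality
    would not be defined. *)
Lemma exists_subgroup_chain : infinite_set [set: G] -> bergman_property G ->
  exists k, union_of_subgroup_chain G k.
Proof.
move=> Gi bG.
have [|S [gS Smin]] := @exists_least_card G (@generates G).
  by exists setT => H _; rewrite -subTset.
have Si := bergman_generating_infinite Gi bG gS.
have [k kS'] := cardinal_of (set_type S).
have kS : [set: k] #= S by apply: card_eq_trans kS' _; rewrite card_eq_sym; exact: card_setT_sym.
have [h [hS hI hsurj]] := card_eq_bijection kS.
pose U (i : k) := generated (h @` [set j | cardinal_ltn j i]).
have wo := @cardinal_wo k.
have Umono i j : cardinal_ltn i j -> U i `<=` U j.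
  move=> /andP[ij nij]; apply: generated_mono => _ [l /andP[li nli] <-].
  exists l => //; apply/andP; split; first exact: (wo_trans wo li ij).
  by apply/eqP => lj; rewrite lj in li; move/eqP: nij; apply; exact: (wo_anti wo).
have Utot i j : U i `<=` U j \/ U j `<=` U i.
  have [->|nij] := eqVneq i j; first by left.
  by have /orP[ij|ji] := wo_total wo i j; [left|right]; apply: Umono;
    rewrite /cardinal_ltn ?ij ?ji //= eq_sym.
have ki : infinite_set [set: k].
  by rewrite (eq_finite_set kS).
(* An infinite initial ordinal has no last element, since dropping one point does not change the
   cardinality. *)
have next (j : k) : exists i, cardinal_ltn j i.
  apply: contrapT => N; have /andP[_ /negP] := cardinal_initial j; apply.
  rewrite card_eq_sym; suff -> : [set l | cardinal_le l j && (l != j)] = [set~ j].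
    exact: infinite_setD1.
  apply/seteqP; split=> [l /= /andP[_ /eqP]//|l /= /eqP lj].
  apply/andP; split=> //; have /orP[//|jl] := wo_total wo l j.
  by case: N; exists l; rewrite /cardinal_ltn jl /= eq_sym.
exists k, U; split; last by move=> i; exact: generated_subgroup.
split=> //.
  move=> i Ui; have /generatesE/Smin le := Ui.
  have /andP[_ /negP] := cardinal_initial i; apply.
  rewrite card_eq_le card_leT /=; rewrite (card_le_eql kS).
  apply: card_le_trans le (card_image_le _ _).
have gU : is_subgroup (\bigcup_i U i).
  have hU i := iffLR (is_subgroupP _) (generated_subgroup (h @` [set j | cardinal_ltn j i])).
  apply/is_subgroupP; split.
  - have [i _] : [set: k] !=set0 by exact: infinite_setN0.
    by exists i => //; have [] := hU i.
  - move=> g g' [i _ Ug] [j _ Ug'].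
    have [ij|ji] := Utot i j.
      by exists j => //; have [_ + _] := hU j; apply=> //; exact: ij.
    by exists i => //; have [_ + _] := hU i; apply=> //; exact: ji.
  - by move=> g [i _ Ug]; exists i => //; have [_ _] := hU i; apply.
apply: gS => // g /hsurj[j <-]; have [i ji] := next j; exists i => //.
by apply: sub_generated; exists j.
Qed.

Lemma subgroup_chain_strong k :
  union_of_subgroup_chain G k -> union_of_strong_chain G k.
Proof.
move=> [U [Uc Us]]; exists U; split=> // i.
have /is_subgroupP[_ UM UV] := Us i; split; first exact: setinv_sub.
by exists i => _ [g Ug [h Uh <-]]; exact: UM.
Qed.

Theorem uncountable_cofinalities : infinite_set [set: G] ->
  (~ exists C : nat -> set G, nat_strong_chain C) ->
  [/\ uncountable_strong_cofinality G, uncountable_cofinality G & bergman_property G].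
Proof.
move=> Gi nU; have bG := no_chain_bergman nU.
have [k0 k0c] := exists_subgroup_chain Gi bG.
split=> //.
  have [k kl] := least_cardinal_exists (subgroup_chain_strong k0c).
  by exists k; split=> //; apply: no_countable_strong_chain nU _; case: kl.
have [k kl] := least_cardinal_exists k0c.
exists k; split=> //; apply: no_countable_strong_chain nU _.
by apply: subgroup_chain_strong; case: kl.
Qed.

(* A bornology of "small" subsets that covers both the subsets of a subgroup of
   small index and the subsets of the members of a countable strong chain.  The
   last field says that for some piece [k] every element of the [k]-th factor
   of an infinite product [Pi] occurs in a quotient lying in one small set. *)
Record ample_bornology (bnd : set (set G)) : Prop := AmpleBornology {
  bnd_sub : forall U V, U `<=` V -> bnd V -> bnd U;
  bnd_one : bnd [set 1];
  bnd_union : forall U V, bnd U -> bnd V -> bnd (U `|` V);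
  bnd_mul : forall U V, bnd U -> bnd V -> bnd (setmul U V);
  bnd_inv : forall U, bnd U -> bnd (setinv U);
  bnd_pair : forall g : (nat -> bool) -> G, exists S S' m,
    [/\ S m = false, S' m = true & bnd [set (g S)^-1 * g S']];
  bnd_piece : forall (T : Type) (one : T) (C : nat -> set T) (Pi : (nat -> T) -> G),
    (forall k, C k one) -> exists k Z, bnd Z /\ forall c, C k c -> exists u v,
      [/\ forall j, C j (u j), forall j, C j (v j), u k = one, v k = c
        & Z ((Pi u)^-1 * Pi v)] }.

End GroupSets.

(** * Stone spaces *)

Section StonePoints.
Context {d : Order.disp_t}.
Variable B : ctbDistrLatticeType d.
Implicit Types (a b c u v : B) (y z p q : stone B).
Local Open Scope order_scope.

Definition inb y b : Prop := val y b.

Lemma inbT y : inb y \top.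
Proof. by have [[[]]] := stone_filter y. Qed.

Lemma inb0 y : ~ inb y \bot.
Proof. by have [[]] := stone_filter y. Qed.

Lemma inb_le y a b : a <= b -> inb y a -> inb y b.
Proof. by have [[[_ _ +] _] _] := stone_filter y; apply. Qed.

Lemma inbI y a b : inb y (a `&` b) <-> inb y a /\ inb y b.
Proof.
split=> [ab|[]]; last by have [[[_ + _] _] _] := stone_filter y; apply.
by split; apply: inb_le ab; [exact: leIl|exact: leIr].
Qed.

Lemma inbC y b : inb y (~` b) <-> ~ inb y b.
Proof. by split=> /stone_compl. Qed.

Lemma inbU y a b : inb y (a `|` b) <-> inb y a \/ inb y b.
Proof.
split=> [ab|[ya|yb]]; [|exact: inb_le (leUl _ _) ya|exact: inb_le (leUr _ _) yb].
apply: contrapT => /not_orP[/inbC na /inbC nb].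
apply: (@inb0 y); rewrite -(meetxC (a `|` b)) complU.
by apply/inbI; split=> //; apply/inbI.
Qed.

Lemma inbD y a b : inb y (a `&` ~` b) <-> inb y a /\ ~ inb y b.
Proof. by rewrite inbI inbC. Qed.

Lemma point_sep y z : y <> z -> exists b, inb y b /\ ~ inb z b.
Proof. exact: stone_separate. Qed.

(** Zorn's lemma runs over the sets added to [F] rather than over the filters above it, so that the
    empty chain needs no separate treatment. *)
Lemma filter_in_point (F : set B) : proper_filter F -> exists y, F `<=` inb y.
Proof.
move=> Ff; have [[FT FI Fup] F0] := Ff.
have [|M [[[MT MI Mup] M0] Mmax]] := @Zorn_bigcup _ [set M | proper_filter (F `|` M)].
  move=> C CP Ctot; split; last by move=> [|[M CM M0]] //; case: (CP _ CM) => _ []; right.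
  split; first by left.
  - move=> a b [Fa|[M CM Ma]] [Fb|[N CN Nb]]; first by left; exact: FI.
    + have [[_ NI _] _] := CP _ CN.
      by have [|] := NI a b (or_introl Fa) (or_intror Nb); [left|right; exists N].
    + have [[_ MI _] _] := CP _ CM.
      by have [|] := MI a b (or_intror Ma) (or_introl Fb); [left|right; exists M].
    + have [MN|NM] := Ctot _ _ CM CN.
        have [[_ NI _] _] := CP _ CN.
        by have [|] := NI a b (or_intror (MN _ Ma)) (or_intror Nb);
          [left|right; exists N].
      have [[_ MI _] _] := CP _ CM.
      by have [|] := MI a b (or_intror Ma) (or_intror (NM _ Nb));
        [left|right; exists M].
  - move=> a b ab [Fa|[M CM Ma]]; first by left; exact: Fup Fa.
    have [[_ _ Mup] _] := CP _ CM.
    by have [|] := Mup a b ab (or_intror Ma); [left|right; exists M].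
have Mu : ultrafilter (F `|` M).
  split=> // N Nf MN; apply: contrapT => NM.
  have FN : (F `|` N)%classic = N by apply/setUidPr => b Fb; apply: MN; left.
  apply: (Mmax N); last by change (proper_filter (F `|` N)); rewrite FN.
  split; first by move=> b Mb; apply: MN; right.
  move=> sub; apply: NM; apply/seteqP; split=> // b Nb.
  by right; exact: sub.
by exists (SigSub (mem_set Mu)) => b Fb; left.
Qed.

Lemma exists_point b : b != \bot -> exists y, inb y b.
Proof.
move=> b0; have [|y Fy] := @filter_in_point [set c | b <= c].
  split; last by rewrite /= lex0 (negbTE b0).
  split=> /=; first exact: lex1.
    by move=> a c ba bc; rewrite lexI ba.
  by move=> a c ac ba; exact: le_trans ac.
by exists y; apply: Fy => /=.
Qed.

Lemma le_points a b : (forall y, inb y a -> inb y b) -> a <= b.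
Proof.
move=> ab; apply: contrapT => nab.
have [|y] := @exists_point (a `&` ~` b); last first.
  by move=> /inbD[/ab].
apply/eqP => E; apply: nab; rewrite -[a]meetx1 -(joinxC b) meetUr E joinx0.
exact: leIr.
Qed.

Lemma eq_points a b : (forall y, inb y a <-> inb y b) -> a = b.
Proof.
by move=> ab; apply/eqP; rewrite eq_le; apply/andP; split; apply: le_points => y /ab.
Qed.

Lemma neq0_point b : b != \bot <-> exists y, inb y b.
Proof.
split; first exact: exists_point.
by move=> [y yb]; apply/eqP => b0; rewrite b0 in yb; exact: inb0 yb.
Qed.

(** Compactness. If [Q] fails at the top, the complements of the elements with [Q] generate a proper
    filter; a point containing it also has a neighbourhood with [Q], a contradiction. *)
Lemma compact_induction (Q : B -> Prop) : Q \bot ->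
  (forall a b, Q a -> Q b -> Q (a `|` b)) ->
  (forall y, exists b, inb y b /\ Q b) -> Q \top.
Proof.
move=> Q0 QU Qloc; apply: contrapT => nQ.
have [|y Fy] := @filter_in_point [set c | exists b, Q b /\ ~` b <= c].
  split; last first.
    move=> [b [Qb]]; rewrite lex0 => /eqP b1; apply: nQ.
    by rewrite -(joinxC b) b1 joinx0.
  split; first by exists \bot; split=> //; exact: lex1.
    move=> a c [b [Qb ba]] [b' [Qb' bc]]; exists (b `|` b'); split; first exact: QU.
    by rewrite complU leI2.
  by move=> a c ac [b [Qb ba]]; exists b; split=> //; exact: le_trans ac.
have [b [yb Qb]] := Qloc y.
by have /inbC : inb y (~` b) by apply: Fy; exists b.
Qed.

(** The values lie in a type without topology; propositions and functions are allowed, so that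
    continuity of maps of the base also takes this form. *)
Definition lc_at (T : Type) (f : stone B -> T) y :=
  exists b, inb y b /\ forall z, inb z b -> f z = f y.

Lemma near_points (P : set (stone B)) y :
  (\forall z \near y, P z) <-> exists b, inb y b /\ forall z, inb z b -> P z.
Proof.
split; last first.
  move=> [b [yb bP]]; have : nbhs y (stone_basic b).
    by apply: open_nbhs_nbhs; split=> //; exact: stone_basic_open.
  by apply: filterS => z; exact: bP.
move=> yP; have : nbhs y P by exact: yP.
rewrite nbhsE => -[U [[D _ <-] [b Db yb]] UP].
by exists b; split=> // z zb; apply: UP; exists b.
Qed.

Lemma lc_atP (T : Type) (f : stone B -> T) y :
  lc_at f y <-> \forall z \near y, f z = f y.
Proof. by rewrite near_points. Qed.

Lemma lc_inb b y : lc_at (fun z => inb z b) y.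
Proof.
have [yb|nyb] := pselect (inb y b).
  by exists b; split=> // z zb; rewrite propeqE; split.
by exists (~` b); split=> [|z]; [exact/inbC|move=> /inbC nzb; rewrite propeqE; split].
Qed.

Lemma lc_cst (T : Type) (t : T) y : lc_at (fun=> t) y.
Proof. by exists \top; split=> //; exact: inbT. Qed.

Lemma lc_comp (T T' : Type) (h : T -> T') (f : stone B -> T) y :
  lc_at f y -> lc_at (fun z => h (f z)) y.
Proof. by move=> [b [yb bf]]; exists b; split=> // z /bf ->. Qed.

Lemma lc_pair (T T' : Type) (f : stone B -> T) (g : stone B -> T') y :
  lc_at f y -> lc_at g y -> lc_at (fun z => (f z, g z)) y.
Proof.
move=> [b [yb bf]] [c [yc cg]]; exists (b `&` c); split; first exact/inbI.
by move=> z /inbI[/bf -> /cg ->].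
Qed.

Lemma lc_eq (T : Type) (f g : stone B -> T) y b : inb y b ->
  (forall z, inb z b -> f z = g z) -> lc_at f y -> lc_at g y.
Proof.
move=> yb fg [c [yc cf]]; exists (b `&` c); split; first exact/inbI.
by move=> z /inbI[zb zc]; rewrite -!fg // cf.
Qed.

Lemma lc_set_clopen (S : set (stone B)) : (forall y, lc_at S y) ->
  exists b, forall y, inb y b <-> S y.
Proof.
move=> Slc.
have [|||c cE] := @compact_induction (fun b => exists c, forall y, inb y b -> inb y c <-> S y).
- by exists \bot => y /inb0.
- move=> a b [a' aE] [b' bE]; exists ((a `&` a') `|` (b `&` b')) => y yab.
  rewrite inbU !inbI; split=> [[[/aE H /H]|[/bE H /H]]|Sy] //.
  by case/inbU: yab => [ya|yb]; [left|right]; split=> //; [exact/aE|exact/bE].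
- move=> y; have [b [yb bS]] := Slc y; exists b; split=> //.
  have [Sy|nSy] := pselect (S y).
    by exists \top => z /bS SE; split=> _; [rewrite SE|exact: inbT].
  by exists \bot => z /bS SE; split=> [/inb0//|]; rewrite SE.
- by exists c => y; apply: cE; exact: inbT.
Qed.

Lemma sep_point y (t : seq (stone B)) : y \notin t ->
  exists c, inb y c /\ forall q, q \in t -> ~ inb q c.
Proof.
elim: t => [|z t IH]; first by exists \top; split=> //; exact: inbT.
rewrite inE negb_or => /andP[/eqP yz /IH[c [yc ct]]].
have [b [yb nzb]] := point_sep yz; exists (b `&` c); split; first exact/inbI.
by move=> q; rewrite inE => /orP[/eqP ->|/ct nqc] /inbI[].
Qed.

Lemma sep_points (s t : seq (stone B)) : (forall p, p \in s -> p \notin t) ->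
  exists c, (forall p, p \in s -> inb p c) /\ (forall q, q \in t -> ~ inb q c).
Proof.
elim: s => [|p s IH] st; first by exists \bot; split=> // q _; exact: inb0.
have [|c [sc tc]] := IH; first by move=> q qs; apply: st; rewrite inE qs orbT.
have [|b [pb tb]] := @sep_point p t; first by apply: st; rewrite inE eqxx.
exists (b `|` c); split=> q; first by rewrite inE => /orP[/eqP ->|/sc qc]; apply/inbU; [left|right].
by move=> qt /inbU[/(tb _ qt)|/(tc _ qt)].
Qed.

Section Atomless.
Hypothesis B_atomless : atomless B.

(** By atomlessness a nonzero element shrinks to a nonzero one that avoids a given point; repeat
    along [s]. *)
Lemma fresh_point b (s : seq (stone B)) : b != \bot -> exists r, inb r b /\ r \notin s.
Proof.
elim: s b => [|p s IH] b b0; first by have [r rb] := exists_point b0; exists r.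
suff [c [cb c0 npc]] : exists c, [/\ c <= b, c != \bot & ~ inb p c].
  have [r [rc rs]] := IH c c0; exists r; split; first exact: inb_le rc.
  by rewrite inE negb_or rs andbT; apply/eqP => rp; rewrite rp in rc.
have [c [cb c0 cnb]] : exists c, [/\ c <= b, c != \bot & c != b].
  apply: contrapT => N; apply: (B_atomless.2 b); split; first exact/eqP.
  move=> c cb; have [->|c0] := eqVneq c \bot; first by left.
  by have [->|cnb] := eqVneq c b; [right|case: N; exists c].
have [pc|npc] := pselect (inb p c); last by exists c.
exists (b `&` ~` c); split; [exact: leIl| |by move=> /inbD[]].
apply/eqP => E; move/eqP: cnb; apply; apply/eqP; rewrite eq_le cb /=.
by rewrite -[b]meetx1 -(joinxC c) meetUr E joinx0 leIr.
Qed.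

Hypothesis B_countable : countable [set: B].

(** * Finite approximations to homeomorphisms with prescribed values *)

Section Homeomorphism.
Variable pts : seq (stone B * stone B).
Hypothesis pts_inj : forall pq pq', pq \in pts -> pq' \in pts -> pq.1 = pq'.1 <-> pq.2 = pq'.2.

Definition matching u v := (u = \bot <-> v = \bot) /\
  forall pq, pq \in pts -> inb pq.1 u <-> inb pq.2 v.

Fixpoint pattern u v (l : seq (B * B)) : Prop :=
  if l is (b, c) :: l' then
    pattern (u `&` b) (v `&` c) l' /\ pattern (u `&` ~` b) (v `&` ~` c) l'
  else matching u v.

(** When both parts of [u] are nonzero, [c] separates the prescribed images belonging to one part
    from those belonging to the other; the fresh points [r1] and [r2] keep both parts of [v]
    nonzero. *)
Lemma matching_split u v b : matching u v ->
  exists c, matching (u `&` b) (v `&` c) /\ matching (u `&` ~` b) (v `&` ~` c).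
Proof.
move=> [uv0 uvp].
have [ub0|ub0] := eqVneq (u `&` b) \bot.
  exists \bot; rewrite meetx0 compl0 meetx1 ub0.
  have nub p : inb p u -> ~ inb p b.
    by move=> pu pb; apply: (@inb0 p); rewrite -ub0; exact/inbI.
  have -> : u `&` ~` b = u.
    by apply: eq_points => p; rewrite inbD; split=> [[]|pu] //; split=> //; exact: nub.
  by split; split=> // pq _; split=> /inb0.
have [ub1|ub1] := eqVneq (u `&` ~` b) \bot.
  exists \top; rewrite meetx1 compl1 meetx0 ub1.
  have nub p : inb p u -> inb p b.
    by move=> pu; apply: contrapT => npb; apply: (@inb0 p); rewrite -ub1; exact/inbD.
  have -> : u `&` b = u.
    by apply: eq_points => p; rewrite inbI; split=> [[]|pu] //; split=> //; exact: nub.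
  by split; split=> // pq _; split=> /inb0.
have v0 : v != \bot.
  by apply/eqP => /uv0 u0; move: ub0; rewrite u0 meet0x eqxx.
pose s := [seq pq.2 | pq <- pts & `[< inb pq.1 (u `&` b) >]].
pose t := [seq pq.2 | pq <- pts & `[< inb pq.1 (u `&` ~` b) >]].
have sE pq : pq \in pts -> pq.2 \in s <-> inb pq.1 (u `&` b).
  move=> pqp; split=> [/mapP[pq']|H].
    by rewrite mem_filter => /andP[/asboolP H pq'p] /pts_inj ->.
  by apply/mapP; exists pq => //; rewrite mem_filter pqp andbT; apply/asboolP.
have tE pq : pq \in pts -> pq.2 \in t <-> inb pq.1 (u `&` ~` b).
  move=> pqp; split=> [/mapP[pq']|H].
    by rewrite mem_filter => /andP[/asboolP H pq'p] /pts_inj ->.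
  by apply/mapP; exists pq => //; rewrite mem_filter pqp andbT; apply/asboolP.
have [r1 [r1v r1st]] := fresh_point (s ++ t) v0.
have [r2 [r2v]] := fresh_point (r1 :: s ++ t) v0.
rewrite inE negb_or => /andP[r21 r2st].
rewrite mem_cat negb_or in r1st; case/andP: r1st => r1s r1t.
rewrite mem_cat negb_or in r2st; case/andP: r2st => r2s r2t.
have [|c [sc tc]] := @sep_points (r1 :: s) (r2 :: t).
  move=> p; rewrite !inE => /orP[/eqP ->|ps]; first by rewrite negb_or eq_sym r21.
  rewrite negb_or; apply/andP; split; first by apply: contraNneq r2s => <-.
  have /mapP[pq] := ps; rewrite mem_filter => /andP[_ pqp] pE.
  rewrite pE in ps *; apply/negP => /(tE _ pqp)/inbD[_ nb].
  by have /(sE _ pqp)/inbI[] := ps.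
exists c; split; split.
- split=> [|E]; first by move/eqP; rewrite (negbTE ub0).
  case: (@inb0 r1); rewrite -E; apply/inbI; split=> //.
  by apply: sc; rewrite inE eqxx.
- move=> pq pqp; split=> [H|/inbI[qv qc]].
    apply/inbI; split; first by apply/(uvp _ pqp); case/inbI: H.
    by apply: sc; rewrite inE; apply/orP; right; exact/sE.
  apply/inbI; split; first exact/(uvp _ pqp).
  apply: contrapT => npb; apply: tc qc; rewrite inE; apply/orP; right.
  by apply/tE => //; apply/inbD; split=> //; exact/(uvp _ pqp).
- split=> [|E]; first by move/eqP; rewrite (negbTE ub1).
  case: (@inb0 r2); rewrite -E; apply/inbD; split=> //.
  by apply: tc; rewrite inE eqxx.
- move=> pq pqp; split=> [H|/inbD[qv nqc]].
    apply/inbD; split; first by apply/(uvp _ pqp); case/inbD: H.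
    by apply: tc; rewrite inE; apply/orP; right; exact/tE.
  apply/inbD; split; first exact/(uvp _ pqp).
  move=> pb; apply: nqc; apply: sc; rewrite inE; apply/orP; right.
  by apply/sE => //; apply/inbI; split=> //; exact/(uvp _ pqp).
Qed.

Lemma pattern_meet u v l b c c' : v `&` c = v `&` c' ->
  pattern u v (rcons l (b, c)) -> pattern u v (rcons l (b, c')).
Proof.
elim: l u v => [|[b0 c0] l IH] u v vcc /=.
  have -> : v `&` ~` c' = v `&` ~` c; last by rewrite vcc.
  apply: eq_points => y; rewrite !inbD.
  have : inb y (v `&` c) <-> inb y (v `&` c') by rewrite vcc.
  by rewrite !inbI; tauto.
move=> [H1 H2]; split; apply: IH; [|exact: H1| |exact: H2];
by rewrite meetAC vcc meetAC.
Qed.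

(** The two halves are extended independently and reassembled along [c0]; by [pattern_meet] only the
    trace of the new element on each half matters. *)
Lemma pattern_rcons u v l b : pattern u v l -> exists c, pattern u v (rcons l (b, c)).
Proof.
elim: l u v => [|[b0 c0] l IH] u v /=; first exact: matching_split.
move=> [/IH[c1 H1] /IH[c2 H2]]; exists ((c0 `&` c1) `|` (c2 `&` ~` c0)).
split; [apply: pattern_meet H1|apply: pattern_meet H2];
apply: eq_points => y; rewrite !inbI !inbU ?inbD ?inbC !inbI ?inbC; tauto.
Qed.

Lemma pattern_consistent u v l y : pattern u v l -> inb y u ->
  exists z, inb z v /\ forall bc, bc \in l -> inb y bc.1 <-> inb z bc.2.
Proof.
elim: l u v => [|[b c] l IH] u v /=.
  move=> [uv _] yu; have [|z zv] := @exists_point v; last by exists z.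
  by apply/eqP => /uv u0; rewrite u0 in yu; exact: inb0 yu.
move=> [H1 H2] yu; have [yb|nyb] := pselect (inb y b).
  have [|z [/inbI[zv zc] zl]] := IH _ _ H1; first exact/inbI.
  by exists z; split=> // bc; rewrite inE => /orP[/eqP ->|/zl].
have [|z [/inbD[zv nzc] zl]] := IH _ _ H2; first exact/inbD.
by exists z; split=> // bc; rewrite inE => /orP[/eqP ->|/zl].
Qed.

Lemma pattern_pts u v l pq : pattern u v l -> pq \in pts -> inb pq.1 u ->
  inb pq.2 v /\ forall bc, bc \in l -> inb pq.1 bc.1 <-> inb pq.2 bc.2.
Proof.
move=> + pqp; elim: l u v => [|[b c] l IH] u v /=; first by move=> [_ /(_ _ pqp) ->].
move=> [H1 H2] yu; have [yb|nyb] := pselect (inb pq.1 b).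
  have [|/inbI[zv zc] zl] := IH _ _ H1; first exact/inbI.
  by split=> // bc; rewrite inE => /orP[/eqP ->|/zl].
have [|/inbD[zv nzc] zl] := IH _ _ H2; first exact/inbD.
by split=> // bc; rewrite inE => /orP[/eqP ->|/zl].
Qed.

End Homeomorphism.

Definition swap (T U : Type) (p : T * U) := (p.2, p.1).

Lemma pattern_swap pts u v l : pattern pts u v l ->
  pattern [seq swap pq | pq <- pts] v u [seq swap bc | bc <- l].
Proof.
elim: l u v => [|[b c] l IH] u v /=; last by move=> [H1 H2]; split; exact: IH.
move=> [uv0 uvp]; split; first by rewrite uv0.
by move=> _ /mapP[pq pqp ->] /=; rewrite uvp.
Qed.

Definition homeo (phi psi : stone B -> stone B) :=
  [/\ cancel phi psi, cancel psi phi,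
      forall b, exists c, forall y, inb (phi y) b <-> inb y c &
      forall b, exists c, forall y, inb (psi y) b <-> inb y c].

Lemma homeo_sym phi psi : homeo phi psi -> homeo psi phi.
Proof. by case. Qed.

(** The elements related to members of [y] form a proper filter because [Z] is consistent on any
    three pairs; [z] is a point containing it. *)
Let relation_point (Z : B -> B -> Prop) :
  (forall c, exists b, Z b c) ->
  (forall y (s : seq (B * B)), (forall bc, bc \in s -> Z bc.1 bc.2) ->
    exists z, forall bc, bc \in s -> inb y bc.1 <-> inb z bc.2) ->
  forall y, exists z, forall b c, Z b c -> inb y b <-> inb z c.
Proof.
move=> Zc Zpt y; pose F := [set c | exists b, Z b c /\ inb y b].
have Z1 b c : Z b c -> exists z, inb y b <-> inb z c.
  move=> Zbc; have [|z zE] := Zpt y [:: (b, c)].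
    by move=> bc; rewrite inE => /eqP ->.
  by exists z; apply: (zE (b, c)); rewrite inE.
have Z3 b1 c1 b2 c2 b3 c3 : Z b1 c1 -> Z b2 c2 -> Z b3 c3 -> exists z,
    [/\ inb y b1 <-> inb z c1, inb y b2 <-> inb z c2 & inb y b3 <-> inb z c3].
  move=> Z1' Z2 Z3; have [|z zE] := Zpt y [:: (b1, c1); (b2, c2); (b3, c3)].
    by move=> bc; rewrite !inE => /or3P[]/eqP ->.
  by exists z; split; [apply: (zE (b1, c1))|apply: (zE (b2, c2))|apply: (zE (b3, c3))];
    rewrite !inE eqxx ?orbT.
have Ff : proper_filter F.
  split; first split.
  - have [b Zb] := Zc \top; exists b; split=> //; have [z zE] := Z1 _ _ Zb.
    by apply/zE; exact: inbT.
  - move=> c c' [b [Zb yb]] [b' [Zb' yb']]; have [b'' Zb''] := Zc (c `&` c').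
    exists b''; split=> //; have [z [E E' E'']] := Z3 _ _ _ _ _ _ Zb Zb' Zb''.
    by apply/E''/inbI; split; [exact/E|exact/E'].
  - move=> c c' cc' [b [Zb yb]]; have [b' Zb'] := Zc c'.
    exists b'; split=> //; have [z [E E' _]] := Z3 _ _ _ _ _ _ Zb Zb' Zb.
    by apply/E'; apply: inb_le cc' _; apply/E.
  - by move=> [b [Zb yb]]; have [z /iffLR/(_ yb)/inb0] := Z1 _ _ Zb.
have [z Fz] := filter_in_point Ff; exists z => b c Zbc; split=> [yb|zc].
  by apply: Fz; exists b.
apply: contrapT => nyb; have [b' Zb'] := Zc (~` c).
have [z' [E E' _]] := Z3 _ _ _ _ _ _ Zbc Zb' Zbc.
have /inbC // : inb z (~` c).
by apply: Fz; exists b'; split=> //; apply/E'/inbC => /E.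
Qed.

(** The back-and-forth yields the graph of an automorphism of [B], which [relation_point] dualizes
    in both directions. Lists are reversed because [back_and_forth] extends at the head and
    [pattern_rcons] at the end. *)
Lemma exists_homeo (pts : seq (stone B * stone B)) (l0 : seq (B * B)) :
  (forall pq pq', pq \in pts -> pq' \in pts -> pq.1 = pq'.1 <-> pq.2 = pq'.2) ->
  pattern pts \top \top l0 -> exists phi psi,
  [/\ homeo phi psi, forall bc, bc \in l0 -> forall y, inb y bc.1 <-> inb (phi y) bc.2 &
      forall pq, pq \in pts -> phi pq.1 = pq.2].
Proof.
move=> ptsI pl0.
have ptsI' pq pq' : pq \in map (@swap _ _) pts -> pq' \in map (@swap _ _) pts ->
    pq.1 = pq'.1 <-> pq.2 = pq'.2.
  by move=> /mapP[r rp ->] /mapP[r' rp' ->] /=; rewrite ptsI.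
have swapK T U (s : seq (T * U)) : map (@swap _ _) (map (@swap _ _) s) = s.
  by rewrite -map_comp -[RHS]map_id; apply: eq_map => -[].
have [|||l [lP lm l0l lB lB']] := @back_and_forth B B
    (fun l => pattern pts \top \top (rev l)) (rev l0) B_countable B_countable.
- by rewrite revK.
- move=> l b pl; have [c pc] := pattern_rcons ptsI b pl.
  by exists c; rewrite rev_cons.
- move=> l c pl; have [b /pattern_swap pb] := pattern_rcons ptsI' c (pattern_swap pl).
  exists b; move: pb; rewrite swapK rev_cons map_rcons.
  by rewrite [map _ (map _ _)]swapK.
pose Z b c := exists k, (b, c) \in l k.
have Zl (s : seq (B * B)) : (forall bc, bc \in s -> Z bc.1 bc.2) ->
    exists k, {subset s <= l k}.
  elim: s => [|[b c] s IH] sZ; first by exists 0%N.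
  have [|k1 k1s] := IH; first by move=> bc bcs; apply: sZ; rewrite inE bcs orbT.
  have [|k2 k2b] := sZ (b, c); first by rewrite inE eqxx.
  exists (maxn k1 k2) => bc; rewrite inE => /orP[/eqP ->|/k1s].
    by apply: lm k2b; exact: leq_maxr.
  by apply: lm; exact: leq_maxl.
have Zc c : exists b, Z b c by have [k [b bc]] := lB' c; exists b, k.
have Zb b : exists c, Z b c by have [k [c bc]] := lB b; exists c, k.
have /choice[phi phiE] : forall y, exists z, forall b c, Z b c -> inb y b <-> inb z c.
  apply: relation_point => // y s /Zl[k sk].
  have [z [_ zE]] := pattern_consistent (lP k) (inbT y).
  by exists z => bc bcs; apply: zE; rewrite mem_rev; exact: sk.
have /choice[psi psiE] : forall y, exists z, forall c b, Z b c -> inb y c <-> inb z b.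
  apply: (@relation_point (fun c b => Z b c)) => // y s sZ.
  have [|k sk] := Zl (map (@swap _ _) s).
    by move=> _ /mapP[[c b] cbs ->]; exact: (sZ (c, b)).
  have [z [_ zE]] := pattern_consistent (pattern_swap (lP k)) (inbT y).
  exists z => -[c b] bcs; apply: zE; apply/mapP; exists (b, c) => //.
  by rewrite mem_rev; apply: sk; apply/mapP; exists (c, b).
have ext y z : (forall b, inb y b <-> inb z b) -> y = z.
  move=> yz; apply: contrapT => /point_sep[b [yb nzb]]; apply: nzb; exact/yz.
exists phi, psi; split.
- split.
  + move=> y; apply: ext => b; have [c Zbc] := Zb b.
    by rewrite -(psiE _ _ _ Zbc) -(phiE _ _ _ Zbc).
  + move=> y; apply: ext => c; have [b Zbc] := Zc c.
    by rewrite -(phiE _ _ _ Zbc) -(psiE _ _ _ Zbc).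
  + by move=> c; have [b Zbc] := Zc c; exists b => y; rewrite (phiE _ _ _ Zbc).
  + by move=> b; have [c Zbc] := Zb b; exists c => y; rewrite (psiE _ _ _ Zbc).
- move=> [b c] bcl y; apply: phiE; exists 0%N; apply: l0l; by rewrite mem_rev.
- move=> pq pqp; apply: ext => c; have [b [k bck]] := Zc c.
  rewrite -(phiE _ b c); last by exists k.
  have [_ /(_ (b, c))] := pattern_pts (lP k) pqp (inbT _).
  by rewrite mem_rev; apply.
Qed.

End Atomless.
End StonePoints.

(** * Automorphisms with prescribed support *)

Lemma aut_mulK (L : signature) (M : algebra L) (g : aut M) : cancel g (g^-1)%g.
Proof. by move=> a; exact: (congr1 (fun h : aut M => h a) (aut_mulVg g)). Qed.

Lemma aut_mulVK (L : signature) (M : algebra L) (g : aut M) : cancel (g^-1)%g g.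
Proof. by move=> a; exact: (congr1 (fun h : aut M => h a) (aut_mulgV g)). Qed.

Section FilteredPower.
Variables (L : signature) (A : algebra L).
Context {d : Order.disp_t}.
Variable B : ctbDistrLatticeType d.
Variables (n : nat) (x : 'I_n -> stone B) (e : 'I_n -> A).
Hypotheses (x_distinct : injective x) (e_idempotent : forall i, idempotent_element (e i)).
Local Notation F := (filtered_boolean_power x_distinct e_idempotent).
Implicit Types (f : F) (y z p : stone B) (b : B).

Definition ev f : stone B -> A := val (val f).

Lemma ev_op s (a : 'I_(arity s) -> F) y :
  ev (op F s a) y = op A s (fun i => ev (a i) y).
Proof. by []. Qed.

Lemma ev_inj f g : (forall y, ev f y = ev g y) -> f = g.
Proof. by move=> fg; apply/val_inj/val_inj/funext. Qed.

Lemma ev_lc f y : lc_at (ev f) y.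
Proof. by apply/lc_atP; have /locally_constantP := set_valP (val f); apply. Qed.

Lemma ev_x f i : ev f (x i) = e i.
Proof. exact: (set_valP f i). Qed.

Lemma ev_exists (f : stone B -> A) : (forall y, lc_at f y) ->
  (forall i, f (x i) = e i) -> exists f', ev f' = f.
Proof.
move=> flc fx; have fc : f \in @boolean_power_set L A _ B.
  by rewrite inE; apply/locally_constantP => y; apply/lc_atP.
pose f1 : boolean_power A B := SigSub fc.
have f1x : f1 \in @filtered_boolean_power_set _ A _ B _ x e by rewrite inE.
by exists (SigSub f1x).
Qed.

(* [E] is a finite set of exceptional points with neighbourhood [W], and every
   element of the power agrees near [E] with one of the sections in [SS] *)
Section Twisted.
Variables (E : seq (stone B)) (W : B) (SS : set (stone B -> A)).
Hypothesis EW : forall p, p \in E -> inb p W.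
Hypothesis xE : forall i, inb (x i) W -> x i \in E.
Hypothesis SS_lc : forall s y, SS s -> lc_at s y.
Hypothesis SS_F : forall f, exists s b, [/\ SS s, forall p, p \in E -> inb p b &
  forall y, inb y b -> ev f y = s y].
Variable a0 : A.

Local Notation Q := (stone B * A)%type.
Implicit Types (g h : Q -> Q) (q : Q).

(* Over the point [y] the map [g] of [X * A] is fiberwise an automorphism of [A],
   locally constant along the fiber, continuous along the base, and it preserves
   the graphs of the sections *)
Definition good g y := [/\
  exists y' (alpha : aut A), forall a, g (y, a) = (y', alpha a),
  lc_at (fun z a => (g (z, a)).2) y,
  forall b, lc_at (fun z a => inb (g (z, a)).1 b) y &
  forall s, SS s -> (g (y, s y)).2 = s (g (y, s y)).1].

Lemma good_base g y a : good g y -> (g (y, a)).1 = (g (y, a0)).1.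
Proof. by move=> [[y' [alpha gE]] _ _ _]; rewrite !gE. Qed.

Lemma good_through (T : Type) (k : stone B -> T) g y : good g y ->
  lc_at k (g (y, a0)).1 -> lc_at (fun z a => k (g (z, a)).1) y.
Proof.
move=> gg [b [yb bk]]; have [_ _ /(_ b)[c [yc cg]] _] := gg.
exists c; split=> // z zc; apply/funext => a.
have gb a' : inb (g (z, a')).1 b.
  by have := congr1 (fun k => k a') (cg z zc); rewrite /= (good_base _ gg) => ->.
rewrite bk; last exact: gb.
by rewrite (good_base a gg).
Qed.

Lemma good_comp g h y : good g y -> good h (g (y, a0)).1 -> good (h \o g) y.
Proof.
move=> gg hg; have [[y' [al gE]] g2 _ gs] := gg; have [[y'' [be hE]] h2 h1 hs] := hg.
split.
- exists y'', (aut_mul be al) => a /=.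
  by rewrite [g _]surjective_pairing (good_base _ gg) hE gE.
- have [b [yb bE]] := good_through gg h2; have [c [yc cE]] := g2.
  exists (b `&` c)%O; split; first exact/inbI.
  move=> z /inbI[zb zc]; apply/funext => a /=.
  have := congr1 (fun k => k a (g (z, a)).2) (bE z zb).
  rewrite -surjective_pairing /= => ->.
  have := congr1 (fun k => k a) (cE z zc); rewrite /= => ->.
  by rewrite -surjective_pairing.
- move=> b; have [b' [yb bE]] := good_through gg (h1 b); have [c [yc cE]] := g2.
  exists (b' `&` c)%O; split; first exact/inbI.
  move=> z /inbI[zb zc]; apply/funext => a /=.
  have := congr1 (fun k => k a (g (z, a)).2) (bE z zb).
  rewrite -surjective_pairing /= => ->.
  have := congr1 (fun k => k a) (cE z zc); rewrite /= => ->.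
  by rewrite -surjective_pairing.
- move=> s Ss /=; rewrite [g _]surjective_pairing gs // (good_base _ gg).
  exact: hs.
Qed.

Lemma good_local g h y b : inb y b -> (forall z a, inb z b -> g (z, a) = h (z, a)) ->
  good g y -> good h y.
Proof.
move=> yb gh [[y' [al gE]] g2 g1 gs]; split.
- by exists y', al => a; rewrite -gh.
- by apply: (lc_eq yb _ g2) => z zb; apply/funext => a; rewrite gh.
- by move=> c; apply: (lc_eq yb _ (g1 c)) => z zb; apply/funext => a; rewrite gh.
- by move=> s Ss; rewrite -gh // gs.
Qed.

Lemma good_id y : good id y.
Proof.
split=> //.
- by exists y, (aut_one A).
- exact: (lc_cst (fun a => a)).
- move=> b; have [c [yc cE]] := lc_inb b y; exists c; split=> // z zc.
  by apply/funext => a /=; exact: cE.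
Qed.

(** The region on which twisted maps act; [E] plays the role of its point at infinity. *)
Definition Rpt y := inb y W /\ y \notin E.

Definition piso (M N : set (stone B)) g g' := [/\
  forall q, M q.1 -> N (g q).1 /\ g' (g q) = q,
  forall q, N q.1 -> M (g' q).1 /\ g (g' q) = q,
  forall y, M y -> good g y & forall y, N y -> good g' y].

Lemma piso_sym M N g g' : piso M N g g' -> piso N M g' g.
Proof. by case. Qed.

Lemma piso_id M : piso M M id id.
Proof. by split=> // y _; exact: good_id. Qed.

Lemma piso_comp M N P g g' h h' :
  piso M N g g' -> piso N P h h' -> piso M P (h \o g) (g' \o h').
Proof.
move=> [g1 g2 g3 g4] [h1 h2 h3 h4]; split=> /=.
- move=> q /g1[Ngq gK]; have [Phq hK] := h1 _ Ngq; split=> //.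
  by rewrite hK.
- move=> q /h2[Nhq hK]; have [Mgq gK] := g2 _ Nhq; split=> //.
  by rewrite gK.
- by move=> y My; apply: good_comp; [exact: g3|apply: h3; exact: (g1 (y, a0) My).1].
- by move=> y Py; apply: good_comp; [exact: h4|apply: g4; exact: (h2 (y, a0) Py).1].
Qed.

Lemma piso_restrict M N M0 N0 g g' : piso M N g g' ->
  (forall y, M0 y <-> M y /\ N0 (g (y, a0)).1) ->
  (forall y, N0 y -> N y) -> piso M0 N0 g g'.
Proof.
move=> [g1 g2 g3 g4] M0E N0N; split.
- move=> [y a] /M0E[My N0y]; have [_ gK] := g1 (y, a) My; split=> //.
  by rewrite (good_base _ (g3 y My)).
- move=> [y a] N0y; have [Mgy gK] := g2 (y, a) (N0N _ N0y); split=> //.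
  apply/M0E; split=> //; rewrite -(good_base (g' (y, a)).2) -?surjective_pairing ?gK //.
  exact: g3.
- by move=> y /M0E[/g3].
- by move=> y /N0N/g4.
Qed.

Lemma piso_glue (T : Type) (pi pi' : stone B -> T) M N (g g' : T -> Q -> Q) :
  (forall y, M y -> lc_at pi y) -> (forall y, N y -> lc_at pi' y) ->
  (forall t, piso [set y | M y /\ pi y = t] [set y | N y /\ pi' y = t] (g t) (g' t)) ->
  piso M N (fun q => g (pi q.1) q) (fun q => g' (pi' q.1) q).
Proof.
move=> lcM lcN gt; split.
- move=> q Mq; have [/(_ q (conj Mq erefl))[[Ngq pigq] gK] _ _ _] := gt (pi q.1).
  by split=> //; rewrite pigq.
- move=> q Nq; have [_ /(_ q (conj Nq erefl))[[Mgq pigq] gK] _ _] := gt (pi' q.1).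
  by split=> //; rewrite pigq.
- move=> y My; have [_ _ /(_ y (conj My erefl)) gy _] := gt (pi y).
  have [b [yb bE]] := lcM y My.
  by apply: good_local gy; [exact: yb|move=> z a /bE /= ->].
- move=> y Ny; have [_ _ _ /(_ y (conj Ny erefl)) gy] := gt (pi' y).
  have [b [yb bE]] := lcN y Ny.
  by apply: good_local gy; [exact: yb|move=> z a /bE /= ->].
Qed.

(* No continuity is required at the points of [E] *)
Record tw := Tw {
  tf : Q -> Q;
  tg : Q -> Q;
  tw_piso : piso Rpt Rpt tf tg;
  tf_out : forall q, ~ Rpt q.1 -> tf q = q;
  tg_out : forall q, ~ Rpt q.1 -> tg q = q }.

Implicit Types (v w : tw).

Definition tw_inv w := Tw (piso_sym (tw_piso w)) (@tg_out w) (@tf_out w).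

Definition tw_one := @Tw id id (piso_id Rpt) (fun q _ => erefl) (fun q _ => erefl).

Lemma tw_mul_out v w q : ~ Rpt q.1 -> (tf v \o tf w) q = q.
Proof. by move=> nR /=; rewrite (tf_out w nR) tf_out. Qed.

Lemma tw_mul_out' v w q : ~ Rpt q.1 -> (tg w \o tg v) q = q.
Proof. by move=> nR /=; rewrite (tg_out v nR) tg_out. Qed.

Definition tw_mul v w :=
  Tw (piso_comp (tw_piso w) (tw_piso v)) (@tw_mul_out v w) (@tw_mul_out' v w).

Lemma tfK w : cancel (tf w) (tg w).
Proof.
move=> q; have [Rq|nRq] := pselect (Rpt q.1); last by rewrite (tf_out w nRq) tg_out.
by have [/(_ q Rq)[]] := tw_piso w.
Qed.

Lemma tgK w : cancel (tg w) (tf w).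
Proof. exact: (tfK (tw_inv w)). Qed.

Lemma tf_R w q : Rpt q.1 -> Rpt (tf w q).1.
Proof. by move=> Rq; have [/(_ q Rq)[]] := tw_piso w. Qed.

Lemma tg_R w q : Rpt q.1 -> Rpt (tg w q).1.
Proof. exact: (@tf_R (tw_inv w)). Qed.

Lemma tf_good w y : y \notin E -> good (tf w) y.
Proof.
move=> yE; have [yW|nyW] := pselect (inb y W).
  by have [_ _ + _] := tw_piso w; apply.
apply: (@good_local id _ _ (~` W)%O); [exact/inbC| |exact: good_id].
by move=> z a /inbC nzW; rewrite tf_out // => -[].
Qed.

Lemma tg_good w y : y \notin E -> good (tg w) y.
Proof. exact: (@tf_good (tw_inv w)). Qed.

Lemma tf_base w y a : (tf w (y, a)).1 = (tf w (y, a0)).1.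
Proof.
have [yE|yE] := boolP (y \in E); last exact: good_base (tf_good w yE).
by rewrite !tf_out //= => -[_]; rewrite yE.
Qed.

Lemma tg_base w y a : (tg w (y, a)).1 = (tg w (y, a0)).1.
Proof. exact: (@tf_base (tw_inv w)). Qed.

Lemma tf_baseq w q : (tf w q).1 = (tf w (q.1, a0)).1.
Proof. by case: q => y a; exact: tf_base. Qed.

Lemma tg_baseq w q : (tg w q).1 = (tg w (q.1, a0)).1.
Proof. exact: (@tf_baseq (tw_inv w)). Qed.

Lemma tf_notE w q : q.1 \notin E -> (tf w q).1 \notin E.
Proof.
move=> qE; have [/(@tf_R w)[]//|nR] := pselect (Rpt q.1).
by rewrite tf_out.
Qed.

Lemma tg_notE w q : q.1 \notin E -> (tg w q).1 \notin E.
Proof. exact: (@tf_notE (tw_inv w)). Qed.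

(* Compactness makes every twisted map continuous at the exceptional set [E] *)
Lemma tf_extend w b : (forall p, p \in E -> inb p b) ->
  exists c, (forall p, p \in E -> inb p c) /\
    forall q, inb q.1 c -> q.1 \notin E -> inb (tf w q).1 b.
Proof.
move=> Eb.
have [|||c cP] := @compact_induction _ B (fun a => exists c,
    (forall p, p \in E -> ~ inb p c) /\
    forall q, inb q.1 a -> ~ inb q.1 b -> inb (tg w q).1 c).
- by exists \bot%O; split=> [p _|q /inb0//]; exact: inb0.
- move=> a a' [c [Ec cP]] [c' [Ec' cP']]; exists (c `|` c')%O; split.
    by move=> p pE /inbU[/Ec|/Ec']; apply.
  by move=> q /inbU[/cP H|/cP' H] /H ?; apply/inbU; [left|right].
- move=> y; have [yb|nyb] := pselect (inb y b).
    by exists b; split=> //; exists \bot%O; split=> [p _|q //]; exact: inb0.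
  have yE : y \notin E by apply/negP => /Eb.
  have yE' : (tg w (y, a0)).1 \notin E by exact: tg_notE.
  have [c [yc cE]] := sep_point yE'.
  have [_ _ /(_ c)[b' [yb' b'E]] _] := tg_good w yE.
  exists b'; split=> //; exists c; split=> // -[z a] /= /b'E zE _.
  have := congr1 (fun k => k a) zE; rewrite /= => ->.
  by rewrite tg_base.
exists (~` c)%O; split; first by move=> p /cP.1 ?; exact/inbC.
move=> q /inbC nqc qE; apply: contrapT => nb; apply: nqc.
by have := cP.2 (tf w q) (inbT _) nb; rewrite tfK.
Qed.

(** The image of [f], computed by pulling the base point back. The coordinate [a0] is a dummy: the
    base point of [tg w (y, a)] does not depend on [a]. *)
Definition afun w f y := (tf w ((tg w (y, a0)).1, ev f (tg w (y, a0)).1)).2.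

Lemma afunE w f q : ev f q.1 = q.2 -> afun w f (tf w q).1 = (tf w q).2.
Proof.
move=> fq; rewrite /afun -tg_baseq tfK fq.
by rewrite -surjective_pairing.
Qed.

(** Away from [E] local constancy composes. Near [E] the function [f] agrees with a section from
    [SS], which [w] preserves, so its image agrees near [E] with the same section. *)
Lemma afun_lc w f y : lc_at (afun w f) y.
Proof.
have [yE|yE] := boolP (y \in E); last first.
  have yE' : (tg w (y, a0)).1 \notin E by exact: tg_notE.
  have H : lc_at (fun z => (tf w (z, ev f z)).2) (tg w (y, a0)).1.
    have [_ t2 _ _] := tf_good w yE'.
    exact: (lc_comp (fun p : (A -> A) * A => p.1 p.2) (lc_pair t2 (@ev_lc f _))).
  have := good_through (tg_good w yE) H.
  exact: (lc_comp (fun k : A -> A => k a0)).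
have [s [b [Ss Eb bs]]] := SS_F f.
have [c [Ec cb]] := tf_extend (tw_inv w) Eb.
apply: (@lc_eq _ _ _ s _ _ c); [exact: Ec| |exact: SS_lc].
move=> z zc; have [zE|zE] := boolP (z \in E).
  by rewrite /afun tg_out ?tf_out /= ?bs //; [exact: Eb|case=> _; rewrite zE..].
have := cb (z, a0) zc zE; rewrite /= => zb.
have zE' : (tg w (z, a0)).1 \notin E by exact: tg_notE.
rewrite /afun bs //; have [_ _ _ ->] := tf_good w zE' => //.
by rewrite tf_base -tf_baseq tgK.
Qed.

Lemma afun_exists w f : exists f', ev f' = afun w f.
Proof.
apply: ev_exists => [y|i]; first exact: afun_lc.
have nR : ~ Rpt (x i) by move=> [/xE ->].
by rewrite /afun tg_out // tf_out // ev_x.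
Qed.

Lemma act_exists w : exists h : aut F,
  forall f q, ev f q.1 = q.2 -> ev (h f) (tf w q).1 = (tf w q).2.
Proof.
have /choice[h hE] := afun_exists w; have /choice[k kE] := afun_exists (tw_inv w).
have hP f q : ev f q.1 = q.2 -> ev (h f) (tf w q).1 = (tf w q).2.
  by move=> /afunE; rewrite hE.
have kP f q : ev f q.1 = q.2 -> ev (k f) (tg w q).1 = (tg w q).2.
  by rewrite kE; exact: (@afunE (tw_inv w)).
have hK : cancel h k.
  move=> f; apply: ev_inj => y.
  by have := kP _ _ (hP f (y, ev f y) erefl); rewrite tfK.
have kK : cancel k h.
  move=> f; apply: ev_inj => y.
  by have := hP _ _ (kP f (y, ev f y) erefl); rewrite tgK.
have hh : homomorphism h.
  move=> s a; apply: ev_inj => y; rewrite ev_op.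
  pose y' := (tg w (y, a0)).1.
  have yE : (tf w (y', a0)).1 = y by rewrite -tf_baseq tgK.
  have [al alE] : exists al : aut A, forall c, tf w (y', c) = (y, al c).
    have [yE'|yE'] := boolP (y' \in E).
      exists (aut_one A) => c; rewrite tf_out; last by case=> _; rewrite yE'.
      by rewrite -yE tf_out //; case=> _; rewrite yE'.
    have [[y'' [al alE]] _ _ _] := tf_good w yE'.
    by exists al => c; rewrite alE -yE alE.
  have evE f : ev (h f) y = al (ev f y').
    by have := hP f (y', ev f y') erefl; rewrite alE.
  rewrite evE ev_op aut_hom; congr (op A s _).
  by apply/funext => i /=; rewrite evE.
by exists (Aut hh (Bijective hK kK)).
Qed.

Definition act w : aut F := projT1 (cid (act_exists w)).

Lemma actE w f q : ev f q.1 = q.2 -> ev (act w f) (tf w q).1 = (tf w q).2.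
Proof. by rewrite /act; case: cid => /= h; apply. Qed.

Lemma act_unique w (h : aut F) :
  (forall f q, ev f q.1 = q.2 -> ev (h f) (tf w q).1 = (tf w q).2) -> h = act w.
Proof.
move=> hE; apply: aut_ext => f; apply: ev_inj => y.
pose q := tg w (y, a0); pose q' := (q.1, ev f q.1).
have yE : (tf w q').1 = y by rewrite tf_baseq -[(q'.1, a0)]/(q.1, a0) -(tf_baseq w q) tgK.
by rewrite -yE hE // actE.
Qed.

Local Open Scope group_scope.

Lemma act_ext v w : (forall q, Rpt q.1 -> tf v q = tf w q) -> act v = act w.
Proof.
move=> vw; apply: act_unique => f q fq.
have <- : tf v q = tf w q by have [/vw//|nR] := pselect (Rpt q.1); rewrite !tf_out.
exact: actE.
Qed.

Lemma act_mul v w : act (tw_mul v w) = act v * act w.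
Proof. by apply/esym/act_unique => f q fq /=; do 2 apply: actE. Qed.

Lemma act_one : act tw_one = 1.
Proof. by apply/esym/act_unique. Qed.

Lemma act_inv w : act (tw_inv w) = (act w)^-1.
Proof.
apply: (mulgI (act w)); rewrite mulgV -act_mul -act_one.
by apply: act_ext => q _ /=; rewrite tgK.
Qed.

Definition supp (M : set (stone B)) w := forall q, ~ M q.1 -> tf w q = q.

Lemma supp_sub M N w : M `<=` N -> supp M w -> supp N w.
Proof. by move=> MN Mw q nNq; apply: Mw => /MN. Qed.

Lemma supp_inv M w : supp M w -> supp M (tw_inv w).
Proof. by move=> Mw q nMq /=; rewrite -{1}(Mw q nMq) tfK. Qed.

Lemma supp_mul M v w : supp M v -> supp M w -> supp M (tw_mul v w).
Proof. by move=> Mv Mw q nMq /=; rewrite (Mw q nMq) Mv. Qed.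

Lemma supp_one M : supp M tw_one.
Proof. by []. Qed.

Lemma supp_in M w q : supp M w -> M q.1 -> M (tf w q).1.
Proof.
move=> Mw Mq; apply: contrapT => nM; apply: nM.
have := Mw (tf w q); have [//|nM /(_ nM)] := pselect (M (tf w q).1).
by move=> /(can_inj (tfK w)) ->.
Qed.

Lemma tw_of_piso (M : set (stone B)) g g' : M `<=` Rpt ->
  (forall y, Rpt y -> lc_at M y) -> piso M M g g' ->
  exists w, [/\ supp M w, forall q, M q.1 -> tf w q = g q
    & forall q, M q.1 -> tg w q = g' q].
Proof.
move=> MR Mlc gM.
pose G (h : Q -> Q) q := if `[< M q.1 >] then h q else q.
have GP : piso Rpt Rpt (G g) (G g').
  have := @piso_glue bool (fun y => `[< M y >]) (fun y => `[< M y >]) Rpt Rpt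
    (fun b : bool => if b then g else id) (fun b : bool => if b then g' else id).
  have GE h : G h = fun q => (if `[< M q.1 >] then h else id) q.
    by apply/funext => q; rewrite /G; case: ifP.
  rewrite !GE; apply.
  - by move=> y /Mlc; exact: (lc_comp asbool).
  - by move=> y /Mlc; exact: (lc_comp asbool).
  case.
    suff -> : [set y | Rpt y /\ `[< M y >] = true] = M by [].
    apply/seteqP; split=> [y [_ /asboolP]//|y My]; split; first exact: MR.
    exact/asboolP.
  exact: piso_id.
have out h q : ~ Rpt q.1 -> G h q = q.
  by move=> nR; rewrite /G; case: asboolP => // /MR.
exists (@Tw (G g) (G g') GP (out g) (out g')); split=> q /=.
- by rewrite /G; case: asboolP.
- by rewrite /G; case: asboolP.
- by rewrite /G; case: asboolP.
Qed.

(** * Cells converging to the exceptional set, and maps between clopen sets *)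

Section Cells.
Hypotheses (B_atomless : atomless B) (B_countable : countable [set: B]).
Variables (p0 : stone B) (Ep0 : p0 \in E).

Local Open Scope order_scope.

(** The cells are the differences of a decreasing sequence of neighbourhoods of [E]. An enumeration
    of [B] makes the sequence cofinal among these neighbourhoods, and removing a fresh point at each
    stage keeps the differences nonempty. *)
Lemma exists_cells : exists C : nat -> B,
  [/\ forall i, exists y, inb y (C i),
      forall i y, inb y (C i) -> Rpt y,
      forall i j y, inb y (C i) -> inb y (C j) -> i = j,
      forall y, Rpt y -> exists i, inb y (C i)
    & forall b, (forall p, p \in E -> inb p b) ->
        exists k, forall i y, (k <= i)%N -> inb y (C i) -> inb y b].
Proof.
have /countable_injP[f fI0] := B_countable.
have fI : injective f by move=> b c; apply: fI0; rewrite inE.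
pose EE b := forall p, p \in E -> inb p b.
have /choice[next nextP] : forall Dk : B * nat, exists D' : B, EE Dk.1 ->
    [/\ EE D', D' <= Dk.1, exists y, inb y Dk.1 /\ ~ inb y D'
      & forall c, f c = Dk.2 -> EE c -> D' <= c].
  move=> [D k] /=; have [ED|nED] := pselect (EE D); last by exists D => /nED.
  have D0 : D != \bot by apply/neq0_point; exists p0; exact: ED.
  have [r [rD rE]] := fresh_point B_atomless E D0.
  have [c [rc Ec]] := sep_point rE.
  have Enc : EE (~` c) by move=> p /Ec ?; exact/inbC.
  have [[b [fb Eb]]|nb] := pselect (exists b, f b = k /\ EE b).
    exists (D `&` ~` c `&` b) => _; split.
    - by move=> p pE; apply/inbI; split; [apply/inbI; split; [exact: ED|exact: Enc]|exact: Eb].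
    - by rewrite -meetA leIl.
    - by exists r; split=> // /inbI[/inbD[]].
    - by move=> c'; rewrite -fb => /fI -> _; exact: leIr.
  exists (D `&` ~` c) => _; split.
  - by move=> p pE; apply/inbI; split; [exact: ED|exact: Enc].
  - exact: leIl.
  - by exists r; split=> // /inbD[].
  - by move=> c' fc Ec'; case: nb; exists c'.
pose D := fix D k := if k is k'.+1 then next (D k', k') else W.
have ED k : EE (D k).
  by elim: k => [|k IH]; [exact: EW|have [] := nextP (D k, k) IH].
have Dle i j : (i <= j)%N -> D j <= D i.
  move=> /subnK <-; elim: (j - i)%N => [//|k IH]; rewrite addSn.
  by have [_ le1 _ _] := nextP (D (k + i)%N, (k + i)%N) (ED _); exact: le_trans le1 IH.
have Dsmall b : EE b -> forall i y, (f b < i)%N -> inb y (D i) -> inb y b.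
  move=> Eb i y fi yD; have [_ _ _ /(_ b erefl Eb)] := nextP (D (f b), f b) (ED _).
  by move=> /inb_le; apply; apply: inb_le yD; exact: (Dle (f b).+1).
exists (fun k => D k `&` ~` D k.+1); split.
- move=> i; have [_ _ [y [yD nyD]] _] := nextP (D i, i) (ED i).
  by exists y; exact/inbD.
- move=> i y /inbD[yD nyD]; split; first by apply: inb_le yD; exact: (Dle 0%N).
  by apply/negP => /(ED i.+1).
- have H i j y : inb y (D i `&` ~` D i.+1) -> inb y (D j `&` ~` D j.+1) -> (i <= j)%N.
    move=> /inbD[yi nyi] /inbD[yj nyj]; rewrite leqNgt; apply/negP => ji.
    by apply: nyj; apply: inb_le yi; exact: Dle.
  by move=> i j y yi yj; apply/eqP; rewrite eqn_leq (H _ _ _ yi yj) (H _ _ _ yj yi).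
- move=> y [yW yE]; have [c [yc Ec]] := sep_point yE.
  have Enc : EE (~` c) by move=> p /Ec ?; exact/inbC.
  have yn : ~ inb y (D (f (~` c)).+1).
    by move=> /(Dsmall _ Enc _ _ (ltnSn _))/inbC.
  apply: contrapT => N; apply: yn; elim: (f (~` c)).+1 => [//|k IH].
  by apply: contrapT => nD; apply: N; exists k; exact/inbD.
- move=> b Eb; exists (f b).+1 => i y fi /inbD[yD _]; exact: (Dsmall _ Eb i).
Qed.

Variable delta : stone B -> aut A.
Hypothesis delta_lc : forall y, lc_at delta y.
Hypothesis SS_delta : forall s, SS s -> exists c, forall y, inb y W -> s y = delta y c.

(** In the coordinates given by [delta] all sections are constant over [W], so any map of the base
    lifts to one that preserves them. *)
Let lift (phi : stone B -> stone B) q :=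
  (phi q.1, delta (phi q.1) (aut_inv (delta q.1) q.2)).

Let liftK phi psi : cancel phi psi -> cancel (lift phi) (lift psi).
Proof. by move=> phiK [y a]; rewrite /lift /= phiK (aut_mulK (delta _)) (aut_mulVK (delta _)). Qed.

Let lift_good phi psi y : homeo phi psi -> inb y W -> inb (phi y) W -> good (lift phi) y.
Proof.
move=> [_ _ phic _] yW pyW; split.
- by exists (phi y), (aut_mul (delta (phi y)) (aut_inv (delta y))).
- have dphi : lc_at (fun z => delta (phi z)) y.
    have [b [yb bE]] := delta_lc (phi y); have [c cE] := phic b.
    by exists c; split=> [|z /cE /bE //]; exact/cE.
  have := lc_comp (fun (r : aut A * aut A) a => r.1 (aut_inv r.2 a))
    (lc_pair dphi (delta_lc y)).
  exact.
- move=> b; have [c cE] := phic b; have := lc_inb c y.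
  move=> [c' [yc' c'E]]; exists c'; split=> // z /c'E zE; apply/funext => a /=.
  by rewrite propeqE !cE zE.
- by move=> s /SS_delta[c sE] /=; rewrite !sE // (aut_mulK (delta _)).
Qed.

(** The point [p0] lies outside both sets, so the complements are nonempty too and a homeomorphism
    of the whole space can carry [b] to [c]. *)
Lemma clopen_piso b c : (exists y, inb y b) -> (exists y, inb y c) ->
  (forall y, inb y b -> Rpt y) -> (forall y, inb y c -> Rpt y) ->
  exists g g', piso (stone_basic b) (stone_basic c) g g'.
Proof.
move=> /neq0_point b0 /neq0_point c0 bR cR.
have nE a : (forall y, inb y a -> Rpt y) -> ~` a != \bot.
  by move=> aR; apply/neq0_point; exists p0; apply/inbC => /aR[_]; rewrite Ep0.
have eq0 a a' : a != \bot -> a' != \bot -> a = \bot <-> a' = \bot.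
  by move=> /eqP ? /eqP ?; split.
have [//||phi [psi [phih bc _]]] := @exists_homeo _ B B_atomless B_countable
  [::] [:: (b, c)].
  by rewrite /= !meet1x; split; split=> //; apply: eq0 => //; exact: nE.
have {}bc y : inb y b <-> inb (phi y) c by apply: (bc (b, c)); rewrite inE.
have cb z : inb z c <-> inb (psi z) b by rewrite bc; have [_ -> _ _] := phih.
have [phiK psiK _ _] := phih.
exists (lift phi), (lift psi); split=> [q /bc qb|q /cb qc|y yb|z zc].
- by split=> //; exact: liftK.
- by split=> //; exact: liftK.
- by apply: lift_good phih _ _; [have [] := bR _ yb|have /bc/cR[] := yb].
- apply: (lift_good (homeo_sym phih)); first by have [] := cR _ zc.
  by have /cb/bR[] := zc.
Qed.

Lemma infinite_bij (I : countType) (J J' : set I) :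
  infinite_set J -> infinite_set J' -> exists s s' : I -> I,
  (forall i, J i -> J' (s i) /\ s' (s i) = i) /\
  (forall i, J' i -> J (s' i) /\ s (s' i) = i).
Proof.
have enum (K : set I) : infinite_set K -> exists (k : nat -> I) (r : I -> nat),
    [/\ forall m, K (k m), forall m, r (k m) = m & forall i, K i -> k (r i) = i].
  move=> Ki; have [k [kK kI ksurj]] : exists k : nat -> I,
      [/\ forall m, K (k m), injective k & forall u, K u -> exists m, k m = u].
    apply: card_eq_bijection; rewrite card_eq_sym; apply/eq_card_nat => //.
  have /choice[r rE] : forall i, exists m, K i -> k m = i.
    move=> i; have [/ksurj[m <-]|nK] := pselect (K i); first by exists m.
    by exists 0%N.
  by exists k, r; split=> // m; apply: kI; exact: rE.
move=> /enum[k [r [kJ rk kr]]] /enum[k' [r' [kJ' rk' kr']]].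
exists (k' \o r), (k \o r'); split=> i iJ /=; split=> //.
  by rewrite rk' kr.
by rewrite rk kr'.
Qed.

Lemma infinite_perm (I : countType) (J J' : set I) :
  infinite_set J -> infinite_set (~` J)%classic ->
  infinite_set J' -> infinite_set (~` J')%classic -> exists s s' : I -> I,
  [/\ cancel s s', cancel s' s & forall i, J i <-> J' (s i)].
Proof.
move=> Ji nJi Ji' nJi'; have [s [s' [sE s'E]]] := infinite_bij Ji Ji'.
have [t [t' [tE t'E]]] := infinite_bij nJi nJi'.
exists (fun i => if `[< J i >] then s i else t i),
  (fun i => if `[< J' i >] then s' i else t' i); split=> i.
- by case: (asboolP (J i)) => [/sE|/tE] [H ->]; case: asboolP.
- by case: (asboolP (J' i)) => [/s'E|/t'E] [H ->]; case: asboolP.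
- by case: (asboolP (J i)) => [Ji0|nJ]; [have [] := sE i Ji0|have [] := tE i nJ]; split.
Qed.

Section Index.
Variables (I : countType) (C : I -> B) (kap : stone B -> I).
Hypothesis C_ne : forall i, exists y, inb y (C i).
Hypothesis C_R : forall i y, inb y (C i) -> Rpt y.
Hypothesis C_kap : forall i y, inb y (C i) -> kap y = i.
Hypothesis kap_C : forall y, Rpt y -> inb y (C (kap y)).
Hypothesis C_lim : forall b, (forall p, p \in E -> inb p b) ->
  finite_set [set i | exists y, inb y (C i) /\ ~ inb y b].

Lemma kap_lc y : Rpt y -> lc_at kap y.
Proof. by move=> /kap_C yC; exists (C (kap y)); split=> // z /C_kap. Qed.

(** The relatively clopen subsets of [Rpt]. *)
Definition lcR (M : set (stone B)) := M `<=` Rpt /\ forall y, Rpt y -> lc_at M y.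

Lemma lcR_kap (J : set I) : lcR [set y | Rpt y /\ J (kap y)].
Proof.
split=> [y []//|y Ry].
apply: (@lc_eq _ _ _ (fun z => J (kap z)) _ y (C (kap y))); first exact: kap_C.
  by move=> z /C_R Rz; rewrite propeqE; split=> [|[]].
exact: (lc_comp J (kap_lc Ry)).
Qed.

Lemma lcR_lift (h : Prop -> Prop -> Prop) (M N : set (stone B)) y :
  lc_at M y -> lc_at N y -> lc_at (fun z => h (M z) (N z)) y.
Proof.
by move=> Mlc Nlc; exact: (lc_comp (fun r : Prop * Prop => h r.1 r.2) (lc_pair Mlc Nlc)).
Qed.

Lemma lcRU M N : lcR M -> lcR N -> lcR (M `|` N)%classic.
Proof.
move=> [MR Ml] [NR Nl]; split=> [y [/MR|/NR]//|y Ry].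
by apply: (@lcR_lift or); [exact: Ml|exact: Nl].
Qed.

Lemma lcRI M N : lcR M -> lcR N -> lcR (M `&` N)%classic.
Proof.
move=> [MR Ml] [NR Nl]; split=> [y [/MR]//|y Ry].
by apply: (@lcR_lift and); [exact: Ml|exact: Nl].
Qed.

Lemma lcRD M N : lcR M -> lcR N -> lcR (M `\` N)%classic.
Proof.
move=> [MR Ml] [NR Nl]; split=> [y [/MR]//|y Ry].
by apply: (@lcR_lift (fun P P' => P /\ ~ P')); [exact: Ml|exact: Nl].
Qed.

Lemma lcR_preim w M : lcR M -> lcR [set y | M (tg w (y, a0)).1].
Proof.
move=> [MR Ml]; split=> [y /MR|y Ry].
  by move=> /(@tf_R w (_, (tg w (y, a0)).2)); rewrite -surjective_pairing tgK.
have := good_through (tg_good w Ry.2) (Ml _ (@tg_R w (y, a0) Ry)).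
exact: (lc_comp (fun k : A -> Prop => k a0)).
Qed.

(* The noncompact clopen subsets of [Rpt] *)
Definition nc (M : set (stone B)) := infinite_set [set i | exists y, M y /\ inb y (C i)].

Lemma nc_sub M N : M `<=` N -> nc M -> nc N.
Proof.
move=> MN; apply: contra_not; apply: sub_finite_set => i [y [/MN]].
by exists y.
Qed.

Lemma ncU M N : nc (M `|` N)%classic -> nc M \/ nc N.
Proof.
move=> MN; apply: contrapT => /not_orP[/contrapT Mf /contrapT Nf]; apply: MN.
suff -> : [set i | exists y, (M `|` N)%classic y /\ inb y (C i)] =
    ([set i | exists y, M y /\ inb y (C i)] `|` [set i | exists y, N y /\ inb y (C i)])%classic.
  by rewrite finite_setU.
apply/seteqP; split=> i [].
- by move=> y [[My|Ny] yi]; [left|right]; exists y.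
- by move=> [y [My yi]]; exists y; split=> //; left.
- by move=> [y [My yi]]; exists y; split=> //; right.
Qed.

(** Noncompactness becomes accumulation at [E], a form that does not mention the cells and that
    twisted maps preserve by [tf_extend]. *)
Lemma ncP M : M `<=` Rpt ->
  nc M <-> forall b, (forall p, p \in E -> inb p b) -> exists y, M y /\ inb y b.
Proof.
move=> MR; split=> [Mnc b Eb|H Mf].
  apply: contrapT => N; apply: Mnc; apply: sub_finite_set (C_lim Eb).
  move=> i [y [My yi]]; exists y; split=> // yb; apply: N; by exists y.
have [s sE] : exists s : seq I, forall i, (exists y, M y /\ inb y (C i)) -> i \in s.
  have /finite_seqP[s sE] := Mf; exists s => i Mi.
  by have : [set` s] i by rewrite -sE.
have [|y [My /inbC nyb]] := H (~` \join_(i <- s) C i).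
  move=> p pE; apply/inbC; elim: s {sE} => [|i s IH]; first by rewrite big_nil; exact: inb0.
  by rewrite big_cons => /inbU[/C_R[_]|/IH//]; rewrite pE.
apply: nyb; have : kap y \in s by apply: sE; exists y; split=> //; exact/kap_C/MR.
elim: s {sE} => [//|i s IH]; rewrite big_cons inE => /orP[/eqP <-|/IH ?]; apply/inbU.
  by left; exact/kap_C/MR.
by right.
Qed.

Lemma nc_image w M : M `<=` Rpt -> nc M -> nc [set y | M (tg w (y, a0)).1].
Proof.
move=> MR /(ncP MR) Mb; apply/ncP.
  move=> y /MR /(@tf_R w (_, (tg w (y, a0)).2)); by rewrite -surjective_pairing tgK.
move=> b /(tf_extend w)[c [/Mb[y [My yc]] cb]].
exists (tf w (y, a0)).1; split; first by rewrite /= -tg_baseq tfK.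
by apply: cb => //; have [] := MR _ My.
Qed.

Lemma infinite_split (J : set I) : infinite_set J -> exists J' : set I,
  infinite_set (J `&` J')%classic /\ infinite_set (J `\` J')%classic.
Proof.
move=> Ji; have [k [kJ kI]] : exists k : nat -> I, (forall m, J (k m)) /\ injective k.
  have [k [? ? _]] : exists k : nat -> I,
      [/\ forall m, J (k m), injective k & forall u, J u -> exists m, k m = u].
    by apply: card_eq_bijection; rewrite card_eq_sym; exact/eq_card_nat.
  by exists k.
exists [set k m.*2 | m in [set: nat]]; split; apply/infiniteP.
  apply: (@card_le_of_inj _ _ _ _ (fun m => k m.*2)).
    by move=> m _; split=> //; exists m.
  by move=> m m' _ _ /kI /double_inj.
apply: (@card_le_of_inj _ _ _ _ (fun m => k m.*2.+1)).
  move=> m _; split=> // -[m' _ /kI] /(congr1 odd).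
  by rewrite /= !odd_double.
by move=> m m' _ _ /kI [/double_inj].
Qed.

Lemma nc_split M : lcR M -> nc M -> exists M1 M2,
  [/\ lcR M1, lcR M2, nc M1, nc M2 & M = (M1 `|` M2)%classic /\ forall y, M1 y -> ~ M2 y].
Proof.
move=> Ml /infinite_split[J [Ji Ji']].
exists (M `&` [set y | Rpt y /\ J (kap y)])%classic,
  (M `\` [set y | Rpt y /\ J (kap y)])%classic; split.
- by apply: lcRI => //; exact: lcR_kap.
- by apply: lcRD => //; exact: lcR_kap.
- apply: contra_not Ji; apply: sub_finite_set => i [[y [My yi]] Ji].
  by exists y; split=> //; split=> //; split; [exact: (C_R yi)|rewrite (C_kap yi)].
- apply: contra_not Ji'; apply: sub_finite_set => i [[y [My yi]] nJi].
  by exists y; split=> //; split=> // -[_]; rewrite (C_kap yi).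
- split; last by move=> y [_ H] [].
  by rewrite setUIDK.
Qed.

(** The cells met by [M] and those met by [N] are matched by a bijection, and their traces by
    [clopen_piso]. Gluing infinitely many pieces is possible since nothing is asked at [E]. *)
Lemma nc_piso M N : lcR M -> lcR N -> nc M -> nc N -> exists g g', piso M N g g'.
Proof.
move=> [MR Ml] [NR Nl] Mnc Nnc; have [s [s' [sE s'E]]] := infinite_bij Mnc Nnc.
have clopen_cell K i : lcR K -> exists b, forall y, inb y b <-> K y /\ inb y (C i).
  move=> [KR Kl]; apply: lc_set_clopen => y.
  have [yi|nyi] := pselect (inb y (C i)).
    by apply: (@lcR_lift and); [apply: Kl; exact: C_R yi|exact: lc_inb].
  exists (~` C i); split; first exact/inbC.
  by move=> z /inbC nzi; rewrite propeqE; split=> -[].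
have /choice[gg ggE] : forall i, exists gg : (Q -> Q) * (Q -> Q),
    piso [set y | M y /\ kap y = i] [set y | N y /\ s' (kap y) = i] gg.1 gg.2.
  move=> i.
  have cellE K j b : lcR K -> (forall y, inb y b <-> K y /\ inb y (C j)) ->
      [set y | K y /\ kap y = j] = stone_basic b.
    move=> [KR _] bE; apply/seteqP; split=> [y [Ky yj]|y].
      by apply/bE; split=> //; rewrite -yj; exact/kap_C/KR.
    by move=> /bE[Ky /C_kap].
  have [Mi|nMi] := pselect (exists y, M y /\ inb y (C i)); last first.
    exists (id, id); split=> //= q.
    - by move=> [Mq qi]; case: nMi; exists q.1; split=> //; rewrite -qi; exact/kap_C/MR.
    - move=> [Nq qi]; case: nMi; rewrite -qi.
      by have [] := s'E (kap q.1); [exists q.1; split=> //; exact/kap_C/NR|].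
    - by move=> _; exact: good_id.
    - by move=> _; exact: good_id.
  have [[z [Nz zsi]] s'i] := sE i Mi.
  have [b bE] := @clopen_cell M i (conj MR Ml).
  have [c cE] := @clopen_cell N (s i) (conj NR Nl).
  have [||||g [g' gP]] := @clopen_piso b c.
  - by have [y [My yi]] := Mi; exists y; exact/bE.
  - by exists z; exact/cE.
  - by move=> y /bE[/MR].
  - by move=> y /cE[/NR].
  exists (g, g') => /=; rewrite (cellE _ _ _ _ bE) //.
  suff -> : [set y | N y /\ s' (kap y) = i] = [set y | N y /\ kap y = s i].
    by rewrite (cellE _ _ _ _ cE).
  apply/seteqP; split=> y [Ny yi]; split=> //; last by rewrite yi.
  have [] := s'E (kap y); last by rewrite yi => _ ->.
  by exists y; split=> //; exact/kap_C/NR.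
exists (fun q => (gg (kap q.1)).1 q), (fun q => (gg (s' (kap q.1))).2 q).
apply: (@piso_glue _ kap (fun y => s' (kap y)) M N (fun i => (gg i).1) (fun i => (gg i).2)).
- by move=> y /MR; exact: kap_lc.
- by move=> y /NR Ry; exact: (lc_comp s' (kap_lc Ry)).
- exact: ggE.
Qed.

(** All cells are identified with the single cell [C i0], which makes the action of index maps
    strictly multiplicative. *)
Lemma exists_permutations (i0 : I) : exists pt : (I -> I) -> Q -> Q,
  [/\ forall s q, Rpt q.1 -> Rpt (pt s q).1 /\ kap (pt s q).1 = s (kap q.1),
      forall s t q, Rpt q.1 -> pt s (pt t q) = pt (s \o t) q,
      forall s t q, s (kap q.1) = t (kap q.1) -> pt s q = pt t q,
      forall q, Rpt q.1 -> pt id q = q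
    & forall s s', cancel s s' -> cancel s' s -> exists w,
        forall q, Rpt q.1 -> tf w q = pt s q /\ tg w q = pt s' q].
Proof.
have /choice[h hP] : forall i, exists h : (Q -> Q) * (Q -> Q),
    piso (stone_basic (C i0)) (stone_basic (C i)) h.1 h.2.
  move=> i; have [||||g [g' gP]] := @clopen_piso (C i0) (C i).
  - exact: C_ne.
  - exact: C_ne.
  - exact: C_R.
  - exact: C_R.
  by exists (g, g').
pose pt s q := (h (s (kap q.1))).1 ((h (kap q.1)).2 q).
have hh i j : piso (stone_basic (C i)) (stone_basic (C j))
    ((h j).1 \o (h i).2) ((h i).1 \o (h j).2).
  exact: piso_comp (piso_sym (hP i)) (hP j).
have ptC s q : Rpt q.1 -> inb (pt s q).1 (C (s (kap q.1))).
  move=> /kap_C qC; have [/(_ q qC)[H _] _ _ _] := hh (kap q.1) (s (kap q.1)).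
  exact: H.
have kE i : [set y | Rpt y /\ kap y = i] = stone_basic (C i).
  apply/seteqP; split=> [y [/kap_C yC yi]|y yC].
    by rewrite -yi.
  split; first exact: C_R yC.
  exact: C_kap.
have ptM s t q : Rpt q.1 -> pt s (pt t q) = pt (s \o t) q.
  move=> Rq; rewrite /pt /=.
  have -> : kap ((h (t (kap q.1))).1 ((h (kap q.1)).2 q)).1 = t (kap q.1).
    exact: (C_kap (ptC t q Rq)).
  congr (_.1 _).
  have [_ /(_ q (kap_C Rq))[qC _] _ _] := hP (kap q.1).
  by have [/(_ _ qC)[_ ->]] := hP (t (kap q.1)).
have pt1 q : Rpt q.1 -> pt id q = q.
  move=> Rq; rewrite /pt.
  by have [_ /(_ q (kap_C Rq))[_ ->]] := hP (kap q.1).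
exists pt; split=> // [s q Rq|s t q st|s s' sK s'K]; last 1 first.
have ptP : piso Rpt Rpt (pt s) (pt s').
  have := @piso_glue _ kap (fun y => s' (kap y)) Rpt Rpt
    (fun i q => (h (s i)).1 ((h i).2 q)) (fun i q => (h i).1 ((h (s i)).2 q)).
  have -> : pt s' = (fun q => (h (s' (kap q.1))).1 ((h (s (s' (kap q.1)))).2 q)).
    by apply/funext => q; rewrite s'K.
  apply=> [y|y Ry|i]; [exact: kap_lc|exact: (lc_comp s' (kap_lc Ry))|].
  rewrite kE; have -> : [set y | Rpt y /\ s' (kap y) = i] = [set y | Rpt y /\ kap y = s i].
    by apply/seteqP; split=> y [Ry yi]; split=> //; [rewrite -yi s'K|rewrite yi sK].
  by rewrite kE; exact: hh.
have [|||w [_ wf wg]] := @tw_of_piso Rpt (pt s) (pt s').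
- by [].
- move=> y Ry; exists (C (kap y)); split; first exact: kap_C.
  by move=> z /C_R Rz; rewrite propeqE.
- exact: ptP.
  by exists w => q Rq; rewrite wf ?wg.
- by split; [exact: C_R (ptC s q Rq)|exact: C_kap (ptC s q Rq)].
- by rewrite /pt st.
Qed.

Lemma tw_glue (T : Type) (pi : I -> T) (u : T -> tw) :
  (forall t, supp [set y | Rpt y /\ pi (kap y) = t] (u t)) ->
  exists v, forall q, Rpt q.1 ->
    tf v q = tf (u (pi (kap q.1))) q /\ tg v q = tg (u (pi (kap q.1))) q.
Proof.
move=> us; have [|||v [_ vf vg]] := @tw_of_piso Rpt
    (fun q => tf (u (pi (kap q.1))) q) (fun q => tg (u (pi (kap q.1))) q).
- by [].
- move=> y Ry; exists (C (kap y)); split; first exact: kap_C.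
  by move=> z /C_R Rz; rewrite propeqE.
- apply: (@piso_glue _ (fun y => pi (kap y)) (fun y => pi (kap y)) _ _
      (fun t => tf (u t)) (fun t => tg (u t))).
  + by move=> y /kap_lc; exact: (lc_comp pi).
  + by move=> y /kap_lc; exact: (lc_comp pi).
  + move=> t; split.
    * by move=> q /(supp_in (us t)) ?; split=> //; exact: tfK.
    * by move=> q /(supp_in (supp_inv (us t))) ?; split=> //; exact: tgK.
    * by move=> y [[_ yE] _]; exact: tf_good.
    * by move=> y [[_ yE] _]; exact: tg_good.
by exists v => q Rq; rewrite vf ?vg.
Qed.

(** The two complements in [M] are noncompact, so [nc_piso] supplies the rest of the map. *)
Lemma extend_piso (M M1 N1 : set (stone B)) g g' : lcR M -> lcR M1 -> lcR N1 ->
  M1 `<=` M -> N1 `<=` M -> nc (M `\` M1)%classic -> nc (M `\` N1)%classic ->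
  piso M1 N1 g g' -> exists w, supp M w /\ forall q, M1 q.1 -> tf w q = g q.
Proof.
move=> Ml M1l N1l M1M N1M MM1 MN1 gP.
have [h [h' hP]] := nc_piso (lcRD Ml M1l) (lcRD Ml N1l) MM1 MN1.
pose k (b : bool) := if b then g else h; pose k' (b : bool) := if b then g' else h'.
have [|||w [Mw wf _]] := @tw_of_piso M (fun q => k `[< M1 q.1 >] q)
    (fun q => k' `[< N1 q.1 >] q).
- by case: Ml.
- by case: Ml.
- apply: (@piso_glue _ (fun y => `[< M1 y >]) (fun y => `[< N1 y >]) _ _ k k').
  + by move=> y /Ml.1 Ry; exact: (lc_comp asbool (M1l.2 y Ry)).
  + by move=> y /Ml.1 Ry; exact: (lc_comp asbool (N1l.2 y Ry)).
  + have eT (S : set (stone B)) : S `<=` M -> [set y | M y /\ `[< S y >] = true] = S.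
      move=> SM; apply/seteqP; split=> [y [_ /asboolP]//|y Sy].
      by split; [exact: SM|exact/asboolP].
    have eF (S : set (stone B)) : [set y | M y /\ `[< S y >] = false] = (M `\` S)%classic.
      by apply/seteqP; split=> y [My Sy]; split=> //; [apply/asboolPn; rewrite Sy|exact: asboolF].
    by case; rewrite ?eT ?eF.
exists w; split=> // q M1q; rewrite wf; last exact: M1M.
by rewrite (asboolT M1q).
Qed.

Definition img w (M : set (stone B)) := [set y | M (tg w (y, a0)).1].

Lemma img_tf w M q : img w M (tf w q).1 <-> M q.1.
Proof. by rewrite /img /= -tg_baseq tfK. Qed.

Lemma img_sub M N w : supp M w -> N `<=` M -> img w N `<=` M.
Proof.
move=> Mw NM y /NM Mty; apply: contrapT => nMy.
by have := supp_in (supp_inv Mw); have := supp_inv Mw (q := (y, a0)) nMy => /= yE;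
  rewrite yE in Mty.
Qed.

(** * Factoring a map of a union of two overlapping sets *)

Section Generation.
Variables U V : set (stone B).
Hypotheses (Ul : lcR U) (Vl : lcR V) (UV : nc (U `&` V)%classic).
Local Notation P := (U `\` V)%classic.

Let Pl : lcR P. Proof. exact: lcRD. Qed.

(** Let [X] be the image of [P]. A map [a] on [V] brings the part of [X] in [V] into [U], so that
    [a w] sends [P] into [U]; extend this restriction to a map [b] on [U]. Then [c], the composite
    of [b] inverse with [a w], is the identity outside [V]. *)
Let factor_aux w : supp (U `|` V)%classic w -> nc (V `\` img w P)%classic ->
  exists (a b c : tw), [/\ supp V a, supp U b, supp V c &
    forall q, tf w q = tf a (tf b (tf c q))].
Proof.
move=> sw; set X := img w P => Vnc.
have Xl : lcR X by exact: lcR_preim.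
have [Q1 [Q2 [Q1l Q2l Q1nc Q2nc [QE Q12]]]] := nc_split (lcRI Ul Vl) UV.
have [M1 [M2 [M1l M2l M1nc M2nc [ME M12]]]] := nc_split (lcRD Vl Xl) Vnc.
have M1sub y : M1 y -> V y /\ ~ X y.
  by move=> My; have : (V `\` X)%classic y by rewrite ME; left.
have M2sub y : M2 y -> V y /\ ~ X y.
  by move=> My; have : (V `\` X)%classic y by rewrite ME; right.
have Q1sub y : Q1 y -> U y /\ V y.
  by move=> Qy; have : (U `&` V)%classic y by rewrite QE; left.
have Q2sub y : Q2 y -> U y /\ V y.
  by move=> Qy; have : (U `&` V)%classic y by rewrite QE; right.
(* The part of [X] in [V] may be compact, so it is padded with [M1] to become isomorphic to [Q1];
   [M2] and [Q2] are kept back to leave noncompact complements. *)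
pose D := (V `&` X `|` M1)%classic.
have Dl : lcR D by apply: lcRU => //; exact: lcRI.
have Dnc : nc D by apply: nc_sub M1nc; right.
have [g [g' gP]] := nc_piso Dl Q1l Dnc Q1nc.
have [|||||a [Va aE]] := @extend_piso V D Q1 g g' Vl Dl Q1l.
- by move=> y [[]|/M1sub[]].
- by move=> y /Q1sub[].
- apply: nc_sub M2nc => y My; have [Vy nXy] := M2sub y My; split=> //.
  by move=> [[]//|/M12].
- apply: nc_sub Q2nc => y Qy; split; first by have [] := Q2sub y Qy.
  by move=> /Q12.
- exact: gP.
have aX q : V q.1 -> X q.1 -> Q1 (tf a q).1.
  move=> Vq Xq; have Dq : D q.1 by left.
  by rewrite aE //; have [/(_ q Dq)[]] := gP.
pose w1 := tw_mul a w; pose Y := img w1 P.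
have YU : Y `<=` U.
  move=> y Yy; pose q := tg w1 (y, a0); have qy : tf w1 q = (y, a0) by exact: tgK.
  have Xq : X (tf w q).1 by apply/img_tf.
  have -> : y = (tf a (tf w q)).1 by rewrite -[tf a _]/(tf w1 q) qy.
  have [Vwq|nVwq] := pselect (V (tf w q).1); first by have [] := Q1sub _ (aX _ Vwq Xq).
  rewrite Va //; have [_ nV] : P q.1 by [].
  have : (U `|` V)%classic (tf w q).1 by apply: supp_in => //; left; have [] : P q.1 by [].
  by case.
have YQ2 y : Y y -> ~ Q2 y.
  move=> Yy; pose q := tg w1 (y, a0); have qy : tf w1 q = (y, a0) by exact: tgK.
  have Xq : X (tf w q).1 by apply/img_tf.
  have -> : y = (tf a (tf w q)).1 by rewrite -[tf a _]/(tf w1 q) qy.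
  have [Vwq|nVwq] := pselect (V (tf w q).1); first exact: Q12 (aX _ Vwq Xq).
  by rewrite Va // => /Q2sub[].
have Yl : lcR Y by exact: lcR_preim.
have [|||||b [Ub bE]] := @extend_piso U P Y (tf w1) (tg w1) Ul Pl Yl.
- by move=> y [].
- exact: YU.
- by apply: nc_sub UV => y [Uy Vy]; split=> // -[].
- by apply: nc_sub Q2nc => y Qy; split; [have [] := Q2sub y Qy|move=> /YQ2].
- apply: (piso_restrict (tw_piso w1)) => [y|y /Yl.1//].
  rewrite /Y img_tf; split=> [Py|[]//]; split=> //; exact: Pl.1.
exists (tw_inv a), b, (tw_mul (tw_inv b) w1); split=> //.
- exact: supp_inv.
- move=> q nVq /=; have [Uq|nUq] := pselect (U q.1).
    by rewrite -[tf a _]/(tf w1 q) -bE ?tfK.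
  have nUVq : ~ (U `|` V)%classic q.1 by case.
  by rewrite (sw q nUVq) (Va q nVq); exact: (supp_inv Ub).
- by move=> q /=; rewrite tgK tfK.
Qed.

(** If [factor_aux] does not apply, then [U] minus the image of [P] is noncompact, because the image
    of [V] is. A map [b0] on [U] carries part of it into the intersection of [U] and [V], and
    [factor_aux] applies to [b0 w]. *)
Lemma generation w : supp (U `|` V)%classic w -> exists (b0 a b c : tw),
  [/\ supp U b0, supp V a, supp U b, supp V c &
    forall q, tf w q = tf b0 (tf a (tf b (tf c q)))].
Proof.
move=> sw; have [Vnc|Vfin] := pselect (nc (V `\` img w P)%classic).
  have [a [b [c [Va Ub Vc wE]]]] := factor_aux sw Vnc.
  by exists tw_one, a, b, c; split.
set X := img w P; have Xl : lcR X by exact: lcR_preim.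
have Unc : nc (U `\` X)%classic.
  have : nc (img w V) by apply: nc_image; [exact: Vl.1|apply: nc_sub UV => y []].
  have sub : img w V `<=` ((U `\` X) `|` (V `\` X))%classic.
    move=> y Vy; have nXy : ~ X y by move=> [].
    by have [|Uy|Vy'] := img_sub sw _ Vy; [by right|left|right].
  by move=> /(nc_sub sub)/ncU[].
have [Q1 [Q2 [Q1l Q2l Q1nc Q2nc [QE Q12]]]] := nc_split (lcRI Ul Vl) UV.
have [M1 [M2 [M1l M2l M1nc M2nc [ME M12]]]] := nc_split (lcRD Ul Xl) Unc.
have M1sub y : M1 y -> U y /\ ~ X y.
  by move=> My; have : (U `\` X)%classic y by rewrite ME; left.
have M2sub y : M2 y -> U y /\ ~ X y.
  by move=> My; have : (U `\` X)%classic y by rewrite ME; right.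
have Q1sub y : Q1 y -> U y /\ V y.
  by move=> Qy; have : (U `&` V)%classic y by rewrite QE; left.
have Q2sub y : Q2 y -> U y /\ V y.
  by move=> Qy; have : (U `&` V)%classic y by rewrite QE; right.
have [g [g' gP]] := nc_piso M1l Q1l M1nc Q1nc.
have [|||||b0 [Ub0 b0E]] := @extend_piso U M1 Q1 g g' Ul M1l Q1l.
- by move=> y /M1sub[].
- by move=> y /Q1sub[].
- apply: nc_sub M2nc => y My; split; first by have [] := M2sub y My.
  by move=> /M12.
- apply: nc_sub Q2nc => y Qy; split; first by have [] := Q2sub y Qy.
  by move=> /Q12.
- exact: gP.
have [||a [b [c [Va Ub Vc wE]]]] := @factor_aux (tw_mul b0 w).
- by apply: supp_mul => //; apply: supp_sub Ub0; left.
- apply: nc_sub Q1nc => y Qy; split; first by have [] := Q1sub y Qy.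
  have [_ /(_ (y, a0) Qy)[M1y gy] _ _] := gP.
  have tgy : tg b0 (y, a0) = g' (y, a0) by rewrite -{1}gy -b0E ?tfK.
  rewrite /img /= tg_baseq -/(img w P (tg b0 (y, a0)).1) tgy => Xy.
  by have [] := M1sub _ M1y.
exists (tw_inv b0), a, b, c; split=> //; first exact: supp_inv.
by move=> q; rewrite -wE /= tfK.
Qed.

End Generation.

End Index.

Local Open Scope group_scope.

(* The cells are indexed by a piece, a column of the piece, an integer along which
   the columns are shifted, and a position *)
Definition idx : countType := (nat * nat * int * nat)%type.

Lemma idx_nat : exists f : idx -> nat, injective f /\ forall m, exists i, f i = m.
Proof.
have [|f [_ fI fs]] := @card_eq_bijection idx nat setT.
  apply: eq_card_nat => //; apply/infiniteP.
  apply: (@card_le_of_inj _ _ _ _ (fun m => (0%N, 0%N, 0%R, m) : idx)) => //.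
  by move=> m m' _ _ [].
by exists f; split=> // m; apply: fs.
Qed.

Lemma infinite_col (J : set idx) (t : nat * nat * int) :
  (forall m, J (t, m)) -> infinite_set J.
Proof.
move=> tJ; apply/infiniteP; apply: (@card_le_of_inj _ _ _ _ (fun m => (t, m) : idx)) => //.
by move=> m m' _ _ [].
Qed.

(* The branches of the binary tree are an almost disjoint family *)
Definition node (S : nat -> bool) m : idx := (0%N, 0%N, 0%R, pickle (mkseq S m)).

Definition branch S : set idx := node S @` [set: nat].

Lemma branch_infinite S : infinite_set (branch S).
Proof.
apply/infiniteP; apply: (@card_le_of_inj _ _ _ _ (node S)).
  by move=> m _; exists m.
move=> m m' _ _ [] /(pcan_inj pickleK) /(congr1 size).
by rewrite !size_mkseq.
Qed.

Lemma branch_out S i : branch S i -> i.1.1.1 = 0%N.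
Proof. by move=> [m _ <-]. Qed.

Lemma branch_finite S S' m : S m <> S' m -> finite_set (branch S `&` branch S')%classic.
Proof.
move=> SS'm; apply: (@sub_finite_set _ _ (node S @` `I_m.+1)).
  move=> i [[k _ <-] [k' _ [] /(pcan_inj pickleK) kE]]; exists k => //=.
  have kk' : k' = k by have /(congr1 size) := kE; rewrite !size_mkseq.
  rewrite ltnS leqNgt; apply/negP => mk; apply: SS'm.
  have := congr1 (fun s => nth false s m) kE; rewrite kk' !nth_mkseq //.
exact/finite_image/finite_II.
Qed.

(** * The swindle: maps supported close to the exceptional set are small *)

Section Bounded.
Variable bnd : set (set (aut F)).
Hypothesis bndP : ample_bornology bnd.

Definition bnd_supp M := bnd [set act w | w in supp M].

(** One use of [bnd_piece] and one of [bnd_pair] make the maps supported on [U] small; a second use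
    of [bnd_pair] gives a small conjugate [V]. By [generation] the maps on the union are small, and
    the union misses only finitely many cells. *)
Lemma small_support : exists b, (forall p, p \in E -> inb p b) /\
  bnd_supp [set y | inb y b].
Proof.
have [C0 [C0_ne C0_R C0_I C0_cover C0_lim]] := exists_cells.
have [enc [encI encS]] := idx_nat.
pose C i := C0 (enc i).
have C_ne i : exists y, inb y (C i) by exact: C0_ne.
have C_R i y : inb y (C i) -> Rpt y by exact: C0_R.
have /choice[kap kap_C] : forall y, exists i, Rpt y -> inb y (C i).
  move=> y; have [/C0_cover[m ym]|nR] := pselect (Rpt y).
    by have [i iE] := encS m; exists i; rewrite /C iE.
  by exists (0%N, 0%N, 0%R, 0%N).
have C_kap i y : inb y (C i) -> kap y = i.
  by move=> yC; apply: encI; exact: C0_I (kap_C _ (C_R i y yC)) yC.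
have C_lim b : (forall p, p \in E -> inb p b) ->
    finite_set [set i | exists y, inb y (C i) /\ ~ inb y b].
  move=> /C0_lim[m mP]; apply: card_le_finite _ (finite_II m).
  apply: (@card_le_of_inj _ _ _ _ enc) => [i [y [yC nyb]] /=|i j _ _ /encI//].
  by rewrite ltnNge; apply/negP => mi; apply: nyb; exact: mP yC.
pose K y := (kap y).1.1.1.
pose Rk k := [set y | Rpt y /\ K y = k].
have [pt [ptR ptM ptE pt1 ptW]] := exists_permutations C_ne C_R C_kap kap_C (0%N, 0%N, 0%R, 0%N).
have glue T pi u := @tw_glue _ C kap C_R C_kap kap_C T pi u.
(* Factor [j] consists of the maps supported on piece [j]. The quotient of two products is known on
   piece [k] but uncontrolled on the others, so [w] agrees with [c] only over [Rk k]. *)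
have [k [Z [bZ ZP]]] : exists k Z, bnd Z /\ forall c, supp (Rk k) c -> exists w,
    Z (act w) /\ forall q, Rk k q.1 -> tf w q = tf c q.
  pose Pi (u : nat -> tw) : aut F :=
    if pselect (exists v, forall q, Rpt q.1 -> tf v q = tf (u (K q.1)) q) is left h
    then act (projT1 (cid h)) else 1.
  have PiE u : (forall j, supp (Rk j) (u j)) -> exists v, Pi u = act v /\
      forall q, Rpt q.1 -> tf v q = tf (u (K q.1)) q.
    move=> us; rewrite /Pi; case: pselect => [h|[]].
      by exists (projT1 (cid h)); split=> //; exact: projT2 (cid h).
    have [v vE] := glue nat (fun i : idx => i.1.1.1) u us.
    by exists v => q /vE[].
  have [k [Z [bZ ZP]]] := bnd_piece bndP (one := tw_one) (C := fun j => supp (Rk j))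
    Pi (fun j => @supp_one _).
  exists k, Z; split=> // c /ZP[u [v [us vs uk vk]]].
  have [gu [-> guE]] := PiE u us; have [gv [-> gvE]] := PiE v vs.
  rewrite -act_inv -act_mul => Zw; exists (tw_mul (tw_inv gu) gv); split=> //.
  move=> q [Rq Kq] /=; rewrite gvE // Kq vk.
  have vq : Rk k (tf c q).1 by rewrite -vk; apply: supp_in; [exact: vs|].
  by rewrite -{1}[tf c q](_ : tf gu (tf c q) = _) ?tfK // guE ?vq.2 ?uk //; exact: vq.1.
have ZPn w c q : supp (Rk k) c -> (forall q, Rk k q.1 -> tf w q = tf c q) ->
    ~ Rk k q.1 -> ~ Rk k (tf w q).1.
  move=> cs wc nq wq; have q'k : Rk k (tg c (tf w q)).1 by apply: (supp_in (supp_inv cs)).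
  by apply: nq; have := wc _ q'k; rewrite tgK => /(can_inj (tfK w)) <-.
(* One shift for every set [S] of columns of piece [k]: a family of continuum size for
   [bnd_pair]. *)
pose sg (S : nat -> bool) (c : int) (i : idx) : idx :=
  if (i.1.1.1 == k) && S i.1.1.2 then (i.1.1, (i.1.2 + c)%R, i.2) else i.
have sgD S c c' i : sg S c (sg S c' i) = sg S (c + c')%R i.
  rewrite /sg; case: (boolP ((i.1.1.1 == k) && S i.1.1.2)) => [H|/negbTE H] /=; rewrite H //=.
  by rewrite -GRing.addrA [(c' + c)%R]GRing.addrC.
have sg0 S i : sg S 0%R i = i.
  by rewrite /sg; case: ifP => // _; rewrite GRing.addr0; case: i => -[].
have sg1 S c i : (sg S c i).1.1 = i.1.1 by rewrite /sg; case: ifP.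
have sgW S c : exists w, forall q, Rpt q.1 ->
    tf w q = pt (sg S c) q /\ tg w q = pt (sg S (- c)%R) q.
  by apply: ptW => i; rewrite sgD ?GRing.addNr ?GRing.subrr sg0.
have /choice[tS tSE] := fun S => sgW S 1%R.
(* [t0] is small and acts on the column [(k, m)] as the shift by one *)
have [S [S' [m [Sm S'm bt]]]] := bnd_pair bndP (fun S => act (tS S)).
pose t0 := tw_mul (tw_inv (tS S)) (tS S').
rewrite -act_inv -act_mul -/t0 in bt.
pose tau i := sg S (- 1)%R (sg S' 1%R i); pose tau' i := sg S' (- 1)%R (sg S 1%R i).
have t0f q : Rpt q.1 -> tf t0 q = pt tau q.
  move=> Rq /=; rewrite (tSE S' q Rq).1 (tSE S _ _).2 ?ptM //.
  by have [] := ptR (sg S' 1%R) q Rq.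
have t0g q : Rpt q.1 -> tg t0 q = pt tau' q.
  move=> Rq /=; rewrite (tSE S q Rq).1 (tSE S' _ _).2 ?ptM //.
  by have [] := ptR (sg S 1%R) q Rq.
pose sh := sg (fun l => l == m).
have tauE i : i.1.1 = (k, m) -> tau i = sh 1%R i.
  by case: i => -[[l l'] z] j [-> ->]; rewrite /tau /sh /sg /= S'm /= !eqxx Sm.
have tau'E i : i.1.1 = (k, m) -> tau' i = sh (- 1)%R i.
  by case: i => -[[l l'] z] j [-> ->]; rewrite /tau' /sh /sg /= Sm andbF /= !eqxx S'm.
have shE c i : i.1.1 = (k, m) -> sh c i = (i.1.1, (i.1.2 + c)%R, i.2).
  by case: i => -[[l l'] z] j [-> ->]; rewrite /sh /sg /= !eqxx.
have sh_id c i : i.1.1 <> (k, m) -> sh c i = i.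
  case: i => -[[l l'] z] j /= H; rewrite /sh /sg /=; case: ifP => // /andP[/eqP lk /eqP lm].
  by case: H; rewrite lk lm.
have /choice[Pc PcE] := fun c => sgW (fun l => l == m) c.
pose U := [set y | Rpt y /\ (kap y).1 = (k, m, 0%R)].
(* Swindle: [v] carries a copy of [u] over each nonnegative shift of [U], so that
   [u] is the commutator of [v] and [t0] *)
have bU : bnd_supp U.
  apply: (bnd_sub bndP _ (bnd_mul bndP bZ (bnd_mul bndP bt
    (bnd_mul bndP (bnd_inv bndP bZ) (bnd_inv bndP bt))))) => _ [u uU <-].
  have kpt s q : Rpt q.1 -> kap (pt s q).1 = s (kap q.1) by move=> /(ptR s)[].
  have Rpt_pt s q : Rpt q.1 -> Rpt (pt s q).1 by move=> /(ptR s)[].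
  pose ut (t : nat * nat * int) := if (t.1 == (k, m)) && (0 <= t.2)%R
    then tw_mul (Pc t.2) (tw_mul u (Pc (- t.2)%R)) else tw_one.
  have uts t : supp [set y | Rpt y /\ (kap y).1 = t] (ut t).
    move=> q nq; rewrite /ut; case: ifP => // /andP[/eqP tkm _] /=.
    have [Rq|nRq] := pselect (Rpt q.1); last by rewrite !tf_out.
    have Rq' : Rpt (tf (Pc (- t.2)%R) q).1 by exact: tf_R.
    have uid : tf u (tf (Pc (- t.2)%R) q) = tf (Pc (- t.2)%R) q.
      apply: uU => -[_]; rewrite (PcE _ _ Rq).1 -/sh kpt // => E'.
      have [col|ncol] := pselect ((kap q.1).1.1 = (k, m)); last first.
        by move: E'; rewrite sh_id // => E'; apply: ncol; rewrite E'.
      move: E'; rewrite shE //= col => -[E']; apply: nq; split=> //.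
      rewrite [(kap q.1).1]surjective_pairing col -tkm [RHS]surjective_pairing.
      by congr (_, _); apply/eqP; rewrite -GRing.subr_eq0 E'.
    rewrite uid (PcE _ _ Rq).1 (PcE _ _ (Rpt_pt _ _ Rq)).1 ptM //.
    rewrite -[RHS]pt1 //; apply: ptE => /=.
    by rewrite sgD GRing.subrr sg0.
  have [v vE] := glue _ (fun i : idx => i.1) ut uts.
  have vs : supp (Rk k) v.
    move=> q nq; have [Rq|nRq] := pselect (Rpt q.1); last by rewrite tf_out.
    rewrite (vE q Rq).1 /ut; case: ifP => // /andP[/eqP col _].
    by case: nq; split=> //; rewrite /K col.
  have [w [Zw wv]] := ZP v vs.
  exists (act w) => //; exists (act t0 * ((act w)^-1 * (act t0)^-1)).
    exists (act t0) => //; exists ((act w)^-1 * (act t0)^-1) => //.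
    exists (act w)^-1; first by exists (act w).
    by exists (act t0)^-1 => //; exists (act t0).
  rewrite -!act_inv -!act_mul; apply: act_ext => q Rq /=.
  have t0s : supp (Rk k) t0.
    move=> q' nq'; have [Rq'|nRq'] := pselect (Rpt q'.1); last by rewrite tf_out.
    rewrite t0f // -[RHS]pt1 //; apply: ptE.
    have /negbTE nk : K q'.1 != k by apply/eqP => Kq'; apply: nq'; split.
    by rewrite /tau /sg -/(K q'.1) nk /= nk.
  have wg q' : Rk k q'.1 -> tg w q' = tg v q'.
    move=> kq'; have := wv _ (supp_in (supp_inv vs) kq'); rewrite /= tgK => wE.
    by rewrite -{1}wE tfK.
  (* Outside piece [k] the map [t0] is the identity, so the commutator cancels whatever [w] does
     there. *)
  have [kq|nkq] := pselect (Rk k q.1); last first.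
    have nwq : ~ Rk k (tg w q).1.
      move=> H; apply: nkq; have := wv _ H; rewrite tgK => ->.
      exact: (supp_in vs H).
    have -> : tg (tS S') (tf (tS S) q) = q by exact: (supp_inv t0s nkq).
    rewrite [tg (tS S) _](t0s _ nwq) tgK uU // => -[Rq' Eq]; apply: nkq; split=> //.
    by rewrite /K Eq.
  pose r := tg t0 q; have kr : Rk k r.1 by exact: (supp_in (supp_inv t0s)).
  have kvr : Rk k (tg v r).1 by exact: (supp_in (supp_inv vs)).
  rewrite -[tg (tS S') _]/r (wg r kr) -[tg (tS S) _]/(tf t0 (tg v r)).
  rewrite wv; last exact: (supp_in t0s).
  have rE : r = pt tau' q by exact: t0g.
  have Rr : Rpt r.1 by case: kr.
  have kapr : kap r.1 = tau' (kap q.1) by rewrite rE kpt.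
  have t0r : tf t0 r = q by exact: tgK.
  have [col|ncol] := pselect ((kap q.1).1.1 = (k, m)); last first.
    have utE c : ut ((kap q.1).1.1, c) = tw_one.
      by rewrite /ut; case: eqP ncol.
    have rcol : (kap r.1).1.1 = (kap q.1).1.1 by rewrite kapr /tau' !sg1.
    rewrite (vE r Rr).2 [(kap r.1).1]surjective_pairing rcol utE -[tg tw_one r]/r t0r.
    rewrite (vE q Rq).1 [(kap q.1).1]surjective_pairing utE /=.
    by rewrite uU // => -[_ Eq]; apply: ncol; rewrite Eq.
  set z := (kap q.1).1.2.
  have qz : (kap q.1).1 = (k, m, z) by rewrite [LHS]surjective_pairing col.
  have rz : (kap r.1).1 = (k, m, (z - 1)%R).
    by rewrite kapr tau'E // shE //= col.
  have utE c : ut (k, m, c) = if (0 <= c)%R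
      then tw_mul (Pc c) (tw_mul u (Pc (- c)%R)) else tw_one.
    by rewrite /ut /= eqxx.
  have rsh : r = pt (sh (- 1)%R) q by rewrite rE; apply: ptE; exact: tau'E.
  (* For [z >= 1] the copy of [u] in [v] cancels against the shifted inverse copy; at [z = 0] only
     [u] itself is left; for [z < 0] both are trivial. *)
  rewrite (vE r Rr).2 rz utE; case: ifP => z1.
    rewrite /= (PcE _ r Rr).2 rsh ptM //.
    have -> : pt (sg (eq_op^~ m) (- (z - 1))%R \o sh (- 1)%R) q = pt (sh (- z)%R) q.
      by apply: ptE => /=; rewrite sgD GRing.opprB GRing.addrAC GRing.subrr GRing.add0r.
    set a := pt (sh (- z)%R) q.
    have Ra : Rpt a.1 by exact: Rpt_pt.
    have Ua : U a.1.
      by split=> //; rewrite /a kpt // shE // col -/z GRing.subrr.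
    have Ub : U (tg u a).1 by exact: (supp_in (supp_inv uU)).
    have Rb : Rpt (tg u a).1 by case: Ub.
    have kb : (kap (tg u a).1).1 = (k, m, 0%R) by case: Ub.
    have colb : (kap (tg u a).1).1.1 = (k, m) by rewrite kb.
    rewrite (PcE _ _ Rb).2 GRing.opprK.
    set b := pt _ (tg u a).
    have Rbb : Rpt b.1 by exact: Rpt_pt.
    have kbE : kap b.1 = sh (z - 1)%R (kap (tg u a).1) by exact: kpt.
    have -> : tg (tS S) (tf (tS S') b) = pt (sh z) (tg u a).
      rewrite -[LHS]/(tf t0 b) t0f // ptM //; apply: ptE => /=.
      by rewrite tauE ?sg1 // /sh sgD GRing.addrCA GRing.subrr GRing.addr0.
    have Rc : Rpt (pt (sh z) (tg u a)).1 by exact: Rpt_pt.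
    have kc : (kap (pt (sh z) (tg u a)).1).1 = (k, m, z).
      by rewrite kpt // shE // kb /= GRing.add0r.
    have z0 : (0 <= z)%R by lia.
    rewrite (vE _ Rc).1 kc utE z0 /= (PcE _ _ Rc).1 ptM //.
    have -> : pt (sg (eq_op^~ m) (- z)%R \o sh z) (tg u a) = tg u a.
      by rewrite -[RHS]pt1 //; apply: ptE => /=; rewrite sgD GRing.addNr sg0.
    rewrite tgK (PcE _ _ Ra).1 /a ptM //.
    rewrite uU; last by move=> [_]; rewrite qz => -[]; lia.
    by rewrite -[RHS]pt1 //; apply: ptE => /=; rewrite sgD GRing.subrr sg0.
  rewrite -[tg tw_one r]/r t0r (vE q Rq).1 qz utE.
  case: ifP => z0 /=; last first.
    by rewrite uU // => -[_]; rewrite qz => -[]; lia.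
  have -> : z = 0%R by lia.
  rewrite GRing.oppr0 (PcE _ q Rq).1.
  have -> : pt (sg (eq_op^~ m) 0%R) q = q.
    by rewrite -[RHS]pt1 //; apply: ptE; rewrite sg0.
  have Ruq : Rpt (tf u q).1 by exact: tf_R.
  rewrite (PcE _ _ Ruq).1 -[RHS]pt1 //; apply: ptE; by rewrite sg0.
pose D := [set i : idx | i.1 = (k, m, 0%R)].
have Di : infinite_set D by apply: (@infinite_col _ (k, m, 0%R)).
have nDi : infinite_set (~` D)%classic.
  by apply: (@infinite_col _ (k, m, 1%R)) => j; rewrite /D /= => -[].
have brC T : infinite_set (~` branch T)%classic.
  by apply: (@infinite_col _ (1%N, 0%N, 0%R)) => j /branch_out.
(* [rs T] carries the complement of [D] onto the branch of [T], so that different [T] give almost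
   disjoint images of this complement. *)
have /choice[rs rsP] : forall T, exists rs : (idx -> idx) * (idx -> idx),
    [/\ cancel rs.1 rs.2, cancel rs.2 rs.1 & forall i, ~ D i <-> branch T (rs.1 i)].
  move=> T; have nnD : infinite_set (~` ~` D)%classic by rewrite setCK.
  have [r [r' [rK r'K rE]]] := infinite_perm nDi nnD (@branch_infinite T) (brC T).
  by exists (r, r').
have /choice[pS pSE] : forall T, exists w,
    forall q, Rpt q.1 -> tf w q = pt (rs T).1 q /\ tg w q = pt (rs T).2 q.
  by move=> T; have [rK r'K _] := rsP T; exact: ptW.
(* [h0] is small and maps [U] to a set [V] whose union with [U] is cofinite but
   whose intersection with [U] is not compact *)
have [S1 [S2 [m' [S1m S2m bh]]]] := bnd_pair bndP (fun T => act (pS T)).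
pose h0 := tw_mul (tw_inv (pS S1)) (pS S2).
rewrite -act_inv -act_mul -/h0 in bh.
have [r1K r1'K r1D] := rsP S1; have [r2K r2'K r2D] := rsP S2.
pose rho i := (rs S1).2 ((rs S2).1 i); pose rho' i := (rs S2).2 ((rs S1).1 i).
have rhoK : cancel rho rho' by move=> i; rewrite /rho /rho' r1'K r2K.
have h0f q : Rpt q.1 -> tf h0 q = pt rho q.
  move=> Rq /=; rewrite (pSE S2 q Rq).1 (pSE S1 _ _).2 ?ptM //.
  by have [] := ptR (rs S2).1 q Rq.
pose V := [set y | Rpt y /\ D (rho' (kap y))].
have bV : bnd_supp V.
  apply: (bnd_sub bndP _ (bnd_mul bndP bh (bnd_mul bndP bU (bnd_inv bndP bh)))).
  move=> _ [u uV <-]; pose u' := tw_mul (tw_inv h0) (tw_mul u h0).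
  exists (act h0) => //; exists (act u' * (act h0)^-1).
    exists (act u'); last by exists (act h0)^-1 => //; exists (act h0).
    exists u' => // q nUq; rewrite /u' -[LHS]/(tg h0 (tf u (tf h0 q))).
    rewrite uV ?tfK // => -[Rhq]; apply: contra_not nUq => Dh.
    have Rq : Rpt q.1 by have := tg_R h0 Rhq; rewrite tfK.
    split=> //; move: Dh; rewrite h0f //; have [_ ->] := ptR rho q Rq.
    by rewrite rhoK.
  rewrite -act_inv -!act_mul; apply: act_ext => q Rq.
  by rewrite -[LHS]/(tf h0 (tg h0 (tf u (tf h0 (tg h0 q))))) !tgK.
have Ul : lcR U by exact: (lcR_kap C_R C_kap kap_C D).
have Vl : lcR V by exact: (lcR_kap C_R C_kap kap_C (fun i => D (rho' i))).
have UVnc : nc C (U `&` V)%classic.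
  (* The cells of column [(1, 0, 0)] lie on no branch, so their preimages under [rs S1] belong to
     both [U] and [V]. *)
  apply/infiniteP; apply: (@card_le_of_inj _ _ _ _
    (fun j => (rs S1).2 (1%N, 0%N, 0%R, j))); last first.
    by move=> j j' _ _ /(can_inj r1'K) [].
  move=> j _; set i := (rs S1).2 _; have [y yi] := C_ne i.
  have Rnode T : ~ branch T (1%N, 0%N, 0%R, j) by move=> /branch_out.
  exists y; split=> //; split; split; [exact: C_R yi| |exact: C_R yi|]; rewrite (C_kap _ _ yi).
    by apply: contrapT => /r1D; rewrite /i r1'K; exact: Rnode.
  by apply: contrapT => /r2D; rewrite /rho' /i r1'K r2'K; exact: Rnode.
have bUV : bnd_supp (U `|` V)%classic.
  apply: (bnd_sub bndP _ (bnd_mul bndP bU (bnd_mul bndP bV (bnd_mul bndP bU bV)))).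
  move=> _ [u uUV <-].
  have [b0 [a [b [c [Ub0 Va Ub Vc uE]]]]] :=
    generation C_R C_kap kap_C C_lim Ul Vl UVnc uUV.
  exists (act b0); first by exists b0.
  exists (act a * (act b * act c)).
    exists (act a); first by exists a.
    exists (act b * act c) => //; exists (act b); first by exists b.
    by exists (act c) => //; exists c.
  by rewrite -!act_mul; apply: act_ext => q _; rewrite uE.
(* [rs S1] injects the cells missed by both [U] and [V] into the intersection of two different
   branches. *)
have fin : finite_set [set i | ~ D i /\ ~ D (rho' i)].
  have S12 : S1 m' <> S2 m' by rewrite S1m S2m.
  apply: card_le_finite _ (branch_finite S12).
  apply: (@card_le_of_inj _ _ _ _ (rs S1).1); last by move=> i j _ _ /(can_inj r1K).
  by move=> i [/r1D ? /r2D]; rewrite /rho' r2'K.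
have /finite_seqP[s sE] := fin.
exists (W `&` ~` \join_(i <- s) C i)%O; split.
  move=> p pE; apply/inbD; split; first exact: EW.
  elim: s {sE} => [|i s IH]; first by rewrite big_nil; exact: inb0.
  by rewrite big_cons => /inbU[/C_R[_]|/IH//]; rewrite pE.
apply: (bnd_sub bndP _ bUV) => _ [w ws <-]; exists w => // q nq.
have [Rq|nRq] := pselect (Rpt q.1); last by rewrite tf_out.
apply: ws => /inbD[_]; apply.
have : kap q.1 \in s.
  have : [set` s] (kap q.1); last by [].
  rewrite -sE; split; apply: contra_not nq => ?; [left|right]; by split.
elim: s {sE} => [//|i s IH]; rewrite big_cons inE => /orP[/eqP <-|/IH ?]; apply/inbU.
  by left; exact/kap_C.
by right.
Qed.

End Bounded.

End Cells.

End Twisted.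
End FilteredPower.

(** * The permutation of the points induced by an automorphism *)

Section Automorphisms.
Variables (L : signature) (A : algebra L).
Context {d : Order.disp_t}.
Variable B : ctbDistrLatticeType d.
Variables (n : nat) (x : 'I_n -> stone B) (e : 'I_n -> A).
Hypotheses (x_distinct : injective x) (e_idempotent : forall i, idempotent_element (e i)).
Hypotheses (B_countable : countable [set: B]) (B_atomless : atomless B).
Local Notation F := (filtered_boolean_power x_distinct e_idempotent).
Local Notation Q := (stone B * A)%type.
Implicit Types (f : F) (g h : aut F) (y z p : stone B) (b c : B) (G : Q -> Q) (q : Q).

Definition regular y := forall i, x i <> y.

Lemma regular_sep y : regular y -> exists b, inb y b /\ forall i, ~ inb (x i) b.
Proof.
move=> ry; have [|b [yb bE]] := @sep_point _ B y [seq x i | i <- enum 'I_n].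
  by apply/negP => /mapP[i _ yi]; exact: (ry i).
by exists b; split=> // i; apply: bE; apply/mapP; exists i; rewrite ?mem_enum.
Qed.

Lemma mix_exists f f' b : exists f'',
  (forall y, inb y b -> ev f'' y = ev f y) /\ (forall y, ~ inb y b -> ev f'' y = ev f' y).
Proof.
have [||f'' fE] := @ev_exists L A _ B n x e x_distinct e_idempotent
  (fun y => if `[< inb y b >] then ev f y else ev f' y).
- move=> y; have H := lc_pair (lc_comp asbool (lc_inb b y)) (lc_pair (ev_lc f y) (ev_lc f' y)).
  exact: (lc_comp (fun r : bool * (A * A) => if r.1 then r.2.1 else r.2.2) H).
- by move=> i; case: ifP => _; exact: ev_x.
by exists f''; split=> y yb; rewrite fE; case: asboolP.
Qed.

Lemma patch_exists f b (a : A) : (forall i, ~ inb (x i) b) -> exists f',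
  (forall y, inb y b -> ev f' y = a) /\ (forall y, ~ inb y b -> ev f' y = ev f y).
Proof.
move=> xb; have [||f' fE] := @ev_exists L A _ B n x e x_distinct e_idempotent
  (fun y => if `[< inb y b >] then a else ev f y).
- move=> y; have H := lc_pair (lc_comp asbool (lc_inb b y)) (ev_lc f y).
  exact: (lc_comp (fun r : bool * A => if r.1 then a else r.2) H).
- by move=> i; case: asboolP => [/xb|_] //; exact: ev_x.
by exists f'; split=> y yb; rewrite fE; case: asboolP.
Qed.

Lemma value_exists y (a : A) : regular y -> exists f, ev f y = a.
Proof.
move=> /regular_sep[b [yb xb]]; have [f0] := algebra_nonempty F.
by have [f [fb _]] := patch_exists f0 a xb; exists f; exact: fb.
Qed.

Section PointAction.
Hypotheses (A_simple : simple_algebra A) (A_malcev : malcev A).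
Hypothesis A_nonabelian : ~ abelian_algebra A.

Lemma two_values : exists a a' : A, a <> a'. Proof. exact: A_simple.1. Qed.

Let agree b (f f' : F) := forall y, inb y b -> ev f y = ev f' y.

Let agree_congruence b : congruence (agree b).
Proof.
split=> //.
- by move=> f f' ff' y yb; rewrite ff'.
- by move=> f f' f'' H H' y yb; rewrite H ?H'.
- by move=> s u v uv y yb; rewrite !ev_op; congr (op A s _); apply/funext => i; exact: uv.
Qed.

(** For each [b], agreement on [b] or on its complement lies in the kernel of [pi], by
    [central_pair_abelian]. The elements [b] of the first kind form a proper filter, contained in a
    point [z]. This point is no [x i], as all elements agree there, and the induced map of [A] is
    injective by simplicity. *)
Lemma surjection_factors (pi : F -> A) : homomorphism pi ->
  (forall a, exists f, pi f = a) ->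
  exists z (alpha : aut A), regular z /\ forall f, pi f = alpha (ev f z).
Proof.
move=> pih pis; have [t tE] := A_malcev; have [a1 [a2 a12]] := two_values.
have eval_ev (v : 'I_3 -> F) y : ev (eval v t) y = eval (fun i => ev (v i) y) t.
  exact: (@homomorphism_eval L F A (fun f => ev f y) 3 v t (fun s a => erefl)).
have tnth_ev (f1 f2 f3 : F) y : (fun i => ev (tnth [tuple f1; f2; f3] i) y) =
    tnth [tuple ev f1 y; ev f2 y; ev f3 y].
  by apply/funext => -[[|[|[|//]]] i]; rewrite !(tnth_nth f1) (tnth_nth (ev f1 y)).
have dich b : (forall f f', agree b f f' -> pi f = pi f') \/
    (forall f f', agree (~` b)%O f f' -> pi f = pi f').
  apply: contrapT => /not_orP[N1 N2]; apply: A_nonabelian.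
  apply: (@central_pair_abelian L F A pi t pih pis A_simple _ _ _ _
    (agree b) (agree (~` b)%O)) => //.
  - by move=> f f'; apply: ev_inj => y; rewrite eval_ev tnth_ev (tE _ _).1.
  - by move=> f f'; apply: ev_inj => y; rewrite eval_ev tnth_ev (tE _ _).2.
  - by move=> a a'; rewrite (tE _ _).1.
  - by move=> a a'; rewrite (tE _ _).2.
  - move=> f f' H H'; apply: ev_inj => y; have [yb|nyb] := pselect (inb y b).
      exact: H.
    by apply: H'; exact/inbC.
  - apply: contrapT => N; apply: N1 => f f' ff'; apply: contrapT => pff'.
    by apply: N; exists f, f'.
  - apply: contrapT => N; apply: N2 => f f' ff'; apply: contrapT => pff'.
    by apply: N; exists f, f'.
pose fil : set B := [set b | forall f f', agree b f f' -> pi f = pi f'].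
have Ff : proper_filter fil.
  split; last first.
    move=> H; apply: a12; have [f1 <-] := pis a1; have [f2 <-] := pis a2.
    by apply: H => y /inb0.
  split.
  - by move=> f f' H; congr pi; apply: ev_inj => y; apply: H; exact: inbT.
  - move=> b c Hb Hc f f' ff'; have [f'' [f''b f''nb]] := mix_exists f f' b.
    rewrite -(Hb f'' f) //; apply: Hc => y yc.
    have [yb|nyb] := pselect (inb y b); last exact: f''nb.
    by rewrite f''b // ff' //; exact/inbI.
  - by move=> b c bc Hb f f' ff'; apply: Hb => y /(inb_le bc)/ff'.
have [z zF] := filter_in_point Ff.
have zfil b : inb z b -> fil b.
  move=> zb; case: (dich b) => // H.
  by have /inbC : inb z (~` b)%O by exact: zF.
have pi_z f f' : ev f z = ev f' z -> pi f = pi f'.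
  move=> ff'; have [b [zb bE]] := lc_pair (ev_lc f z) (ev_lc f' z).
  by apply: (zfil b) => // y /bE[-> ->].
have rz : regular z.
  move=> i xz; apply: a12; have [f1 <-] := pis a1; have [f2 <-] := pis a2.
  by apply: pi_z; rewrite -xz !ev_x.
have /choice[w wE] := fun a => value_exists a rz.
pose al a := pi (w a).
have alE f : pi f = al (ev f z) by apply: pi_z; rewrite wE.
have alh : homomorphism al.
  move=> s a; rewrite /al -pih; apply: pi_z; rewrite ev_op wE.
  by congr (op A s _); apply/funext => i /=; rewrite wE.
have alI : injective al.
  have cal : congruence (fun a a' => al a = al a').
    split=> // [a a' a'' -> //|s a a' aa']; rewrite !alh; congr (op A s _).
    by apply/funext => i /=.
  have [H a a' /H//|H] := A_simple.2 _ cal; case: a12.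
  have [f1 <-] := pis a1; have [f2 <-] := pis a2; rewrite !alE; exact: H.
have /choice[be beE] : forall a, exists a', al a' = a.
  by move=> a; have [f <-] := pis a; exists (ev f z); rewrite alE.
have bij : bijective al by exists be => [a|a //]; exact: alI.
by exists z, (Aut alh bij).
Qed.

Lemma point_action g y : regular y -> exists z (alpha : aut A),
  regular z /\ forall f, ev (g f) y = alpha (ev f z).
Proof.
move=> ry; apply: (@surjection_factors (fun f => ev (g f) y)).
  by move=> s a; rewrite aut_hom ev_op.
move=> a; have [f fy] := value_exists a ry.
by exists ((g^-1)%g f); rewrite aut_mulVK.
Qed.

(** At the points [x i] the graphs carry no information beyond [e i]; the identity is chosen
    there. *)
Definition graph_map g G := [/\
  forall f q, ev f q.1 = q.2 -> ev (g f) (G q).1 = (G q).2,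
  forall y, exists y' (alpha : aut A), forall a, G (y, a) = (y', alpha a),
  forall q, regular q.1 -> regular (G q).1 &
  forall q, ~ regular q.1 -> G q = q].

Lemma graph_map_exists g : exists G, graph_map g G.
Proof.
have /choice[psi psiE] : forall y, exists r : stone B * aut A,
    [/\ forall f, ev ((g^-1)%g f) y = r.2 (ev f r.1), regular y -> regular r.1
      & ~ regular y -> r = (y, aut_one A)].
  move=> y; have [ry|nry] := pselect (regular y).
    by have [z [al [rz E]]] := point_action (g^-1)%g ry; exists (z, al).
  exists (y, aut_one A); split=> // f; have /existsNP[i /contrapT <-] := nry.
  by rewrite !ev_x.
exists (fun q => ((psi q.1).1, ((psi q.1).2^-1)%g q.2)); split=> /=.
- move=> f [y a] /= <-; have [/(_ (g f)) + _ _] := psiE y.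
  by rewrite aut_mulK => ->; rewrite aut_mulK.
- by move=> y; exists (psi y).1, ((psi y).2^-1)%g.
- by move=> [y a] /= ry; have [_ + _] := psiE y; apply.
- move=> [y a] /= nry; have [_ _ ->] := psiE y => //=; congr (_, _).
  by apply: (can_inj (aut_mulK (aut_one A))); rewrite aut_mulVK.
Qed.

Lemma ev_separates y z (a a' : A) : regular y -> z <> y ->
  exists f f', [/\ ev f z = ev f' z, ev f y = a & ev f' y = a'].
Proof.
move=> ry zy; have [b [yb xb]] := regular_sep ry.
have [c [yc nzc]] := point_sep (nesym zy); have [f0] := algebra_nonempty F.
have xbc i : ~ inb (x i) (b `&` c)%O by move=> /inbI[/xb].
have nz : ~ inb z (b `&` c)%O by move=> /inbI[].
have ybc : inb y (b `&` c)%O by exact/inbI.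
have [f [fb fnb]] := patch_exists f0 a xbc; have [f' [fb' fnb']] := patch_exists f0 a' xbc.
by exists f, f'; split; [rewrite fnb ?fnb'|exact: fb|exact: fb'].
Qed.

(** If the composite moved [y] to another regular point, the value of every element there would be
    determined by its value at [y], against [ev_separates]. *)
Lemma graph_mapK g G G' : graph_map g G -> graph_map (g^-1)%g G' -> cancel G G'.
Proof.
move=> [GP Gf Gr Gn] [GP' Gf' Gr' Gn'] [y a].
have [ry|nry] := pselect (regular y); last by rewrite Gn ?Gn'.
have key f : ev f y = a -> ev f (G' (G (y, a))).1 = (G' (G (y, a))).2.
  by move=> fy; have := GP' _ _ (GP f (y, a) fy); rewrite aut_mulK.
have rz : regular (G' (G (y, a))).1 by apply: Gr'; exact: Gr.
have zy : (G' (G (y, a))).1 = y.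
  apply: contrapT => zy; have [a1 [a2 a12]] := two_values.
  have [f [f' [ff' fz fz']]] := ev_separates a1 a2 rz (nesym zy).
  have al_eq (h h' : F) : ev h y = ev h' y ->
      ev h (G' (G (y, a))).1 = ev h' (G' (G (y, a))).1.
    move=> hh'; pose a' := ev h y.
    have [y1 [al alE]] := Gf y; have [y2 [be beE]] := Gf' y1.
    have base a'' : (G' (G (y, a''))).1 = y2 by rewrite alE beE.
    have := GP' _ _ (GP h (y, a') erefl); have := GP' _ _ (GP h' (y, a') (esym hh')).
    by rewrite !aut_mulK !base => -> ->.
  by apply: a12; rewrite -fz -fz'; exact: al_eq.
have [f fy] := value_exists a ry; have := key f fy.
rewrite zy fy => aE; rewrite [LHS]surjective_pairing zy -aE //.
Qed.

Lemma graph_map_eq1 g : (forall f y, ev (g f) y = ev f y) -> g = 1%g.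
Proof. by move=> H; apply: aut_ext => f; apply: ev_inj => y; exact: H. Qed.

Hypothesis A_finite : finite_set [set: A].

(** Continuity of the base map comes from two elements that differ only inside a given clopen set.
    The fibre part is locally constant because [A] is finite and each of its values is taken by an
    element constant near [y]. *)
Lemma graph_map_good g G : graph_map g G -> forall y, regular y -> good set0 G y.
Proof.
move=> gG; have [GP Gf Gr Gn] := gG.
have [a1 [a2 a12]] := two_values; move=> y ry.
have [y1 [al alE]] := Gf y.
have ry1 : regular y1 by have := Gr (y, a1) ry; rewrite alE.
have evG f z a : ev f (G (z, a)).1 = ev f (G (z, ev ((g^-1)%g f) z)).1.
  by have [y' [be beE]] := Gf z; rewrite !beE.
have pull f z : ev f (G (z, a1)).1 = (G (z, ev ((g^-1)%g f) z)).2.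
  by rewrite evG -(GP ((g^-1)%g f)) //= aut_mulVK.
(* [k1] and [k2] differ exactly on a neighbourhood of [y1] inside [b]. Their preimages differ at
   [y], hence near [y], which forces the image points into [b]. *)
have cont b : inb y1 b -> exists c, inb y c /\ forall z a, inb z c -> inb (G (z, a)).1 b.
  move=> y1b; have [b' [y1b' xb']] := regular_sep ry1.
  have xbb i : ~ inb (x i) (b `&` b')%O by move=> /inbI[_ /xb'].
  have [f0] := algebra_nonempty F.
  have [k1 [k1b k1n]] := patch_exists f0 a1 xbb; have [k2 [k2b k2n]] := patch_exists f0 a2 xbb.
  have [c [yc cE]] := lc_pair (ev_lc ((g^-1)%g k1) y) (ev_lc ((g^-1)%g k2) y).
  exists c; split=> // z a /cE[E1 E2].
  have ne : ev ((g^-1)%g k1) y <> ev ((g^-1)%g k2) y.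
    move=> E; have := pull k1 y; have := pull k2 y; rewrite -E => <-.
    by rewrite alE /= k1b ?k2b //; exact/inbI.
  apply: contrapT => nb; apply: ne; rewrite -E1 -E2.
  have [z' [be beE]] := Gf z; have nb' : ~ inb z' (b `&` b')%O.
    by move=> /inbI[+ _]; move: nb; rewrite beE.
  apply: (can_inj (aut_mulK be)).
  have := pull k1 z; have := pull k2 z; rewrite !beE /= k1n // k2n // => <- //.
have contb b : lc_at (fun z a => inb (G (z, a)).1 b) y.
  have [y1b|ny1b] := pselect (inb y1 b).
    have [c [yc cE]] := cont _ y1b; exists c; split=> // z zc; apply/funext => a.
    by rewrite propeqE alE; split=> // _; exact: cE.
  have [|c [yc cE]] := cont (~` b)%O; first exact/inbC.
  exists c; split=> // z zc; apply/funext => a.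
  by rewrite propeqE alE; split=> // zb; have /inbC := cE z a zc.
split; [by exists y1, al| |exact: contb|by []].
have /finite_seqP[s sE] := A_finite.
have [c [yc cE]] : exists c, inb y c /\ forall z a, inb z c -> a \in s ->
    (G (z, a)).2 = (G (y, a)).2.
  elim: s {sE} => [|a s [c [yc cE]]]; first by exists \top%O; split=> //; exact: inbT.
  have [b [yb xb]] := regular_sep ry; have [f0] := algebra_nonempty F.
  have [f [fb _]] := patch_exists f0 a xb.
  have [b1 [y1b1 b1E]] := ev_lc (g f) y1; have [c1 [yc1 c1E]] := cont _ y1b1.
  exists (b `&` (c `&` c1))%O; split; first by apply/inbI; split=> //; exact/inbI.
  move=> z a' /inbI[zb /inbI[zc zc1]]; rewrite inE => /orP[/eqP ->|]; last exact: cE.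
  rewrite -(GP f (z, a) (fb z zb)) -(GP f (y, a) (fb y yb)) alE /=.
  by apply: b1E; exact: c1E.
exists c; split=> // z zc; apply/funext => a; apply: cE => //.
by have : [set: A] a by []; rewrite sE.
Qed.

Lemma homeo_lc phi psi (T : Type) (k : stone B -> T) y :
  homeo phi psi -> lc_at k (phi y) -> lc_at (fun z => k (phi z)) y.
Proof.
move=> [_ _ phic _] [b [yb bk]]; have [c cE] := phic b.
by exists c; split=> [|z /cE/bk //]; exact/cE.
Qed.

Lemma homeo_comp phi psi phi' psi' : homeo phi psi -> homeo phi' psi' ->
  @homeo _ B (phi' \o phi) (psi \o psi').
Proof.
move=> [K1 K2 C1 C2] [K1' K2' C1' C2']; split.
- exact: (can_comp K1' K1).
- exact: (can_comp K2 K2').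
- move=> b; have [c cE] := C1' b; have [c' c'E] := C1 c.
  by exists c' => y /=; rewrite cE c'E.
- move=> b; have [c cE] := C2 b; have [c' c'E] := C2' c.
  by exists c' => y /=; rewrite cE c'E.
Qed.

Lemma homeo_restrict b phi psi : homeo phi psi ->
  (forall y, inb y b <-> inb (phi y) b) -> exists phi' psi',
  [/\ homeo phi' psi', forall y, inb y b -> phi' y = phi y
    & forall y, ~ inb y b -> phi' y = y].
Proof.
move=> [K1 K2 C1 C2] bphi; have bpsi y : inb y b <-> inb (psi y) b by rewrite (bphi (psi y)) K2.
pose r (th : stone B -> stone B) y := if `[< inb y b >] then th y else y.
have rC th : (forall c, exists c', forall y, inb (th y) c <-> inb y c') ->
    forall c, exists c', forall y, inb (r th y) c <-> inb y c'.
  move=> thC c; have [c' c'E] := thC c.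
  exists ((b `&` c') `|` (c `&` ~` b))%O => y; rewrite inbU inbI inbD /r.
  by case: asboolP => yb; rewrite ?c'E; tauto.
have rK th th' : cancel th th' -> (forall y, inb y b <-> inb (th y) b) ->
    cancel (r th) (r th').
  move=> K bth y; rewrite /r; case: (asboolP (inb y b)) => yb /=; last by rewrite asboolF.
  by rewrite asboolT ?K //; apply/(bth y).
exists (r phi), (r psi); split=> [|y yb|y yb]; [|by rewrite /r asboolT|by rewrite /r asboolF].
by split; [exact: rK|exact: rK|exact: rC|exact: rC].
Qed.

Definition hom_act h (phi : stone B -> stone B) := forall f y, ev (h f) (phi y) = ev f y.

Lemma homeo_act phi psi : homeo phi psi -> (forall i, phi (x i) = x i) ->
  exists h, hom_act h phi.
Proof.
move=> hphi phix; have [K1 K2 _ _] := hphi.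
have comp th th' : homeo th th' -> (forall i, th (x i) = x i) ->
    forall f, exists f', ev f' = ev f \o th.
  move=> hth thx f; apply: ev_exists => [y|i /=]; last by rewrite thx ev_x.
  exact: (homeo_lc hth (ev_lc f (th y))).
have psix i : psi (x i) = x i by rewrite -{1}phix K1.
have /choice[h hE] := comp _ _ (homeo_sym hphi) psix.
have /choice[k kE] := comp _ _ hphi phix.
have hK : cancel h k by move=> f; apply: ev_inj => y; rewrite kE /= hE /= K1.
have kK : cancel k h by move=> f; apply: ev_inj => y; rewrite hE /= kE /= K2.
have hh : homomorphism h.
  move=> s a; apply: ev_inj => y; rewrite hE /= !ev_op; congr (op A s _).
  by apply/funext => i /=; rewrite hE.
by exists (Aut hh (Bijective hK kK)) => f y; rewrite /= hE /= K1.
Qed.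

Lemma hom_act_inv h phi psi : cancel psi phi -> hom_act h phi -> hom_act (h^-1)%g psi.
Proof. by move=> K H f y; have := H ((h^-1)%g f) (psi y); rewrite K aut_mulVK. Qed.

Lemma hom_act_mul h h' phi phi' :
  hom_act h phi -> hom_act h' phi' -> hom_act (h * h')%g (phi \o phi').
Proof. by move=> H H' f y; rewrite -(H' f y) -(H (h' f) (phi' y)). Qed.

Definition homeo_auts b : set (aut F) := [set h | exists phi psi,
  [/\ homeo phi psi, forall y, ~ inb y b -> phi y = y & hom_act h phi]].

Lemma homeo_supp phi psi b y : homeo phi psi -> (forall y, ~ inb y b -> phi y = y) ->
  inb y b <-> inb (phi y) b.
Proof.
move=> [K1 _ _ _] out; split=> [yb|pyb]; apply: contrapT => nb; last first.
  by have yE := out y nb; apply: nb; rewrite -yE.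
by have := out _ nb => /(can_inj K1) yE; rewrite yE in nb.
Qed.

Lemma homeo_moving b (pts : seq (stone B * stone B)) : (forall i, ~ inb (x i) b) ->
  (forall pq pq', pq \in pts -> pq' \in pts -> pq.1 = pq'.1 <-> pq.2 = pq'.2) ->
  (forall pq, pq \in pts -> inb pq.1 b /\ inb pq.2 b) ->
  exists h phi psi, [/\ homeo phi psi, forall y, ~ inb y b -> phi y = y, hom_act h phi
    & forall pq, pq \in pts -> phi pq.1 = pq.2].
Proof.
move=> xb ptsI ptsb.
have [|phi [psi [H bb phip]]] := exists_homeo B_atomless B_countable ptsI (l0 := [:: (b, b)]).
  rewrite /= !meet1x; split; split=> // pq /ptsb[p1 p2]; first by split.
  by rewrite !inbC; split.
have [|phi' [psi' [H' in' out']]] := @homeo_restrict b _ _ H.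
  by move=> y; apply: (bb (b, b)); rewrite inE.
have [i|h hE] := homeo_act H'; first by rewrite out'.
exists h, phi', psi'; split=> // pq pqp; rewrite in' ?phip //.
by have [] := ptsb _ pqp.
Qed.

(** A binary tree of nonzero elements. The points serve as targets that distinguish a family of
    automorphisms indexed by [nat -> bool]. *)
Lemma cantor_points b : b != \bot%O -> exists q : (nat -> bool) -> stone B,
  injective q /\ forall S, inb (q S) b.
Proof.
move=> b0.
have /choice[half halfP] : forall c, exists c', c != \bot%O ->
    [/\ (c' <= c)%O, c' != \bot%O & (c `&` ~` c')%O != \bot%O].
  move=> c; have [->|c0] := eqVneq c \bot%O; first by exists \bot%O.
  have [r1 [r1c _]] := fresh_point B_atomless [::] c0.
  have [r2 [r2c]] := fresh_point B_atomless [:: r1] c0.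
  rewrite inE => /eqP r12; have [a [ra nra]] := point_sep (nesym r12).
  exists (c `&` a)%O => _; split; first exact: leIl.
    by apply/neq0_point; exists r1; exact/inbI.
  by apply/neq0_point; exists r2; apply/inbD; split=> // /inbI[].
pose N (S : nat -> bool) := fix N k := if k is k'.+1 then
  (if S k' then half (N k') else (N k' `&` ~` half (N k'))%O) else b.
have N0 S k : N S k != \bot%O.
  by elim: k => //= k IH; have [_ H1 H2] := halfP _ IH; case: ifP.
have NS S k : (N S k.+1 <= N S k)%O.
  rewrite /=; have [le _ _] := halfP _ (N0 S k); case: ifP => _ //.
  exact: leIl.
have Nle S i j : (i <= j)%N -> (N S j <= N S i)%O.
  by move=> /subnK <-; elim: (j - i)%N => // k IH; exact: le_trans (NS S _) IH.
have /choice[q qE] : forall S, exists y, forall k, inb y (N S k).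
  move=> S; have [|y yF] := @filter_in_point _ B [set c | exists k, (N S k <= c)%O].
    split; last by move=> [k]; rewrite lex0 (negbTE (N0 S k)).
    split; first by exists 0%N; exact: lex1.
      move=> c c' [k kc] [k' kc']; exists (maxn k k'); rewrite lexI.
      have H1 := le_trans (Nle S _ _ (leq_maxl k k')) kc.
      by rewrite H1 (le_trans (Nle S _ _ (leq_maxr k k')) kc').
    by move=> c c' cc' [k kc]; exists k; exact: le_trans cc'.
  by exists y => k; apply: yF; exists k.
exists q; split=> [S S' qS|S]; last exact: (qE S 0%N).
have excl c y : ~ (inb y (half c) /\ inb y (c `&` ~` half c)%O).
  by move=> [yh /inbD[_]].
have H k : N S k = N S' k /\ S k = S' k.
  elim: k => [|k [IH Sk]]; last first.
    have NE : N S k.+1 = N S' k.+1 by rewrite /= IH Sk.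
    split=> //; have := qE S k.+2; have := qE S' k.+2; rewrite -qS /= -/(N S k.+1) -/(N S' k.+1) NE.
    by case: (S k.+1); case: (S' k.+1) => // h1 h2; case: (@excl (N S' k.+1) (q S)).
  split=> //; have := qE S 1%N; have := qE S' 1%N; rewrite -qS /=.
  by case: (S 0%N); case: (S' 0%N) => // h1 h2; case: (@excl b (q S)).
by apply/funext => k; have [] := H k.
Qed.

(** * Small groups of homeomorphisms near regular points *)

Section Bornology.
Local Open Scope group_scope.
Variable bnd : set (set (aut F)).
Hypothesis bndP : ample_bornology bnd.

(** Restates [small_support] for partial isomorphisms of [Rpt E b], so that its users need not
    handle twisted maps. *)
Lemma small_support_aut (E : seq (stone B)) (W : B) (SS : set (stone B -> A))
    (p0 : stone B) (delta : stone B -> aut A) :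
  (forall p, p \in E -> inb p W) -> (forall i, inb (x i) W -> x i \in E) ->
  (forall s y, SS s -> lc_at s y) ->
  (forall f, exists s b, [/\ SS s, forall p, p \in E -> inb p b &
    forall y, inb y b -> ev f y = s y]) ->
  p0 \in E -> (forall y, lc_at delta y) ->
  (forall s, SS s -> exists a, forall y, inb y W -> s y = delta y a) ->
  exists b Z, [/\ (b <= W)%O, forall p, p \in E -> inb p b, bnd Z &
    forall G G', piso SS (Rpt E b) (Rpt E b) G G' -> exists r, [/\ Z r,
      forall f q, Rpt E b q.1 -> ev f q.1 = q.2 -> ev (r f) (G q).1 = (G q).2 &
      forall f y, ~ Rpt E b y -> ev (r f) y = ev f y]].
Proof.
move=> EW xE SSlc SSF Ep0 dlc SSd; have [a0 _] := two_values.
have [b [Eb bb]] := small_support EW xE SSlc SSF a0 B_atomless B_countable Ep0 dlc SSd bndP.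
exists (b `&` W)%O, [set act xE SSlc SSF a0 w | w in supp [set y | inb y b]].
split=> //; [exact: leIr|by move=> p pE; apply/inbI; split; [exact: Eb|exact: EW]|].
move=> G G' GP; have [||w [ws wf wg]] := @tw_of_piso L A _ B E W SS _ G G' _ _ GP.
- by move=> y [/inbI[_ yW] yE].
- move=> y [yW yE]; have [c [yc Ec]] := sep_point yE.
  have [c' [yc' c'E]] := lc_inb b y.
  exists (W `&` (c `&` c'))%O; split; first by apply/inbI; split=> //; exact/inbI.
  move=> z /inbI[zW /inbI[zc zc']]; rewrite propeqE /Rpt !inbI (c'E z zc').
  have zE : z \notin E by apply/negP => /Ec.
  by split=> -[[]].
exists (act xE SSlc SSF a0 w); split.
- exists w => // q nq; apply: ws => -[/inbI[+ _] _]; exact: nq.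
- by move=> f q Rq fq; rewrite -wf //; exact: actE.
- move=> f y nRy; have := @actE L A _ B n x e x_distinct e_idempotent E W SS xE SSlc SSF
    a0 w f (y, ev f y) erefl.
  by rewrite ws.
Qed.

(* With [E = [:: p]] and constant sections, [small_support] covers the
   homeomorphisms that fix [p]; a small element that moves [p] gives the others *)
Lemma small_homeo_auts b0 p : regular p -> inb p b0 -> exists b,
  [/\ (b <= b0)%O, inb p b, forall i, ~ inb (x i) b & bnd (homeo_auts b)].
Proof.
move=> rp pb0; have [b1 [pb1 xb1]] := regular_sep rp.
pose W := (b0 `&` b1)%O; pose SS : set (stone B -> A) := [set s | exists a, s = fun=> a].
have pE : p \in [:: p] by rewrite inE.
have [|||||||b [Z [bW pb bZ ZP]]] := @small_support_aut [:: p] W SS p (fun=> aut_one A).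
- by move=> q; rewrite inE => /eqP ->; exact/inbI.
- by move=> i /inbI[_ /xb1].
- by move=> _ y [a ->]; exact: lc_cst.
- move=> f; have [b [pb bE]] := ev_lc f p; exists (fun=> ev f p), b; split=> //.
    by exists (ev f p).
  by move=> q; rewrite inE => /eqP ->.
- exact: pE.
- by move=> y; exact: lc_cst.
- by move=> _ [a ->]; exists a.
have {}pb : inb p b by exact: pb.
have xb i : ~ inb (x i) b by move=> /(inb_le bW)/inbI[_ /xb1].
have fixp h phi psi : homeo phi psi -> (forall y, ~ inb y b -> phi y = y) ->
    hom_act h phi -> phi p = p -> Z h.
  move=> H out ha php; have [K1 K2 C1 C2] := H.
  have supp := homeo_supp _ H out.
  have pso th th' : homeo th th' -> forall y, good SS (fun q => (th q.1, q.2)) y.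
    move=> [_ _ thC _] y; split.
    - by exists (th y), (aut_one A).
    - exact: (lc_cst (fun a : A => a)).
    - move=> c; have [c' c'E] := thC c; have [c'' [yc H'']] := lc_inb c' y.
      by exists c''; split=> // z /H'' zE; apply/funext => a /=; rewrite propeqE !c'E zE.
    - by move=> _ [a ->].
  have [|r [Zr rin rout]] := ZP (fun q => (phi q.1, q.2)) (fun q => (psi q.1, q.2)).
    split=> [[y a] [/= yb]|[y a] [/= yb]|y _|y _].
    - rewrite inE => /eqP yp; rewrite K1; split=> //; split; first by apply/(supp y).
      by rewrite inE; apply/eqP => E; apply: yp; apply: (can_inj K1); rewrite E php.
    - rewrite inE => /eqP yp; rewrite K2; split=> //; split.
        by apply/(supp (psi y)); rewrite K2.
      by rewrite inE; apply/eqP => E; apply: yp; rewrite -[y]K2 E php.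
    - exact: pso H y.
    - exact: pso (homeo_sym H) y.
  suff -> : h = r by [].
  apply: aut_ext => f; apply: ev_inj => z; rewrite -[z]K2 ha.
  have [Rz|nRz] := pselect (Rpt [:: p] b (psi z)).
    by rewrite (rin f (psi z, ev f (psi z))).
  have pz : phi (psi z) = psi z.
    have [zb|/out//] := pselect (inb (psi z) b).
    have [->//|np] := eqVneq (psi z) p.
    by case: nRz; split=> //; rewrite inE.
  by rewrite pz rout.
have b_0 : b != \bot%O by apply/neq0_point; exists p.
have [pt [ptI ptb]] := cantor_points b_0.
(* Automorphisms supported in [b] that send [p] to distinct points; by [bnd_pair] a quotient of two
   of them is small and moves [p]. *)
have /choice[g gP] : forall S, exists g, exists phi psi, [/\ homeo phi psi,
    forall y, ~ inb y b -> phi y = y, hom_act g phi & phi p = pt S].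
  move=> S; have [||h [phi [psi [H out ha hp]]]] := @homeo_moving b [:: (p, pt S)] xb.
  - by move=> pq pq'; rewrite !inE => /eqP -> /eqP ->.
  - by move=> pq; rewrite inE => /eqP -> /=; split.
  by exists h, phi, psi; split=> //; apply: (hp (p, pt S)); rewrite inE.
have [S [S' [m [Sm S'm bh]]]] := bnd_pair bndP g.
have [phi [psi [H out ha hp]]] := gP S; have [phi' [psi' [H' out' ha' hp']]] := gP S'.
set h := (g S)^-1 * g S' in bh.
have [K1 K2 _ _] := H; have [K1' K2' _ _] := H'.
have hth : hom_act h (psi \o phi') by apply: hom_act_mul => //; exact: hom_act_inv ha.
have Hth : homeo (psi \o phi') (psi' \o phi) by exact: homeo_comp (homeo_sym H).
have outth y : ~ inb y b -> (psi \o phi') y = y.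
  by move=> yb /=; rewrite out' // -{1}(out y yb) K1.
have thp : (psi \o phi') p <> p.
  rewrite /= hp' => E; have : pt S' = pt S by rewrite -hp -E K2.
  by move=> /ptI SS'; move: Sm; rewrite -SS' S'm.
exists b; split=> //; first exact: le_trans bW (leIl _ _).
apply: (bnd_sub bndP _ (bnd_union bndP bZ (bnd_mul bndP bZ (bnd_mul bndP bh bZ)))).
move=> k [ph [ps [Hk outk hk]]]; have [K1k K2k _ _] := Hk.
have [kp|kp] := eqVneq (ph p) p; first by left; exact: fixp Hk outk hk kp.
(* Let [r] be the image of [p] under [h]. Choose [c] fixing [p] and sending [r] to the image of [p]
   under [k]; then [k] is [c * h] times a factor that fixes [p]. *)
right; set r := (psi \o phi') p in thp.
have [||c [ch [ps' [Hc outc hc cE]]]] := @homeo_moving b [:: (p, p); (r, ph p)] xb.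
- move=> pq pq'; rewrite !inE => /orP[]/eqP -> /orP[]/eqP -> //=.
    by split=> E; [case: thp|case/eqP: kp].
  by split=> E; [case: thp|case/eqP: kp].
- move=> pq; rewrite !inE => /orP[]/eqP -> //=; split.
    exact: (iffLR (homeo_supp p Hth outth)).
  exact: (iffLR (homeo_supp p Hk outk)).
have cp : ch p = p by apply: (cE (p, p)); rewrite inE eqxx.
have cr : ch r = ph p by apply: (cE (r, ph p)); rewrite !inE eqxx orbT.
have [K1c K2c _ _] := Hc; have [K1h K2h _ _] := Hth.
exists c; first exact: fixp Hc outc hc cp.
exists (h * (h^-1 * (c^-1 * k))); last by rewrite !mulVKg.
exists h => //; exists (h^-1 * (c^-1 * k)) => //.
apply: (fixp _ ((psi' \o phi) \o (ps' \o ph)) ((ps \o ch) \o (psi \o phi'))).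
- by apply: homeo_comp (homeo_sym Hth); apply: homeo_comp (homeo_sym Hc).
- move=> y yb /=; rewrite outk // -{1}(outc y yb) K1c.
  by have := outth y yb => /= E; rewrite -[in LHS]E K2 K1'.
- apply: hom_act_mul; first exact: hom_act_inv K2h hth.
  by apply: hom_act_mul => //; exact: hom_act_inv K2c hc.
- by rewrite /= -cr K1c /r /= K2 K1'.
Qed.

(** * Pointwise stabilizers of finite sets *)

Section Decomposition.
Variable f0 : F.

(* Fixing finitely many elements lets one strip an automorphism of its action over
   [c] by a factor from a small set *)
Definition handled c := exists T Z, [/\ finite_set T,
  forall f, T f -> forall y, ~ inb y c -> ev f y = ev f0 y, bnd Z &
  forall g, (forall f, T f -> g f = f) -> g f0 = f0 -> exists h, [/\ Z h,
    forall f y, ~ inb y c -> ev (h f) y = ev f y,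
    forall f, (forall y, inb y c -> ev f y = ev f0 y) -> h f = f &
    forall f y, inb y c -> ev (h^-1 (g f)) y = ev f y]].

Lemma trivial_inv (h : aut F) (S : set (stone B)) :
  (forall f y, S y -> ev (h f) y = ev f y) -> forall f y, S y -> ev (h^-1 f) y = ev f y.
Proof. by move=> H f y Sy; rewrite -H // aut_mulVK. Qed.

Lemma handled0 : handled \bot%O.
Proof.
exists set0, [set 1]; split=> //; first exact: bnd_one.
by move=> g _ _; exists 1; split=> // f y /inb0.
Qed.

Lemma handled_join c c' : (forall y, inb y c -> ~ inb y c') ->
  handled c -> handled c' -> handled (c `|` c')%O.
Proof.
move=> cc' [T [Z [Tf TE bZ ZP]]] [T' [Z' [Tf' TE' bZ' ZP']]].
exists (T `|` T')%classic, (setmul Z Z'); split.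
- by rewrite finite_setU.
- move=> f Hf y; rewrite inbU => /not_orP[nc nc'].
  by case: Hf => [/TE|/TE']; apply.
- exact: bnd_mul.
move=> g gT gf0; have [h [Zh hout hfix hg]] := ZP g (fun f Tf => gT f (or_introl Tf)) gf0.
have hf0 : h f0 = f0 by apply: hfix.
have hVfix f : h f = f -> h^-1 f = f by move=> {1}<-; rewrite aut_mulK.
have [|| h' [Zh' hout' hfix' hg']] := ZP' (h^-1 * g).
- move=> f T'f; rewrite /= -[RHS](hVfix f).
    by rewrite -{2}(gT f (or_intror T'f)).
  by apply: hfix => y yc; apply: TE' => //; exact: cc'.
- by rewrite -[RHS](hVfix f0) // -{2}gf0.
exists (h * h'); split.
- by exists h => //; exists h'.
- move=> f y; rewrite inbU => /not_orP[nc nc'].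
  by rewrite -[LHS]/(ev (h (h' f)) y) hout // hout'.
- move=> f ff; rewrite -[LHS]/(h (h' f)) hfix' ?hfix // => y yc; apply: ff; apply/inbU;
  by [left|right].
- move=> f y; rewrite invgM -[((h'^-1 * h^-1) _)]/(h'^-1 (h^-1 (g f))).
  move=> /inbU[yc|yc']; last exact: hg'.
  rewrite (@trivial_inv h' (fun y => ~ inb y c')) ?hg //.
  exact: cc'.
Qed.

(** Fixing the elements [w a], constant on [c], forces [g] to preserve [c] and to act trivially on
    the fibres over it. Its base map on [c], extended by the identity, gives [h]; it fixes elements
    equal to [f0] on [c] because [f0] is constant there. *)
Lemma handled_regular b c (a : A) : bnd (homeo_auts b) -> (c <= b)%O ->
  (forall i, ~ inb (x i) c) -> (forall y, inb y b -> ev f0 y = a) -> handled c.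
Proof.
move=> bb cb xc f0b; have /choice[w wP] := fun a => patch_exists f0 a xc.
have [a1 [a2 a12]] := two_values.
have [wc wn] : (forall a y, inb y c -> ev (w a) y = a) /\
    (forall a y, ~ inb y c -> ev (w a) y = ev f0 y).
  by split=> a' y yc; have [H1 H2] := wP a'; [exact: H1|exact: H2].
exists (w @` [set: A]), (homeo_auts b); split=> //; first exact: finite_image.
  by move=> _ [a' _ <-] y; exact: wn.
move=> g gT gf0; have gw a' : g (w a') = w a' by apply: gT; exists a'.
have inv_w (k : aut F) K : graph_map k K -> (forall a, k (w a) = w a) ->
    forall y, inb y c -> exists y1, inb y1 c /\ forall a, K (y, a) = (y1, a).
  move=> [KP Kf Kr Kn] kw y yc; have [y1 [al alE]] := Kf y.
  have H a' : ev (w a') y1 = al a'.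
    by have := KP (w a') (y, a') (wc a' y yc); rewrite kw alE.
  have y1c : inb y1 c.
    apply: contrapT => nc; apply: a12; apply: (can_inj (aut_mulK al)).
    by rewrite -!H !wn.
  by exists y1; split=> // a'; rewrite alE -H wc.
have [G gG] := graph_map_exists g; have [G' gG'] := graph_map_exists (g^-1).
have GG' := graph_mapK gG gG'; have G'G : cancel G' G.
  by apply: (graph_mapK gG'); rewrite invgK.
have gVw a' : g^-1 (w a') = w a' by rewrite -{1}gw aut_mulK.
have Gc := inv_w g G gG gw; have Gc' := inv_w g^-1 G' gG' gVw.
pose ph (K : Q -> Q) y : stone B := if `[< inb y c >] then (K (y, a1)).1 else y.
have phK (K K' : Q -> Q) :
    (forall y, inb y c -> exists y1, inb y1 c /\ forall a, K (y, a) = (y1, a)) ->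
    cancel K K' -> cancel (ph K) (ph K').
  move=> Kc KK' y; rewrite /ph; case: (asboolP (inb y c)) => yc; last by rewrite asboolF.
  have [y1 [y1c E]] := Kc y yc; rewrite E asboolT //.
  by have := KK' (y, a1); rewrite E => ->.
have phC k K : graph_map k K ->
    (forall y, inb y c -> exists y1, inb y1 c /\ forall a, K (y, a) = (y1, a)) ->
    forall b, exists b', forall y, inb (ph K y) b <-> inb y b'.
  move=> kK Kc b'; have [|b'' b''E] := @lc_set_clopen _ B (fun y => inb (ph K y) b').
    move=> y; have [yc|nyc] := pselect (inb y c).
      have ry : regular y by move=> i xy; rewrite -xy in yc; exact: xc yc.
      have [_ _ /(_ b')[e' [ye' eE]] _] := graph_map_good kK ry.
      exists (e' `&` c)%O; split; first exact/inbI.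
      move=> z /inbI[ze zc]; rewrite /ph !asboolT //.
      exact: (congr1 (fun r => r a1) (eE z ze)).
    have [e' [ye' eE]] := lc_inb b' y.
    exists (e' `&` ~` c)%O; split; first exact/inbD.
    by move=> z /inbD[ze zc]; rewrite /ph !asboolF //; exact: eE.
  by exists b'' => y; rewrite b''E.
have Hph : homeo (ph G) (ph G').
  by split; [exact: phK|exact: phK|exact: phC gG Gc|exact: phC gG' Gc'].
have phx i : ph G (x i) = x i by rewrite /ph asboolF.
have phout y : ~ inb y c -> ph G y = y by move=> yc; rewrite /ph asboolF.
have phc y : inb y c -> inb (ph G y) c by move=> yc; apply: (iffLR (homeo_supp y Hph phout)).
have [h hE] := homeo_act Hph phx; exists h; split.
- exists (ph G), (ph G'); split=> // y nyb; by apply: phout => /(inb_le cb).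
- by move=> f y nyc; rewrite -{1}(phout y nyc) hE.
- move=> f ff0; apply: ev_inj => z; have [_ K2 _ _] := Hph; rewrite -[z]K2 hE.
  have [yc|yc] := pselect (inb (ph G' z) c); last by rewrite phout.
  by rewrite !ff0 ?f0b //; [exact: inb_le cb (phc _ yc)|exact: inb_le cb yc|exact: phc].
- move=> f y yc; rewrite -hE aut_mulVK; have [GP _ _ _] := gG.
  have := GP f (y, ev f y) erefl; rewrite /ph asboolT //.
  by have [y1 [_ E]] := Gc y yc; rewrite !E.
Qed.

Lemma handled_all c : (forall i, ~ inb (x i) c) -> handled c.
Proof.
(* The claim for all smaller [c'] lets overlapping neighbourhoods be made disjoint before
   [handled_join]. *)
move=> xc; suff H : forall c', (c' <= \top)%O -> (c' <= c)%O -> handled c'.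
  by apply: H => //; exact: lex1.
apply: (@compact_induction _ B (fun b => forall c', (c' <= b)%O -> (c' <= c)%O -> handled c')).
- by move=> c'; rewrite lex0 => /eqP -> _; exact: handled0.
- move=> b b' Hb Hb' c' c'bb' c'c.
  have -> : c' = ((c' `&` b) `|` (c' `&` ~` b))%O.
    apply: eq_points => y; rewrite inbU inbI inbD.
    by have [yb|yb] := pselect (inb y b); tauto.
  apply: handled_join => [y /inbI[_ yb] /inbD[]//||]; [apply: Hb|apply: Hb'].
  + exact: leIr.
  + exact: le_trans (leIl _ _) c'c.
  + by apply: le_points => y /inbD[/(inb_le c'bb')/inbU[]].
  + exact: le_trans (leIl _ _) c'c.
- move=> y; have [yc|nyc] := pselect (inb y c); last first.
    exists (~` c)%O; split; first exact/inbC.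
    move=> c' H1 H2; have -> : c' = \bot%O; last exact: handled0.
    apply: eq_points => z; split=> [zc'|/inb0//].
    by have /inbC nc := inb_le H1 zc'; case: nc; exact: inb_le H2 zc'.
  have ry : regular y by move=> i xy; rewrite -xy in yc; exact: xc yc.
  have [b0 [yb0 b0E]] := ev_lc f0 y.
  have [b [bb0 yb xb bb]] := small_homeo_auts ry yb0.
  exists b; split=> // c' c'b c'c; apply: (handled_regular (a := ev f0 y) bb c'b).
    by move=> i /(inb_le c'b)/xb.
  by move=> z /(inb_le bb0)/b0E.
Qed.

Definition same_orbit (i j : 'I_n) := exists al : aut A, al (e i) = e j.

Lemma same_orbit_refl i : same_orbit i i. Proof. by exists (aut_one A). Qed.

Lemma same_orbit_sym i j : same_orbit i j -> same_orbit j i.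
Proof. by move=> [al alE]; exists al^-1; rewrite -alE aut_mulK. Qed.

Lemma same_orbit_trans i j k : same_orbit i j -> same_orbit j k -> same_orbit i k.
Proof. by move=> [al alE] [be beE]; exists (be * al); rewrite -beE -alE. Qed.

(** A canonical member of each class, so that all indices of a class get literally the same
    block. *)
Definition rep (j : 'I_n) := odflt j [pick i | `[< same_orbit i j >]].

Lemma rep_orbit j : same_orbit (rep j) j.
Proof.
by rewrite /rep; case: pickP => [i /asboolP//|_]; exact: same_orbit_refl.
Qed.

Lemma rep_eq i j : same_orbit i j -> rep i = rep j.
Proof.
move=> ij; rewrite /rep.
have -> : [pick k | `[< same_orbit k i >]] = [pick k | `[< same_orbit k j >]].
  apply: eq_pick => k; apply: asbool_equiv_eq; split=> [ki|kj].
    exact: same_orbit_trans ki ij.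
  exact: same_orbit_trans kj (same_orbit_sym ij).
by case: pickP => // /(_ j) /asboolPn; case; exact: same_orbit_refl.
Qed.

(* The points [x i] with [e i] in one [aut A]-orbit form one exceptional set; there
   [f0] agrees with the single twisted section [fun y => delta y (e j)] *)
Lemma orbit_data (j : 'I_n) : exists (E : seq (stone B)) (delta : stone B -> aut A) (W : B),
  [/\ forall y, lc_at delta y, (forall i, x i \in E <-> same_orbit j i),
      forall p, p \in E -> exists i, p = x i,
      forall y, inb y W <-> ev f0 y = delta y (e j) &
      forall i, same_orbit j i -> delta (x i) (e j) = e i].
Proof.
have /choice[V VP] : forall i, exists b, inb (x i) b /\ forall k, k != i -> ~ inb (x k) b.
  move=> i; have [|b [xb bE]] := @sep_point _ B (x i) [seq x k | k <- enum 'I_n & k != i].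
    apply/negP => /mapP[k]; rewrite mem_filter => /andP[+ _] /x_distinct ik.
    by rewrite ik eqxx.
  exists b; split=> // k ki; apply: bE; apply/mapP; exists k => //.
  by rewrite mem_filter ki mem_enum.
have /choice[al alP] : forall i, exists al : aut A, same_orbit j i -> al (e j) = e i.
  move=> i; have [[al alE]|N] := pselect (same_orbit j i); first by exists al.
  by exists (aut_one A).
pose delta y := if [pick i | `[< inb y (V i) >]] is Some i then al i else aut_one A.
have dlc y : lc_at delta y.
  apply/lc_atP; have : \forall z \near y, forall i, inb z (V i) = inb y (V i).
    apply: (@filter_forall _ _ (fun i => [set z | inb z (V i) = inb y (V i)]) (nbhs y)).
    by move=> i; apply/(lc_atP (fun z => inb z (V i))); exact: lc_inb.
  apply: filterS => z zy; rewrite /delta.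
  by under eq_pick do rewrite zy.
have dx i : delta (x i) = al i.
  rewrite /delta; case: pickP => [k /asboolP xik|/(_ i)].
    have [->//|ik] := eqVneq k i; have [_ /(_ i)] := VP k.
    by rewrite eq_sym => /(_ ik).
  by move=> /asboolPn; have [] := VP i.
have [|W WE] := @lc_set_clopen _ B (fun y => ev f0 y = delta y (e j)).
  move=> y; exact: (lc_comp (fun r : A * aut A => r.1 = r.2 (e j)) (lc_pair (ev_lc f0 y) (dlc y))).
exists [seq x i | i <- enum 'I_n & `[< same_orbit j i >]], delta, W; split=> //.
- move=> i; split=> [/mapP[k]|ji].
    by rewrite mem_filter => /andP[/asboolP jk _] /x_distinct ->.
  by apply/mapP; exists i => //; rewrite mem_filter mem_enum andbT; apply/asboolP.
- by move=> p /mapP[i _ ->]; exists i.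
- by move=> i ji; rewrite dx alP.
Qed.

(** On [b] the element [f0] is the section to be preserved, so fixing [f0] makes the point map of
    [g] good there. If [g] and its inverse also keep the regular points of [b] in [b], this map is
    realized by a small [r]. *)
Lemma orbit_block (j : 'I_n) : exists b Z, [/\ bnd Z,
  forall i, same_orbit j i -> inb (x i) b,
  forall y, inb y b -> exists al : aut A, al (e j) = ev f0 y &
  forall g, g f0 = f0 ->
    (forall k K, (k = g \/ k = g^-1) -> graph_map k K ->
      forall q, regular q.1 -> inb q.1 b -> inb (K q).1 b) ->
    exists r, [/\ Z r, r f0 = f0, forall f y, ~ inb y b -> ev (r f) y = ev f y &
      forall f y, inb y b -> ev (r^-1 (g f)) y = ev f y]].
Proof.
have [E [delta [W [dlc EP Ex WE dE]]]] := orbit_data j.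
pose s y := delta y (e j); pose SS : set (stone B -> A) := [set s].
have s_lc y : lc_at s y by exact: (lc_comp (fun r : aut A => r (e j)) (dlc y)).
have EW p : p \in E -> inb p W.
  by move=> pE; have [i pi] := Ex p pE; rewrite pi in pE *; apply/WE;
    rewrite ev_x dE //; apply/EP.
have xE i : inb (x i) W -> x i \in E.
  by move=> /WE; rewrite ev_x => ei; apply/EP; exists (delta (x i)).
have [|||||||b [Z [bW Eb bZ ZP]]] := @small_support_aut E W SS (x j) delta.
- exact: EW.
- exact: xE.
- by move=> _ y ->.
- move=> f; have [|b bE] := @lc_set_clopen _ B (fun y => ev f y = s y).
    by move=> y; exact: (lc_comp (fun r : A * A => r.1 = r.2) (lc_pair (ev_lc f y) (s_lc y))).
  exists s, b; split=> [//|p pE|y /bE//]; have [i pi] := Ex p pE; rewrite pi in pE *.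
  by apply/bE; rewrite ev_x /s dE //; apply/EP.
- by apply/EP; exact: same_orbit_refl.
- exact: dlc.
- by move=> _ ->; exists (e j).
have Rreg y : Rpt E b y <-> inb y b /\ regular y.
  split=> [[yb yE]|[yb ry]]; split=> //.
    by move=> i xy; move/negP: yE; apply; rewrite -xy; apply: xE; rewrite xy; exact: inb_le bW yb.
  by apply/negP => /Ex[i yx]; exact: (ry i).
exists b, Z; split=> //.
- by move=> i ji; apply: Eb; apply/EP.
- by move=> y /(inb_le bW)/WE ->; exists (delta y).
move=> g gf0 gb.
have [G gG] := graph_map_exists g; have [G' gG'] := graph_map_exists g^-1.
have GG' := graph_mapK gG gG'; have G'G : cancel G' G.
  by apply: (graph_mapK gG'); rewrite invgK.
have gVf0 : g^-1 f0 = f0 by rewrite -{1}gf0 aut_mulK.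
have good_of k K : (k = g \/ k = g^-1) -> graph_map k K -> k f0 = f0 ->
    forall y, Rpt E b y -> good SS K y.
  move=> kg kK kf0 y /Rreg[yb ry]; have [H1 H2 H3 _] := graph_map_good kK ry.
  split=> // _ ->; have sE z : inb z b -> s z = ev f0 z.
    by move=> /(inb_le bW)/WE ->.
  rewrite !sE //; last exact: (gb k K kg kK (y, ev f0 y) ry yb).
  by have [/(_ f0 (y, ev f0 y) erefl) + _ _ _] := kK; rewrite kf0 => ->.
have move_R k K : (k = g \/ k = g^-1) -> graph_map k K ->
    forall q, Rpt E b q.1 -> Rpt E b (K q).1.
  move=> kg kK q /Rreg[qb rq]; apply/Rreg; split; first exact: gb kg kK q rq qb.
  by have [_ _ + _] := kK; apply.
have gg : g = g \/ g = g^-1 by left.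
have gV : g^-1 = g \/ g^-1 = g^-1 by right.
have [|r [Zr rin rout]] := ZP G G'.
  split=> [q Rq|q Rq|y Ry|y Ry].
  - by split; [exact: move_R gg gG q Rq|exact: GG'].
  - by split; [exact: move_R gV gG' q Rq|exact: G'G].
  - exact: good_of gg gG gf0 y Ry.
  - exact: good_of gV gG' gVf0 y Ry.
exists r; split=> //.
- apply: ev_inj => z; have [Rz|nRz] := pselect (Rpt E b z); last exact: rout.
  have := rin f0 (G' (z, ev f0 z)); rewrite G'G /=; apply.
    exact: move_R gV gG' (z, ev f0 z) Rz.
  by have [/(_ f0 (z, ev f0 z) erefl) + _ _ _] := gG'; rewrite gVf0.
- by move=> f y nyb; apply: rout => -[].
- move=> f y yb; have [Ry|nRy] := pselect (Rpt E b y); last first.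
    have /Ex[i ->] : y \in E by apply: contrapT => /negP yE; apply: nRy.
    by rewrite !ev_x.
  have [GP Gf _ _] := gG; have [y1 [al alE]] := Gf y.
  have := rin (r^-1 (g f)) (y, ev (r^-1 (g f)) y) Ry erefl; rewrite aut_mulVK alE /=.
  have := GP f (y, ev f y) erefl; rewrite alE /= => ->.
  by move=> /(can_inj (aut_mulK al)) ->.
Qed.

Theorem small_stabilizer_aux : exists T : set F, finite_set T /\
  bnd (pointwise_stabilizer T).
Proof.
have /choice[bZ bZP] : forall j, exists bZ : B * set (aut F), [/\ bnd bZ.2,
    forall i, same_orbit j i -> inb (x i) bZ.1,
    forall y, inb y bZ.1 -> exists al : aut A, al (e j) = ev f0 y &
    forall g, g f0 = f0 ->
      (forall k K, (k = g \/ k = g^-1) -> graph_map k K ->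
        forall q, regular q.1 -> inb q.1 bZ.1 -> inb (K q).1 bZ.1) ->
      exists r, [/\ bZ.2 r, r f0 = f0, forall f y, ~ inb y bZ.1 -> ev (r f) y = ev f y &
        forall f y, inb y bZ.1 -> ev (r^-1 (g f)) y = ev f y]].
  by move=> j; have [b [Z H]] := orbit_block j; exists (b, Z).
pose blk j := (bZ (rep j)).1.
have blkU (s : seq 'I_n) : exists Z, bnd Z /\ forall g, g f0 = f0 ->
    (forall f y, (forall j, j \in s -> ~ inb y (blk j)) -> ev (g f) y = ev f y) -> Z g.
  elim: s => [|j s [Z [bndZ ZP]]].
    exists [set 1]; split; first exact: bnd_one.
    by move=> g _ gtriv; apply: graph_map_eq1 => f y; apply: gtriv.
  have [bndZj _ _ Zj] := bZP (rep j).
  exists (setmul (bZ (rep j)).2 Z); split; first exact: bnd_mul.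
  move=> g gf0 gout.
  (* A point [y] of block [j] is fixed or lands in a listed block [i]. In the latter case the values
     of [f0] at both points link [e (rep j)] to [e (rep i)] by an automorphism of [A], so the two
     blocks coincide. *)
  have fwd k K : (k = g \/ k = g^-1) -> graph_map k K ->
      forall q, regular q.1 -> inb q.1 (blk j) -> inb (K q).1 (blk j).
    move=> kg [KP Kf Kr Kn] [y a] /= ry yb.
    have kf0 : k f0 = f0 by case: kg => ->; rewrite // -{1}gf0 aut_mulK.
    have kout f z : (forall i, i \in j :: s -> ~ inb z (blk i)) -> ev (k f) z = ev f z.
      case: kg => ->; first exact: gout.
      exact: (@trivial_inv g (fun z => forall i, i \in j :: s -> ~ inb z (blk i)) gout).
    have [y1 [al alE]] := Kf y; rewrite alE /=.
    have alf f : ev (k f) y1 = al (ev f y) by have := KP f (y, ev f y) erefl; rewrite alE.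
    have [[i [ij y1i]]|N] := pselect (exists i, i \in j :: s /\ inb y1 (blk i)); last first.
      have y1y : y1 = y.
        apply: contrapT => ne; have [a1 [a2 a12]] := two_values.
        have [f [f' [ff' fy fy']]] := ev_separates a1 a2 ry ne.
        have N' i : i \in j :: s -> ~ inb y1 (blk i) by move=> ij y1i; apply: N; exists i.
        apply: a12; rewrite -fy -fy'; apply: (can_inj (aut_mulK al)).
        by rewrite -!alf !kout.
      by rewrite y1y.
    have [_ _ /(_ y1 y1i)[al1 al1E] _] := bZP (rep i).
    have [_ _ /(_ y yb)[al2 al2E] _] := bZP (rep j).
    have so : same_orbit (rep j) (rep i).
      exists (al1^-1 * (al * al2)); rewrite -[LHS]/(al1^-1 (al (al2 (e (rep j))))).
      by rewrite al2E -alf kf0 -al1E aut_mulK.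
    have rij : rep i = rep j.
      apply: rep_eq; apply: same_orbit_trans (same_orbit_sym (rep_orbit i)) _.
      exact: same_orbit_trans (same_orbit_sym so) (rep_orbit j).
    by move: y1i; rewrite /blk rij.
  have [r [Zr rf0 rout rin]] := Zj g gf0 fwd.
  exists r => //; exists (r^-1 * g); last by rewrite mulVKg.
  have rVf0 : r^-1 f0 = f0 by rewrite -{1}rf0 aut_mulK.
  apply: ZP; first by rewrite -[LHS]/(r^-1 (g f0)) gf0.
  move=> f y ys; rewrite -[(r^-1 * g) f]/(r^-1 (g f)).
  have [yb|nyb] := pselect (inb y (blk j)); first exact: rin.
  rewrite (@trivial_inv r (fun y => ~ inb y (blk j))) // gout // => i.
  by rewrite inE => /orP[/eqP ->|/ys].
have [Z2 [bZ2 Z2P]] := blkU (enum 'I_n).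
(* No [x i] is left outside the blocks, so [handled_all] applies to the remainder. *)
pose D := (~` \join_(j <- enum 'I_n) blk j)%O.
have DE y : inb y D <-> forall j, ~ inb y (blk j).
  have H (s : seq 'I_n) : inb y (\join_(j <- s) blk j)%O <-> exists j, j \in s /\ inb y (blk j).
    elim: s => [|j s IH]; first by rewrite big_nil; split=> [/inb0|[? []]].
    rewrite big_cons inbU IH; split=> [[yj|[i [si yi]]]|[i []]].
    - by exists j; rewrite inE eqxx.
    - by exists i; rewrite inE si orbT.
    - by rewrite inE => /orP[/eqP ->|si yi]; [left|right; exists i].
  rewrite inbC H; split=> [N j yj|N [j [_ yj]]]; last exact: N yj.
  by apply: N; exists j; rewrite mem_enum.
have xD i : ~ inb (x i) D.
  move=> /DE /(_ i); apply; have [_ + _ _] := bZP (rep i); apply; exact: rep_orbit.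
have [T [Z1 [Tf TE bZ1 Z1P]]] := handled_all xD.
exists (T `|` [set f0])%classic; split.
  by rewrite finite_setU; split=> //; exact: finite_set1.
apply: (bnd_sub bndP _ (bnd_mul bndP bZ1 bZ2)) => g gT.
have gf0 : g f0 = f0 by apply: gT; right.
have [|h [Z1h hout hfix hg]] := Z1P g _ gf0; first by move=> f Tf'; apply: gT; left.
have hf0 : h f0 = f0 by apply: hfix.
exists h => //; exists (h^-1 * g); last by rewrite mulVKg.
apply: Z2P.
  by rewrite -[LHS]/(h^-1 (g f0)) gf0 -{1}hf0 aut_mulK.
move=> f y yD; apply: hg; apply/DE => j; apply: yD; exact: mem_enum.
Qed.

End Decomposition.

Theorem small_stabilizer : exists T : set F, finite_set T /\ bnd (pointwise_stabilizer T).
Proof. by have [f0] := algebra_nonempty F; exact: small_stabilizer_aux f0. Qed.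

End Bornology.

End PointAction.
End Automorphisms.

(** * Small index and countable strong chains *)

Section Bornologies.
Local Open Scope group_scope.
Variable G : groupType.
Implicit Types (H : set G) (U : nat -> set G).

(** Diagonalization: if every index [k] failed with [V k], the failing elements would form one
    sequence [c] that contradicts the hypothesis. *)
Lemma piece_criterion (bnd : set (set G)) (V : nat -> set G) : (forall k, bnd (V k)) ->
  forall (T : Type) (one : T) (C : nat -> set T) (Pi : (nat -> T) -> G),
  (forall c, (forall k, C k (c k)) -> exists k u v,
    [/\ forall j, C j (u j), forall j, C j (v j), u k = one, v k = c k
      & V k ((Pi u)^-1 * Pi v)]) ->
  exists k Z, bnd Z /\ forall c, C k c -> exists u v,
    [/\ forall j, C j (u j), forall j, C j (v j), u k = one, v k = c
      & Z ((Pi u)^-1 * Pi v)].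
Proof.
move=> bV T one C Pi H; apply: contrapT => N.
have /choice[c cP] : forall k, exists c, C k c /\ ~ exists u v,
    [/\ forall j, C j (u j), forall j, C j (v j), u k = one, v k = c
      & V k ((Pi u)^-1 * Pi v)].
  move=> k; apply: contrapT => Nk; apply: N; exists k, (V k); split=> // c Ckc.
  by apply: contrapT => Nc; apply: Nk; exists c.
have [k [u [v kuv]]] := H c (fun k => (cP k).1).
by have [_ []] := cP k; exists u, v.
Qed.

(** With so few cosets, two of the [g S] share one, which gives [bnd_pair]. For [bnd_piece] take the
    products of [c] restricted to [S]: at an index where [S] and [S'] differ, the two factors are
    [one] and [c m]. *)
Lemma small_index_bornology H : is_subgroup H ->
  card_lt (left_cosets H) [set: nat -> bool] -> ample_bornology [set S | S `<=` H].
Proof.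
move=> /is_subgroupP[H1 HM HV] /andP[Hle /negP Hne].
have pair (g : (nat -> bool) -> G) : exists S S' m,
    [/\ S m = false, S' m = true & H ((g S)^-1 * g S')].
  apply: contrapT => N; apply: Hne; rewrite card_eq_le Hle /=.
  apply: (@card_le_of_inj _ _ _ _ (fun S => [set g S * h | h in H])).
    by move=> S _; exists (g S).
  move=> S S' _ _ SS'; apply/funext => m; apply: contrapT => ne.
  have HSS' (S1 S2 : nat -> bool) : [set g S1 * h | h in H] = [set g S2 * h | h in H] ->
      H ((g S1)^-1 * g S2).
    move=> E; have [h Hh] : [set g S1 * h | h in H] (g S2).
      by rewrite E; exists 1; rewrite ?mulg1.
    by move=> <-; rewrite mulKg.
  case Sm: (S m) ne => ne; case S'm: (S' m) ne => // _; apply: N.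
    by exists S', S, m; split=> //; exact: HSS'.
  by exists S, S', m; split=> //; exact: HSS'.
split.
- by move=> S S' SS' /(subset_trans SS').
- by move=> _ ->.
- by move=> S S' HS HS' g [/HS|/HS'].
- by move=> S S' HS HS' _ [g /HS Hg [h /HS' Hh <-]]; exact: HM.
- by move=> S HS _ [g /HS Hg <-]; exact: HV.
- by move=> g; have [S [S' [m [Sm S'm HSS']]]] := pair g; exists S, S', m; split=> // _ ->.
- move=> T one C Pi Cone; apply: (piece_criterion (V := fun=> H)) => [k /=|c Cc]; first exact: subset_refl.
  have [S [S' [m [Sm S'm HSS']]]] := pair (fun S => Pi (fun j => if S j then c j else one)).
  exists m, (fun j => if S j then c j else one), (fun j => if S' j then c j else one).
  by split=> // [j|j||]; [case: ifP|case: ifP|rewrite Sm|rewrite S'm].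
Qed.

Lemma nat_strong_chain_mono U i j : nat_strong_chain U -> (i <= j)%N -> U i `<=` U j.
Proof.
move=> [_ UP _ _ _] /subnK <-; elim: (j - i)%N => [//|k IH].
exact: subset_trans IH (UP _).
Qed.

Lemma nat_strong_chain_in U g : nat_strong_chain U -> exists i, U i g.
Proof.
by move=> [_ _ Ucov _ _]; have [i _ Ui] : (\bigcup_i U i) g; [rewrite Ucov|exists i].
Qed.

(** Any single element lies in some member of the chain. In [bnd_piece] the quotient for the whole
    sequence [c] lies in some [U k], and this [k] is the index to use. *)
Lemma strong_chain_bornology U : nat_strong_chain U ->
  ample_bornology [set S | exists n, S `<=` U n].
Proof.
move=> Uc; have [_ _ _ UV UM] := Uc.
have Umono i j := @nat_strong_chain_mono U i j Uc.
have Uin g := nat_strong_chain_in g Uc.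
split.
- by move=> S S' SS' [i /(subset_trans SS')]; exists i.
- by have [i Ui] := Uin 1; exists i => _ ->.
- move=> S S' [i Si] [j S'j]; exists (maxn i j) => g [/Si|/S'j]; apply: Umono.
    exact: leq_maxl.
  exact: leq_maxr.
- move=> S S' [i Si] [j S'j]; have [k Uk] := UM (maxn i j).
  exists k => _ [g /Si Ug [h /S'j Uh <-]]; apply: Uk; exists g.
    by apply: Umono Ug; exact: leq_maxl.
  by exists h => //; apply: Umono Uh; exact: leq_maxr.
- by move=> S [i Si]; exists i => _ [g /Si Ug <-]; rewrite UV; exists g.
- move=> g; have [i Ui] := Uin ((g xpred0)^-1 * g xpredT).
  by exists xpred0, xpredT, 0%N; split=> //; exists i => _ ->.
- move=> T one C Pi Cone; apply: (piece_criterion (V := U)) => [k|c Cc]; first by exists k.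
  have [k Uk] := Uin ((Pi (fun=> one))^-1 * Pi c).
  by exists k, (fun=> one), c.
Qed.

End Bornologies.

Section Stabilizers.
Local Open Scope group_scope.
Variables (L : signature) (M : algebra L).

(** The double coset of [g] depends only on the orbit of the tuple [t] followed by its image under
    [g]. *)
Lemma finite_double_cosets (T : set M) : finitely_many_orbits M -> finite_set T ->
  exists (K : finType) (r : K -> aut M), forall g, exists k a b,
  [/\ pointwise_stabilizer T a, pointwise_stabilizer T b & g = a * (r k * b)].
Proof.
move=> Mo /finite_seqP[t ->]; have [K [orb orbP]] := Mo (size t + size t)%N.
pose w (g : aut M) i := match fintype.split i with
  | inl j => tnth (in_tuple t) j
  | inr j => g (tnth (in_tuple t) j) end.
have /choice[r rP] : forall k, exists r, (exists g, orb (w g) = k) -> orb (w r) = k.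
  move=> k; have [[g gk]|N] := pselect (exists g, orb (w g) = k); first by exists g.
  by exists (aut_one M).
exists K, r => g; exists (orb (w g)).
have [a aP] := orbP _ _ (rP _ (ex_intro _ g erefl)).
have tE f : f \in t -> a f = f /\ a (r (orb (w g)) f) = g f.
  move=> ft; have /tnthP[j fj] : f \in in_tuple t by [].
  split.
    by have := aP (lshift _ j); rewrite /w (unsplitK (inl j : _ + 'I_(size t))) -fj.
  by have := aP (rshift _ j); rewrite /w (unsplitK (inr j : 'I_(size t) + _)) -fj.
exists a, ((a * r (orb (w g)))^-1 * g); split.
- by move=> f /tE[].
- move=> f /tE[_ af]; rewrite -[LHS]/((a * r (orb (w g)))^-1 (g f)) -af.
  exact: (aut_mulK (a * r (orb (w g)))).
- by rewrite mulgA mulVKg.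
Qed.

Lemma bounded_stabilizer_no_chain : finitely_many_orbits M ->
  (forall bnd : set (set (aut M)), ample_bornology bnd ->
    exists T, finite_set T /\ bnd (pointwise_stabilizer T)) ->
  ~ exists U : nat -> set (aut M), nat_strong_chain U.
Proof.
move=> Mo stab [U Uc]; have bU := strong_chain_bornology Uc.
have [T [Tf bT]] := stab _ bU; have [K [r rP]] := finite_double_cosets Mo Tf.
have [Uproper _ _ _ _] := Uc.
have br : [set S | exists n, S `<=` U n] (range r).
  have /choice[N NP] := fun k => nat_strong_chain_in (r k) Uc.
  exists (\max_k N k)%N => _ [k _ <-]; apply: nat_strong_chain_mono (NP k) => //; exact: leq_bigmax.
have [i Ui] := bnd_mul bU bT (bnd_mul bU br bT).
apply: (Uproper i); apply/seteqP; split=> // g _; apply: Ui.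
have [k [a [b [aT bT' ->]]]] := rP g.
by exists a => //; exists (r k * b) => //; exists (r k) => //; exists b.
Qed.

(** Used in contraposition: the power is infinite because its automorphism group is. *)
Lemma finite_aut : finite_set [set: M] -> finite_set [set: aut M].
Proof.
move=> /finite_seqP[s sE].
have Ms f : f \in s by have : [set: M] f by []; rewrite sE.
pose K := {ffun 'I_(size s) -> 'I_(size s).+1}.
pose code (g : aut M) : K := [ffun i => inord (index (g (tnth (in_tuple s) i)) s)].
apply: (@card_le_finite _ _ _ [set: K]); last exact: finite_finset.
apply: (@card_le_of_inj _ _ _ _ code) => // g h _ _ gh; apply: aut_ext => f.
have /tnthP[i ->] : f \in in_tuple s by exact: Ms.
move/ffunP: gh => /(_ i); rewrite !ffunE => /(congr1 val) /=.
rewrite !inordK ?ltnS ?index_size // => gh.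
by rewrite -[LHS](nth_index f (Ms _)) gh nth_index.
Qed.

End Stabilizers.

(** * Countability, orbits on tuples and the final assembly *)

Section Labels.
Context {d : Order.disp_t}.
Variable B : ctbDistrLatticeType d.

(** If the same labels occur on both sides and each listed pair is cut out by the same set of
    labels, then corresponding leaves carry the same labels and are empty together. *)
Lemma pattern_labels (K : Type) (lam mu : stone B -> K) pts u v (l : seq (B * B)) :
  (forall k, (exists y, inb y u /\ lam y = k) <-> (exists z, inb z v /\ mu z = k)) ->
  (forall pq, pq \in pts -> lam pq.1 = mu pq.2 /\ (inb pq.1 u <-> inb pq.2 v)) ->
  (forall bc, bc \in l -> exists S : set K,
    (forall y, inb y bc.1 <-> S (lam y)) /\ forall z, inb z bc.2 <-> S (mu z)) ->
  pattern pts u v l.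
Proof.
elim: l u v => [|[b c] l IH] u v uv ptsP lP /=.
  split; last by move=> pq /ptsP[].
  split=> H; apply: contrapT => /eqP /exists_point[y].
    by move=> yv; have [z [zu _]] := (iffRL (uv _) (ex_intro _ y (conj yv erefl)));
      rewrite H in zu; exact: inb0 zu.
  by move=> yu; have [z [zv _]] := (iffLR (uv _) (ex_intro _ y (conj yu erefl)));
    rewrite H in zv; exact: inb0 zv.
have [S [bS cS]] := lP (b, c) (mem_head _ _); rewrite /= in bS cS.
have lP' bc : bc \in l -> exists S : set K,
    (forall y, inb y bc.1 <-> S (lam y)) /\ forall z, inb z bc.2 <-> S (mu z).
  by move=> bcl; apply: lP; rewrite inE bcl orbT.
split; apply: IH => //.
- move=> k; split=> [[y [/inbI[yu yb] yk]]|[z [/inbI[zv zc] zk]]].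
    have [z [zv zk]] := iffLR (uv k) (ex_intro _ y (conj yu yk)).
    by exists z; split=> //; apply/inbI; split=> //; apply/cS; rewrite zk -yk; exact/bS.
  have [y [yu yk]] := iffRL (uv k) (ex_intro _ z (conj zv zk)).
  by exists y; split=> //; apply/inbI; split=> //; apply/bS; rewrite yk -zk; exact/cS.
- by move=> pq /ptsP[pqE pqi]; split=> //; rewrite !inbI pqi bS cS pqE.
- move=> k; split=> [[y [/inbD[yu yb] yk]]|[z [/inbD[zv zc] zk]]].
    have [z [zv zk]] := iffLR (uv k) (ex_intro _ y (conj yu yk)).
    by exists z; split=> //; apply/inbD; split=> //; rewrite cS zk -yk -bS.
  have [y [yu yk]] := iffRL (uv k) (ex_intro _ z (conj zv zk)).
  by exists y; split=> //; apply/inbD; split=> //; rewrite bS yk -zk -cS.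
- by move=> pq /ptsP[pqE pqi]; split=> //; rewrite !inbD pqi bS cS pqE.
Qed.

End Labels.

Section Main.
Variables (L : signature) (A : algebra L).
Context {d : Order.disp_t}.
Variable B : ctbDistrLatticeType d.
Variables (n : nat) (x : 'I_n -> stone B) (e : 'I_n -> A).
Hypotheses (x_distinct : injective x) (e_idempotent : forall i, idempotent_element (e i)).
Hypotheses (B_countable : countable [set: B]) (B_atomless : atomless B).
Hypothesis A_finite : finite_set [set: A].
Local Notation F := (filtered_boolean_power x_distinct e_idempotent).
Implicit Types (f : F) (y z : stone B).

Let encoding : exists N (enc : A -> 'I_N.+1), injective enc.
Proof.
have /finite_seqP[s sE] := A_finite.
have As a : a \in s by have : [set: A] a by []; rewrite sE.
exists (size s), (fun a => inord (index a s)) => a a' /(congr1 val) /=.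
rewrite !inordK ?ltnS ?index_size // => aa'.
by rewrite -[LHS](nth_index a (As _)) aa' nth_index.
Qed.

(** An element is determined by its finitely many level sets, which are clopen. *)
Lemma countable_power : countable [set: F].
Proof.
have [N [enc encI]] := encoding; have /countable_injP[cd cdI] := B_countable.
have /choice[cl clP] : forall p : F * 'I_N.+1, exists b,
    forall y, inb y b <-> enc (ev p.1 y) = p.2.
  move=> [f k] /=; apply: (@lc_set_clopen _ B (fun y => enc (ev f y) = k)) => y.
  exact: (lc_comp (fun a => enc a = k) (ev_lc f y)).
pose code f : {ffun 'I_N.+1 -> nat} := [ffun k => cd (cl (f, k))].
apply: (card_le_trans (B := [set: {ffun 'I_N.+1 -> nat}])); last exact: countableP.
apply: (@card_le_of_inj _ _ _ _ code) => // f f' _ _ ff'; apply: ev_inj => y; apply: encI.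
have /esym clE : cl (f, enc (ev f y)) = cl (f', enc (ev f y)).
  by move/ffunP: ff' => /(_ (enc (ev f y))); rewrite !ffunE; apply: cdI; rewrite inE.
by have /clP /= -> : inb y (cl (f', enc (ev f y))) by rewrite clE; apply/clP.
Qed.

(** The colour of a tuple is the set of value vectors it attains. For equal colours, a homeomorphism
    fixing every [x i] carries the level sets of one tuple to those of the other. *)
Lemma oligomorphic_power : finitely_many_orbits F.
Proof.
move=> m; have [N [enc encI]] := encoding.
pose lab (v : 'I_m -> F) y := [ffun i => enc (ev (v i) y)].
exists {set {ffun 'I_m -> 'I_N.+1}}, (fun v => [set k | `[< exists y, lab v y = k >]]%SET).
move=> v w vw; have lc_lab u y : lc_at (lab u) y.
  apply/lc_atP; have : \forall z \near y, forall i, ev (u i) z = ev (u i) y.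
    apply: (@filter_forall _ _ (fun i => [set z | ev (u i) z = ev (u i) y]) (nbhs y)) => i.
    by apply/(lc_atP (ev (u i))); exact: ev_lc.
  by apply: filterS => z zE; apply/ffunP => i; rewrite !ffunE zE.
have /choice[cl clP] : forall p : ('I_m -> F) * {ffun 'I_m -> 'I_N.+1}, exists b,
    forall y, inb y b <-> lab p.1 y = p.2.
  move=> [u k] /=; apply: (@lc_set_clopen _ B (fun y => lab u y = k)) => y.
  exact: (lc_comp (fun l => l = k) (lc_lab u y)).
pose l0 := [seq (cl (v, k), cl (w, k)) | k <- enum {: {ffun 'I_m -> 'I_N.+1}}].
pose pts := [seq (x i, x i) | i <- enum 'I_n].
have [||phi [psi [phiP phil phix]]] := @exists_homeo _ B B_atomless B_countable pts l0.
- by move=> _ _ /mapP[i _ ->] /mapP[j _ ->].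
- apply: (@pattern_labels _ B _ (lab v) (lab w)).
  + move=> k; have /setP/(_ k) := vw; rewrite !inE => kE.
    split=> [[y [_ yk]]|[y [_ yk]]].
      have /asboolP[z zk] : `[< exists z, lab w z = k >] by rewrite -kE; apply/asboolP; exists y.
      by exists z; split=> //; exact: inbT.
    have /asboolP[z zk] : `[< exists z, lab v z = k >] by rewrite kE; apply/asboolP; exists y.
    by exists z; split=> //; exact: inbT.
  + move=> _ /mapP[i _ ->]; split; last by split=> _; exact: inbT.
    by apply/ffunP => j; rewrite !ffunE !ev_x.
  + by move=> _ /mapP[k _ ->]; exists [set k]; split=> y; exact: clP.
have [|h hE] := homeo_act x_distinct e_idempotent phiP.
  by move=> i; apply: (phix (x i, x i)); apply/mapP; exists i; rewrite ?mem_enum.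
exists h => i; apply: ev_inj => z; have [_ psiK _ _] := phiP; rewrite -[z]psiK hE.
apply: encI; set y := psi z.
have /clP/ffunP/(_ i) : inb (phi y) (cl (w, lab v y)).
  apply/(phil (cl (v, lab v y), cl (w, lab v y))); last exact/clP.
  by apply/mapP; exists (lab v y); rewrite ?mem_enum.
by rewrite !ffunE.
Qed.

Hypothesis A_simple : simple_algebra A.

(** The automorphisms are told apart by where they send one regular point. *)
Lemma infinite_aut_power : infinite_set [set: aut F].
Proof.
have [r [_ rx]] : exists r, inb r \top%O /\ r \notin [seq x i | i <- enum 'I_n].
  by apply: fresh_point; first exact: B_atomless; apply/eqP => /esym; exact: B_atomless.1.
have [|b [rb xb]] := @regular_sep _ B _ x r.
  by move=> i xr; move/negP: rx; apply; rewrite -xr; apply/mapP; exists i; rewrite ?mem_enum.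
have [|q [qI qb]] := cantor_points B_atomless (b := b); first by apply/neq0_point; exists r.
have /choice[h hP] : forall S, exists h : aut F, exists phi, hom_act h phi /\ phi (q xpred0) = q S.
  move=> S; have [||h [phi [psi [_ _ hphi phiq]]]] :=
    @homeo_moving _ A _ B n x e x_distinct e_idempotent B_countable B_atomless b
      [:: (q xpred0, q S)] xb.
  - by move=> _ _ /[!inE] /eqP -> /eqP ->.
  - by move=> _ /[!inE] /eqP ->; split; exact: qb.
  by exists h, phi; split=> //; exact: (phiq _ (mem_head _ _)).
apply/infiniteP; apply: (@card_le_of_inj _ _ _ _ (fun k => h (eq_op k))) => // j k _ _ hjk.
suff : q (eq_op j) = q (eq_op k) by move=> /qI/(congr1 (fun S => S k)); rewrite eqxx => /eqP.
have [phi [Hphi phij]] := hP (eq_op j); have [phi' [Hphi' phik]] := hP (eq_op k).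
apply: contrapT => ne; have [a1 [a2 a12]] := two_values A_simple.
have [|f [f' [E fa fa']]] := ev_separates x_distinct e_idempotent a1 a2 _ ne.
  by move=> i xk; apply: (xb i); rewrite xk; exact: qb.
apply: a12; rewrite -fa -fa'.
have H f1 : ev f1 (q (eq_op j)) = ev f1 (q (eq_op k)).
  rewrite -phij -phik -(aut_mulVK (h (eq_op j)) f1) Hphi.
  by rewrite hjk Hphi'.
by rewrite -!H.
Qed.

End Main.

Theorem theorem1p3
    (L : signature) (A : algebra L)
    (A_finite : finite_set [set: A])
    (A_simple : simple_algebra A)
    (A_malcev : malcev A)
    (A_nonabelian : ~ abelian_algebra A)
    (n : nat) (e : 'I_n -> A)
    (e_idempotent : forall i, idempotent_element (e i))
    (d : Order.disp_t) (B : ctbDistrLatticeType d)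
    (B_countable : countable [set: B])
    (B_atomless : atomless B)
    (x : 'I_n -> stone B) (x_distinct : injective x) :
  let F := filtered_boolean_power x_distinct e_idempotent in
  omega_categorical F /\
  small_index_property F /\
  (uncountable_strong_cofinality (aut F) /\
   uncountable_cofinality (aut F) /\
   bergman_property (aut F)).
Proof.
move=> F.
have Fc : countable [set: F] by exact: countable_power.
have Fo : finitely_many_orbits F by exact: oligomorphic_power.
have Gi : infinite_set [set: aut F] by exact: infinite_aut_power.
have stab bnd : ample_bornology bnd ->
    exists T : set F, finite_set T /\ bnd (pointwise_stabilizer T).
  exact: small_stabilizer.
have Fi : infinite_set [set: F] by move=> /finite_aut.
split; first exact: ryll_nardzewski.
split.
  split; first by rewrite card_eq_le; apply/andP; split; [exact: Fc|exact/infiniteP].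
  by move=> H Hs Hc; exact: (stab _ (small_index_bornology Hs Hc)).
by have [] := uncountable_cofinalities Gi (bounded_stabilizer_no_chain Fo stab).
Qed.
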